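(* Let $n\ge1$, let $Q\in\mathcal{D}$, and let $\Phi_n:[0,\infty)\to\mathbb{R}$ be the function given in the context. Take a function $\varphi\in L^1_{loc}(\mathbb{R}^n)$ such that $N\varphi$ is not identically infinite on $Q$ and $\varphi|_Q\in\mathrm{BMO}^d(Q)$. Let $L=\inf_QN\varphi$ and $t=\inf_QN\varphi-\langle\varphi\rangle_Q$. Then $$\langle N\varphi\rangle_Q\le L+\Phi_n(t)\,\|\varphi\|_{\mathrm{BMO}^d(Q)},\qquad(\mathrm{I})$$ where $\Phi_n$ is a decreasing, convex function on $[0,\infty)$ satisfying $$\Phi_n\big(k(2^{n/2}-2^{-n/2})\big)=2^{-nk}$$ for all non-negative integers $k$. Consequently, if $\varphi\in\mathrm{BMO}^d(\mathbb{R}^n)$, then $N\varphi\in\mathrm{BLO}^d(\mathbb{R}^n)$ and $$\|N\varphi\|_{\mathrm{BLO}^d(\mathbb{R}^n)}\le\|\varphi\|_{\mathrm{BMO}^d(\mathbb{R}^n)}.\qquad(\mathrm{II})$$ Both inequalities (I) and (II) are sharp. Sharpness of (I) means: for any dyadic cube $Q$, any real number $L$, and any $t\ge0$, there exists a sequence of functions $\{\varphi_j\}$ such that $\varphi_j|_Q\in\mathrm{BMO}^d(Q)$ with $\|\varphi_j\|_{\mathrm{BMO}^d(Q)}=1$, $\inf_QN\varphi_j=L$, $\inf_QN\varphi_j-\langle\varphi_j\rangle_Q=t$, and $\lim_{j\to\infty}\langle N\varphi_j\rangle_Q=L+\Phi_n(t)$. Sharpness of (II) means: there is a sequence $\{\varphi_j\}$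 of functions from $\mathrm{BMO}^d(\mathbb{R}^n)$ such that $\|\varphi_j\|_{\mathrm{BMO}^d(\mathbb{R}^n)}=1$ for all $j$ and $\|N\varphi_j\|_{\mathrm{BLO}^d(\mathbb{R}^n)}\to1$ as $j\to\infty$. Moreover, both inequalities (I) and (II) remain true if the operator $N$ is replaced with the operator $M$, and inequality (II) remains sharp under this replacement.
   Context: $\mathcal{D}$ is the collection of all open dyadic cubes in $\mathbb{R}^n$; for a cube $Q$, $\mathcal{D}(Q)$ is the collection of all dyadic subcubes of $Q$. $\langle\varphi\rangle_J=\frac1{|J|}\int_J\varphi$ (Lebesgue measure). Throughout, ''$\inf$'' of a function over a set means the essential infimum. $\mathrm{BMO}^d(\mathbb{R}^n)=\{\varphi\in L^2_{loc}:\ \|\varphi\|_{\mathrm{BMO}^d}:=\sup_{J\in\mathcal{D}}(\langle\varphi^2\rangle_J-\langle\varphi\rangle_J^2)^{1/2}<\infty\}$; $\mathrm{BMO}^d(Q)$ and $\|\cdot\|_{\mathrm{BMO}^d(Q)}$ are defined in the same way with the supremum taken over all $J\in\mathcal{D}(Q)$. $\mathrm{BLO}^d(\mathbb{R}^n)=\{\varphi\in L^1_{loc}:\ \|\varphi\|_{\mathrm{BLO}^d}:=\sup_{J\in\mathcal{D}}(\langle\varphi\rangle_J-\inf_J\varphi)<\infty\}$. The natural dyadic maximal operator is $N\varphi(x)=\sup_{J\ni x,\,J\in\mathcal{D}}\langle\varphi\rangle_J$, and the classical dyadic maximal operator is $M\varphi(x)=\sup_{J\ni x,\,J\in\mathcal{D}}\langle|\varphi|\rangle_J$.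 The function $\Phi_n$: put $\alpha=2^{-n}$, $\tau=\frac1{\sqrt\alpha}-\sqrt\alpha$, $p_0=\frac12\sqrt\alpha+\frac1{2\sqrt\alpha}-1$, $p_k=p_0-k\tau$ for $k\ge1$, and $$f(y)=\tfrac1{27}\big(2y^3+2y^2\sqrt{y^2+3}+9y+6\sqrt{y^2+3}\big).$$ For $p\le0$ let $$b(p)=\begin{cases}\alpha^kf(p+k\tau+1),& p_{k+1}\le p\le-k\tau,\ k\ge0,\\ \alpha^k(p+k\tau+1),& -k\tau\le p\le p_k,\ k\ge1.\end{cases}$$ Then $\Phi_n(t)=b(-t)$ for $t\ge0$.
   Formalization: (I) is false for norm c>1: proved with Φ_n(t/c)·c, and as written for c≤1. (II) fails for log|x|: assumes Nφ (resp. Mφ) not identically infinite on any dyadic cube. In (I) for M, t uses ⟨|φ|⟩_Q instead of ⟨φ⟩_Q, as the literal form is false. *)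

(* Defs.v *)
From HB Require Import structures.
From mathcomp Require Import all_boot all_order all_algebra.
From mathcomp Require Import all_classical all_reals all_analysis.
From mathcomp Require Import measurable_realfun.
From mathcomp Require Import ring lra.

Set Implicit Arguments.
Unset Strict Implicit.
Unset Printing Implicit Defensive.

Import Order.TTheory GRing.Theory Num.Theory.
Import numFieldNormedType.Exports.

Local Open Scope classical_set_scope.
Local Open Scope ring_scope.

(** * Lebesgue measure on R^n *)

(* R^n, with the product of the Borel sigma-algebras. *)
Notation Rn R n := (n.-tuple (measurableTypeR R)).

Section lebesgue_step.
Local Open Scope ereal_scope.
Context {R : realType} {n : nat}.
Variable mu : {sigma_finite_measure set (Rn R n) -> \bar R}.

Definition cons_tuple (p : measurableTypeR R * Rn R n) : Rn R n.+1 :=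
  [tuple of p.1 :: p.2].

Definition uncons_tuple (x : Rn R n.+1) : measurableTypeR R * Rn R n :=
  (thead x, [tuple of behead x]).

Lemma measurable_cons_tuple : measurable_fun setT cons_tuple.
Proof. by apply: measurable_cons. Qed.

Lemma measurable_uncons_tuple : measurable_fun setT uncons_tuple.
Proof.
apply: measurable_fun_pair; last exact: measurable_behead.
exact: (measurable_tnth ord0).
Qed.

Lemma uncons_tupleK : cancel uncons_tuple cons_tuple.
Proof. by move=> x; rewrite /cons_tuple/= -tuple_eta. Qed.

Lemma cons_tupleK : cancel cons_tuple uncons_tuple.
Proof. by move=> [a x]; rewrite /uncons_tuple theadE; congr pair; exact/val_inj. Qed.

Definition lebesgue_step : set (Rn R n.+1) -> \bar R :=
  pushforward (@lebesgue_measure R \x mu) cons_tuple.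

Let lebesgue_step0 : lebesgue_step set0 = 0.
Proof. by rewrite /lebesgue_step /pushforward preimage_set0 measure0. Qed.

Let measurable_preimage_cons (A : set (Rn R n.+1)) :
  measurable A -> measurable (cons_tuple @^-1` A).
Proof. by move=> mA; rewrite -[X in measurable X]setTI; exact: measurable_cons_tuple. Qed.

Let lebesgue_step_ge0 A : 0 <= lebesgue_step A.
Proof. by rewrite /lebesgue_step /pushforward measure_ge0. Qed.

Let lebesgue_step_sigma_additive : semi_sigma_additive lebesgue_step.
Proof.
move=> F mF tF mUF; rewrite /lebesgue_step /pushforward preimage_bigcup.
apply: measure_semi_sigma_additive.
- by move=> k; exact: measurable_preimage_cons.
- apply/trivIsetP => /= i j _ _ ij; rewrite -preimage_setI.
  by move/trivIsetP : tF => /(_ _ _ _ _ ij) ->//; rewrite preimage_set0.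
- by rewrite -preimage_bigcup; exact: measurable_preimage_cons.
Qed.

HB.instance Definition _ := isMeasure.Build _ _ _ lebesgue_step
  lebesgue_step0 lebesgue_step_ge0 lebesgue_step_sigma_additive.

Let lebesgue_step_sigma_finite : sigma_finite setT lebesgue_step.
Proof.
have /sigma_finiteP[F [TF ndF Foo]] := sigma_finiteT (@lebesgue_measure R).
have /sigma_finiteP[G [TG ndG Goo]] := sigma_finiteT mu.
exists (fun k => uncons_tuple @^-1` (F k `*` G k)).
  rewrite -preimage_bigcup -[LHS](preimage_setT uncons_tuple); congr (_ @^-1` _).
  rewrite -setXTT TF TG predeqE => -[x y]; split.
    move=> [/= [k _ Fkx] [l _ Gly]]; exists (maxn k l) => //; split.
    - by move: x Fkx; exact/subsetPset/ndF/leq_maxl.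
    - by move: y Gly; exact/subsetPset/ndG/leq_maxr.
  by move=> [k _ []/= ? ?]; split; exists k.
move=> k; have [mF Fk] := Foo k; have [mG Gk] := Goo k; split.
  by rewrite -[X in measurable X]setTI; apply: measurable_uncons_tuple => //; exact: measurableX.
rewrite /lebesgue_step /pushforward -comp_preimage.
rewrite (_ : uncons_tuple \o cons_tuple = id); last by apply/funext; exact: cons_tupleK.
by rewrite preimage_id product_measure1E// lte_mul_pinfty// ge0_fin_numE.
Qed.

HB.instance Definition _ := Measure_isSigmaFinite.Build _ _ _ lebesgue_step
  lebesgue_step_sigma_finite.

Lemma lebesgue_stepE (A : set (measurableTypeR R)) (B : set (Rn R n)) :
  measurable A -> measurable B ->
  lebesgue_step [set x | A (thead x) /\ B [tuple of behead x]] =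
  lebesgue_measure A * mu B.
Proof.
move=> mA mB; rewrite -product_measure1E// /lebesgue_step /pushforward.
congr ((_ \x _) _); apply/seteqP; split => -[a x] /=;
  by rewrite theadE (_ : [tuple of behead (a :: x)] = x)//; exact/val_inj.
Qed.

End lebesgue_step.

Fixpoint lebesgue_rec (R : realType) (n : nat) :
    {sigma_finite_measure set (Rn R n) -> \bar R} :=
  match n with
  | 0 => \d_([tuple] : Rn R 0)
  | n'.+1 => lebesgue_step (lebesgue_rec R n')
  end.

Definition lebesgue {R : realType} {n : nat} : set (Rn R n) -> \bar R :=
  lebesgue_rec R n.
HB.instance Definition _ (R : realType) n :=
  SigmaFiniteMeasure.on (@lebesgue R n).

Lemma lebesgue_box (R : realType) n (A : 'I_n -> set (measurableTypeR R)) :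
  (forall i, measurable (A i)) ->
  lebesgue [set x : Rn R n | forall i, A i (tnth x i)] =
  (\prod_(i < n) lebesgue_measure (A i))%E.
Proof.
elim: n A => [|n IH] A mA.
  rewrite big_ord0 /lebesgue/= diracE mem_set//=; by case.
rewrite big_ord_recl -IH// -lebesgue_stepE//; last first.
  rewrite (_ : [set x | _] =
    \bigcap_(i in [set: 'I_n]) ((fun x => tnth x i) @^-1` A (lift ord0 i))).
    apply: fin_bigcap_measurable => // i _.
    by rewrite -[X in measurable X]setTI; exact: measurable_tnth.
  by apply/seteqP; split => x /= h i; [move=> _|]; apply: h.
congr (lebesgue_step _ _); apply/seteqP; split => x /=.
  move=> h; split=> [|i]; first exact: h ord0.
  by rewrite (_ : tnth _ i = tnth x (lift ord0 i))//; rewrite [in RHS](tuple_eta x) tnthS.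
move=> [h0 h] i; have [j ->|->//] := unliftP ord0 i.
by rewrite (tuple_eta x) tnthS; exact: h.
Qed.

(** * Dyadic cubes, averages and the spaces *)

Section dyadic.
Context {R : realType} {n : nat}.
Local Notation mu := (@lebesgue R n).
Implicit Types (J K Q : set (Rn R n)) (phi : Rn R n -> R) (f : Rn R n -> \bar R).
Implicit Types C : set (set (Rn R n)).

(* The open cube with side 2^(-m) and lower corner 2^(-m) z. *)
Definition cube (m : int) (z : 'I_n -> int) : set (Rn R n) :=
  [set x | forall i,
    (2 : R) ^ (- m) * (z i)%:~R < tnth x i < (2 : R) ^ (- m) * (z i + 1)%:~R].

Definition dyadic : set (set (Rn R n)) :=
  [set J | exists m z, J = cube m z].

Definition dyadic_in Q : set (set (Rn R n)) :=
  [set J | dyadic J /\ J `<=` Q].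

(* Averages: [mean] for real functions, [emean] for functions, such as maximal
   functions, that may take infinite values. *)
Definition mean J phi : R := (fine (mu J))^-1 * \int[mu]_(x in J) phi x.

Definition emean J f : \bar R := (((fine (mu J))^-1)%:E * \int[mu]_(x in J) f x)%E.

(* Essential infimum over J; [ess_inf] is the case J = setT. *)
Definition ess_inf_on J f : \bar R :=
  ereal_sup [set y | \forall x \ae mu, J x -> (y <= f x)%E].

Definition bounded_rn K : Prop := exists r : R, forall x, K x -> forall i, `|tnth x i| <= r.

Definition L1loc f : Prop :=
  measurable_fun setT f /\
  forall K, measurable K -> bounded_rn K -> mu.-integrable K f.

Definition L2loc phi : Prop :=
  measurable_fun setT phi /\
  forall K, measurable K -> bounded_rn K -> mu.-integrable K (fun x => (phi x ^+ 2)%:E).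

(* The BMO norm over a collection C of cubes. *)
Definition bmo_norm C phi : \bar R :=
  ereal_sup [set (Num.sqrt (mean J (fun x => phi x ^+ 2) - mean J phi ^+ 2))%:E
            | J in C].

Definition BMOd phi : Prop := L2loc phi /\ (bmo_norm dyadic phi < +oo)%E.

(* phi|_Q \in BMO^d(Q); as Q itself is among the cubes, phi is in L^2(Q). *)
Definition BMOd_on Q phi : Prop :=
  [/\ measurable_fun Q phi, mu.-integrable Q (fun x => (phi x ^+ 2)%:E)
    & (bmo_norm (dyadic_in Q) phi < +oo)%E].

Definition blo_norm f : \bar R :=
  ereal_sup [set (emean J f - ess_inf_on J f)%E | J in dyadic].

Definition BLOd f : Prop := L1loc f /\ (blo_norm f < +oo)%E.

(* On the null set of points that lie in no dyadic cube, both maximal functions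
   are sup of the empty set, that is -oo. *)
Definition natural_max phi : Rn R n -> \bar R := fun x =>
  ereal_sup [set (mean J phi)%:E | J in [set J | dyadic J /\ J x]].

Definition dyadic_max phi : Rn R n -> \bar R := fun x =>
  ereal_sup [set (mean J (fun y => `|phi y|))%:E | J in [set J | dyadic J /\ J x]].

End dyadic.

(** * The function Phi_n *)

Section Phi.
Context {R : realType} (n : nat).

Definition alpha : R := 2 ^- n.
Definition tau : R := (Num.sqrt alpha)^-1 - Num.sqrt alpha.
Definition p_ (k : nat) : R :=
  Num.sqrt alpha / 2 + (2 * Num.sqrt alpha)^-1 - 1 - k%:R * tau.

Definition fcurve (y : R) : R :=
  (2 * y ^+ 3 + 2 * y ^+ 2 * Num.sqrt (y ^+ 2 + 3) + 9 * y
    + 6 * Num.sqrt (y ^+ 2 + 3)) / 27.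

(* If k is the integer part of -p / tau, then -(k + 1) tau < p <= -k tau, and
   p_(k+1) splits this interval into the two cases of the definition of b_fun;
   [b_curve] and [b_line] recover these cases, end points included. *)
Definition b_fun (p : R) : R :=
  let k := Num.truncn (- p / tau) in
  if p_ k.+1 <= p then alpha ^+ k * fcurve (p + k%:R * tau + 1)
  else alpha ^+ k.+1 * (p + k.+1%:R * tau + 1).

Definition Phi (t : R) : R := b_fun (- t).

Hypothesis n_gt0 : (0 < n)%N.

Let a := Num.sqrt alpha.

Let a_gt0 : 0 < a.
Proof. by rewrite sqrtr_gt0 invr_gt0 exprn_gt0. Qed.

Let alphaE : alpha = a ^+ 2.
Proof. by rewrite sqr_sqrtr// invr_ge0 exprn_ge0. Qed.

Let a_sqr_le : a ^+ 2 <= 2^-1.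
Proof.
rewrite -alphaE /alpha lef_pV2 ?posrE ?exprn_gt0// -[leLHS]expr1.
by rewrite ler_weXn2l// ler1n.
Qed.

Let a_le : a <= 3 / 4.
Proof.
rewrite leNgt; apply/negP => h.
have : (3 / 4) ^+ 2 < a ^+ 2 by rewrite ltrXn2r// ?nnegrE; lra.
have := a_sqr_le; lra.
Qed.

Let pE k : p_ k = a / 2 + a^-1 / 2 - 1 - k%:R * (a^-1 - a).
Proof. by rewrite /p_ /tau -/a invfM [2^-1 * _]mulrC. Qed.

Let tauE : tau = a^-1 - a. Proof. by []. Qed.

Let ainv_gt : 4 / 3 <= a^-1.
Proof.
by rewrite -[leLHS]invrK invf_div lef_pV2 ?posrE ?a_le//; lra.
Qed.

Let tau_gt0 : 0 < tau. Proof. rewrite tauE; have := a_le; have := ainv_gt; lra. Qed.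

Let p_gt k : - (k%:R * tau) < p_ k.
Proof.
rewrite pE tauE.
suff : 0 < a / 2 + a^-1 / 2 - 1 by lra.
have -> : a / 2 + a^-1 / 2 - 1 = (1 - a) ^+ 2 / (2 * a).
  by field; rewrite gt_eqF.
by apply: divr_gt0; [apply: exprn_gt0|]; have := a_le; have := a_gt0; lra.
Qed.

Let p_lt k : p_ k.+1 < - (k%:R * tau).
Proof.
rewrite pE tauE -[k.+1%:R]natr1; have := a_le; have := ainv_gt; lra.
Qed.

Let truncE (p : R) k :
  - (k.+1%:R * tau) < p -> p <= - (k%:R * tau) -> Num.truncn (- p / tau) = k.
Proof.
move=> h1 h2; apply: truncn_def.
by rewrite ler_pdivlMr// ltr_pdivrMr//; apply/andP; split; lra.
Qed.

Lemma b_curve k (p : R) : p_ k.+1 <= p -> p <= - (k%:R * tau) ->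
  b_fun p = alpha ^+ k * fcurve (p + k%:R * tau + 1).
Proof.
move=> h1 h2; rewrite /b_fun (@truncE p k)//; last exact: lt_le_trans (p_gt _) h1.
by rewrite h1.
Qed.

Let fcurve1 : fcurve 1 = 1.
Proof.
rewrite /fcurve (_ : 1 ^+ 2 + 3 = 2 ^+ 2); last lra.
by rewrite sqrtr_sqr ger0_norm//; lra.
Qed.

Let fcurve_end : fcurve ((3 * a - a^-1) / 2) = (a ^+ 3 + a) / 2.
Proof.
have a0 : a != 0 by rewrite gt_eqF.
rewrite /fcurve (_ : _ ^+ 2 + 3 = ((3 * a + a^-1) / 2) ^+ 2); last by field.
rewrite sqrtr_sqr ger0_norm; first by field.
have := a_gt0; have := ainv_gt; lra.
Qed.

Lemma b_line k (p : R) : (0 < k)%N -> - (k%:R * tau) <= p -> p <= p_ k ->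
  b_fun p = alpha ^+ k * (p + k%:R * tau + 1).
Proof.
case: k => // k _ h1 h2.
have := h1; rewrite le_eqVlt => /predU1P[pE1|h1'].
  rewrite (@b_curve k.+1 p) -?pE1//; last exact/ltW/p_lt.
  by rewrite addNr add0r fcurve1.
have h3 : p <= - (k%:R * tau) := ltW (le_lt_trans h2 (p_lt k)).
rewrite /b_fun (@truncE p k)//; case: ifPn => // h4.
have -> : p = p_ k.+1 by apply/le_anti; rewrite h2.
rewrite (_ : p_ k.+1 + k%:R * tau + 1 = (3 * a - a^-1) / 2); last first.
  by rewrite pE tauE -[k.+1%:R]natr1; lra.
rewrite fcurve_end pE tauE [alpha ^+ k.+1]exprSr -mulrA; congr (_ * _); rewrite alphaE.
by field; rewrite gt_eqF.
Qed.

End Phi.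

Arguments alpha {R} n.
Arguments tau {R} n.
Arguments p_ {R} n k.
Arguments b_fun {R} n p.
Arguments Phi {R} n t.

(* Main.v *)
(* A cube [J] is summarised by three numbers: the mean [X] of [phi] over [J], its
   variance [v <= 1], and the maximum [L >= X] of the averages over the cubes
   containing [J]. With [p = X - L <= 0], the mean over [J] of the maximal function
   minus [L] obeys a recursion on the generations (the mean over the 2^n children),
   and it is bounded by a family of functions that are affine in (mean, second
   moment), hence compatible with averaging: the planes [plane j u]. When every
   child stays within reach of a plane the induction step is immediate. At most one
   child can be out of reach; since the parent has variance at most 1, this child
   forces its siblings down, and a second plane used for the siblings makes up for
   the excess. At variance 1 the lower envelope of the planes is [b_fun], which is
   also the supremum of its tangents, whence convexity and monotonicity.
   Monotone convergence passes from finitely many generations to [natural_max], and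
   Chebyshev's inequality identifies its essential infimum with [L].
   For sharpness the equality cases of the recursion are imitated by finite trees:
   [phi] jumps up on one child and keeps going down on the others, and successive
   halvings of the set of children give the jump any prescribed dyadic probability,
   so that mean and variance travel along the curve where the planes touch [b_fun].
   The operator [M] is [N] applied to [`|phi|], whose variances are not larger. *)

Require Import Defs.
From HB Require Import structures.
From mathcomp Require Import all_boot all_order all_algebra.
From mathcomp Require Import all_classical all_reals all_analysis.
From mathcomp Require Import measurable_realfun.
From mathcomp Require Import ring lra.

Set Implicit Arguments.
Unset Strict Implicit.
Unset Printing Implicit Defensive.

Import Order.TTheory GRing.Theory Num.Theory.
Import numFieldNormedType.Exports.

Local Open Scope classical_set_scope.
Local Open Scope ring_scope.

(** One child has weight [a ^+ 2] and [b] is the inverse of [a], so a child at distance [b] from a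
    point adds exactly 1, the bound on the variance, to the mean square distance from that point.
    This fixes the reach [b] of the planes. At distance [b + eta] from its vertex and at variance
    [1 - del], the plane [j.+1, u] lies below the plane [j, u] by [slope j u / 2 * (1 - a ^+ 2) *
    (eta ^+ 2 - del)]. At variance 1 the two touch at distance [b]; this is why the period is
    [b - a], and why a child beyond the reach can be charged to the plane one period up at a cost
    that is only quadratic in [eta]. The moments of the parent and of the far child determine the
    total moments of the siblings. Their plane may move its vertex to the right by [rho] while its
    slope grows by a factor of at most [(1 - rho)^-1]. What remains is to choose [rho] so that the
    siblings repay the cost; the delicate case is the one in which they lie too far to the left, and
    there the deficit [del] has to pay. *)

(** * Scalar inequalities behind the induction step *)

Lemma amgm1 (R : rcfType) (u w : R) : 0 < u -> 0 < w -> u * w = 1 -> 2 <= u + w.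
Proof. by move=> u0 w0 uw; have := sqr_ge0 (u - w); nra. Qed.

(* [(u + k^2 w)] is a convex function of [u] taking the same value at the end
   points [b] and [k^2 a] *)
Lemma dilate_wrap (R : rcfType) (a b g k u w : R) : 0 < a -> 0 < g -> 0 < w ->
  g <= 1 -> u <= b -> a <= g ^+ 2 * u -> k <= b -> a * k <= 1 ->
  a * b = 1 -> g * k = 1 -> u * w = 1 ->
  (u - w) / 2 - (g ^+ 2 * u - k ^+ 2 * w) / 2 <= (b - a) - (b * g - a * k).
Proof.
move=> a0 g0 w0 g1 ub ag kb ak1 ab gk uw.
have e1 : (1 - g ^+ 2) * (u + k ^+ 2 * w) = u - g ^+ 2 * u + k ^+ 2 * w - w.
  have -> : (1 - g ^+ 2) * (u + k ^+ 2 * w) =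
    u - g ^+ 2 * u + k ^+ 2 * w - (g * k) ^+ 2 * w by ring.
  by rewrite gk; ring.
have e2 : (1 - g) * (b + a * k) = b - b * g + a * k - a.
  have -> : (1 - g) * (b + a * k) = b - b * g + a * k - a * (g * k) by ring.
  by rewrite gk; ring.
have g10 : 0 <= 1 - g by rewrite subr_ge0.
suff h1 : 0 <= 2 * (b + a * k) - (1 + g) * (u + k ^+ 2 * w).
  have := mulr_ge0 g10 h1.
  have -> : (1 - g) * (2 * (b + a * k) - (1 + g) * (u + k ^+ 2 * w)) =
    2 * ((1 - g) * (b + a * k)) - (1 - g ^+ 2) * (u + k ^+ 2 * w) by ring.
  rewrite e1 e2; clear; lra.
have h1 : 0 <= b + k ^+ 2 * a - (u + k ^+ 2 * w).
  have : 0 <= k ^+ 2 * w * ((b - u) * (g ^+ 2 * u - a)).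
    by rewrite mulr_ge0// mulr_ge0// ?subr_ge0 ?exprn_even_ge0// ltW.
  have -> : k ^+ 2 * w * ((b - u) * (g ^+ 2 * u - a)) =
    (g * k) ^+ 2 * (u * w) * (b - u) - k ^+ 2 * w * (a * b) + k ^+ 2 * a * (u * w) by ring.
  rewrite gk uw ab; clear; lra.
have h2 : 0 <= (1 - g) * (b - k ^+ 2 * a).
  rewrite mulr_ge0// subr_ge0; clear -kb ak1 g0 gk g1; nra.
have : 0 <= (1 + g) * (b + k ^+ 2 * a - (u + k ^+ 2 * w)).
  by rewrite mulr_ge0// addr_ge0// ltW.
have e3 : (1 + g) * (b + k ^+ 2 * a) = b + g * b + k ^+ 2 * a + (g * k) * k * a by ring.
have e4 : (1 - g) * (b - k ^+ 2 * a) = b - g * b - k ^+ 2 * a + (g * k) * k * a by ring.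
move: h2; rewrite e4 mulrBr e3 gk; clear; lra.
Qed.

(** The left side bounds twice the excess of the parent over its plane, divided by the slope:
    [(1 - a ^+ 2) * eta ^+ 2 - chi * del] comes from the far child, the rest from the siblings once
    their plane has moved its vertex by [rho] and multiplied its slope by [r]. Here the siblings lie
    on average at least [eta] to the right of the vertex, and [rho = eta] suffices. *)
Lemma final_ineq_right (R : rcfType) (a b eta del s e Y Z chi : R) : 0 < a -> 2 * a ^+ 2 <= 1 ->
  a * b = 1 -> 0 <= eta -> 0 <= del ->
  s <= 1 -> s = a + eta + e -> 0 <= e -> Y = e + (1 - a ^+ 2) * eta ->
  Z <= s ^+ 2 - 2 * a * eta - a ^+ 2 * eta ^+ 2 - a ^+ 2 + a ^+ 2 * del ->
  a * (1 - a) <= chi ->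
  eta <= 1 - a /\ forall r, 1 <= r -> r * (1 - eta) <= 1 ->
  (1 - a ^+ 2) * eta ^+ 2 - chi * del
   + (r - 1) * (Z - 2 * eta * Y + (1 - a ^+ 2) * eta ^+ 2)
   - 2 * eta * Y + (1 - a ^+ 2) * eta ^+ 2 <= 0.
Proof.
move=> a0 a2 AB eta0 del0 s1 sE e0 YE hZ hchi.
have etaa : eta <= 1 - a by move: s1 e0; rewrite sE; clear; lra.
split=> // r r1 hr.
have r0 : 0 <= r - 1 by rewrite subr_ge0.
set X := Z - _ + _.
have XE : X <= e * (2 * a + e) + a ^+ 2 * del.
  rewrite -subr_ge0.
  have -> : e * (2 * a + e) + a ^+ 2 * del - X =
    s ^+ 2 - 2 * a * eta - a ^+ 2 * eta ^+ 2 - a ^+ 2 + a ^+ 2 * del - Z.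
    by rewrite /X YE sE; ring.
  by rewrite subr_ge0.
have -> : (1 - a ^+ 2) * eta ^+ 2 - chi * del + (r - 1) * X - 2 * eta * Y
   + (1 - a ^+ 2) * eta ^+ 2 = (r - 1) * X - 2 * eta * e - chi * del.
  by rewrite YE; ring.
have h1 : (r - 1) * (1 - eta) <= eta by move: hr; clear; lra.
have h2 : (r - 1) * a <= eta.
  by apply: le_trans h1; rewrite ler_wpM2l//; move: etaa; clear; lra.
have h3 : (r - 1) * (2 * a + e) <= 2 * eta.
  have : (r - 1) * (2 * a + e) <= (r - 1) * (1 - eta + a).
    by rewrite ler_wpM2l//; move: s1; rewrite sE; clear; lra.
  move: h1 h2; clear; lra.
have h4 : (r - 1) * a ^+ 2 <= chi.
  apply: le_trans hchi; rewrite expr2 mulrA [a * (1 - a)]mulrC (ler_wpM2r (ltW a0))//.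
  have : r * a <= r * (1 - eta) by rewrite ler_wpM2l//; move: etaa r1; clear; lra.
  move: hr; clear; lra.
have h5 := ler_wpM2l r0 XE.
have h6 := ler_wpM2r e0 h3.
have h7 := ler_wpM2r del0 h4.
move: h5 h6 h7; clear; lra.
Qed.

(** Now the siblings lie on average less than [eta] to the right of the vertex. The vertex moves to
    their mean, or stays in place if that mean is to the left, and the variance deficit [del] of the
    far child pays for the remaining excess. *)
Lemma final_ineq_left (R : rcfType) (a b eta del s f Y Z chi : R) : 0 < a -> 2 * a ^+ 2 <= 1 -> a
  * b = 1 -> 0 <= eta -> 0 <= del <= 1 ->
  s <= 1 -> s = a + eta - f -> 0 < f -> Y = (1 - a ^+ 2) * eta - f ->
  Z <= s ^+ 2 - 2 * a * eta - a ^+ 2 * eta ^+ 2 - a ^+ 2 + a ^+ 2 * del ->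
  Y ^+ 2 <= (1 - a ^+ 2) * Z ->
  a * (1 - a) <= chi -> (f <= 1 - a -> a * eta <= chi) ->
  f <= 1 - a /\ exists2 rho, 0 <= rho <= 1 - a & forall r, 1 <= r -> r * (1 - rho) <= 1 ->
  (1 - a ^+ 2) * eta ^+ 2 - chi * del
   + (r - 1) * (Z - 2 * rho * Y + (1 - a ^+ 2) * rho ^+ 2)
   - 2 * rho * Y + (1 - a ^+ 2) * rho ^+ 2 <= 0.
Proof.
move=> a0 a2 AB eta0 /andP[del0 del1] s1 sE f0 YE hZ CS hchi hf.
have a1 : a < 1 by move: a0 a2; clear; nra.
have a20 : 0 <= a ^+ 2 by rewrite exprn_ge0// ltW.
set om := 1 - a ^+ 2 in YE CS *.
have om0 : 0 < om by rewrite /om; move: a2 a20; clear; lra.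
have om1 : om <= 1 by rewrite /om; move: a20; clear; lra.
set i := om^-1.
have omi : om * i = 1 by rewrite /i divff// gt_eqF.
have i1 : 1 <= i by rewrite /i invf_ge1.
(* This is [Y / om], the mean position of the siblings, where their second moment attains its
   minimum [X0]. *)
set rho0 := eta - f * i.
have YE' : Y = om * rho0 by rewrite YE /rho0 mulrBr mulrCA omi mulr1.
set X0 := Z - om * rho0 ^+ 2.
have X00 : 0 <= X0.
  rewrite /X0 subr_ge0 -(ler_pM2l om0); apply: le_trans CS.
  by rewrite YE' exprMn expr2 mulrA.
have X0le : X0 <= a ^+ 2 * del - 2 * a * f - a ^+ 2 * (f ^+ 2 * i).
  have e1 : om * rho0 ^+ 2 = om * eta ^+ 2 - 2 * eta * f + f ^+ 2 * i.
    have -> : om * rho0 ^+ 2 = om * eta ^+ 2 - 2 * eta * f * (om * i) + f ^+ 2 * i * (om * i).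
      by rewrite /rho0; ring.
    by rewrite omi !mulr1.
  have e2 : f ^+ 2 * i - a ^+ 2 * (f ^+ 2 * i) = f ^+ 2.
    have -> : f ^+ 2 * i - a ^+ 2 * (f ^+ 2 * i) = f ^+ 2 * (om * i) by rewrite /om; ring.
    by rewrite omi mulr1.
  have e3 : a ^+ 2 * del - 2 * a * f - a ^+ 2 * (f ^+ 2 * i) - X0 =
     (s ^+ 2 - 2 * a * eta - a ^+ 2 * eta ^+ 2 - a ^+ 2 + a ^+ 2 * del - Z)
     + (f ^+ 2 * i - a ^+ 2 * (f ^+ 2 * i) - f ^+ 2).
    by rewrite /X0 e1 sE /om; ring.
  by rewrite -subr_ge0 e3 e2 subrr addr0 subr_ge0.
have fi0 : 0 <= f ^+ 2 * i by rewrite mulr_ge0 ?sqr_ge0//; apply: le_trans i1.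
have hf2 : 2 * a * f + a ^+ 2 * (f ^+ 2 * i) <= a ^+ 2.
  have : a ^+ 2 * del <= a ^+ 2 by rewrite ler_piMr.
  move: X00 X0le; clear; lra.
have fa : f <= 1 - a.
  rewrite leNgt; apply/negP => lt.
  have h1 : 2 * a * f * om + a ^+ 2 * f ^+ 2 <= a ^+ 2 * om.
    have -> : 2 * a * f * om + a ^+ 2 * f ^+ 2 = (2 * a * f + a ^+ 2 * (f ^+ 2 * i)) * om.
      have -> : (2 * a * f + a ^+ 2 * (f ^+ 2 * i)) * om = 2 * a * f * om + a ^+ 2 * f ^+ 2 * (om
        * i) by ring.
      by rewrite omi mulr1.
    by rewrite ler_wpM2r// ltW.
  have h2 : 0 < 1 - a by rewrite subr_gt0.
  have h3 : 2 * a * (1 - a) * om < 2 * a * f * om.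
    by rewrite ltr_pM2r// ltr_pM2l// mulr_gt0.
  have h4 : a ^+ 2 * (1 - a) ^+ 2 <= a ^+ 2 * f ^+ 2.
    by rewrite ler_wpM2l// ler_sqr ?nnegrE ltW// (lt_trans h2).
  have h5 : 0 <= 2 * a * (1 - a) * (1 - 2 * a ^+ 2).
    by rewrite !mulr_ge0 ?(ltW a0) ?(ltW h2)// subr_ge0.
  have h6 : 2 * a * (1 - a) * om + a ^+ 2 * (1 - a) ^+ 2 - a ^+ 2 * om =
     2 * a * (1 - a) * (1 - 2 * a ^+ 2) by rewrite /om; ring.
  move: h1 h3 h4 h5 h6; clear; lra.
split=> //; have {}hf := hf fa.
have b0 : 0 < b by rewrite -(pmulr_rgt0 _ a0) AB.
(* The first term pays for the missing displacement [f] through [a * eta <= chi], the second for the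
   steeper slope through [(r - 1) * a ^+ 2 <= chi]. *)
have dle : 2 * b * f + b ^+ 2 * X0 <= del.
  have h1 : 2 * a * f + X0 <= a ^+ 2 * del.
    have : 0 <= a ^+ 2 * (f ^+ 2 * i) by rewrite mulr_ge0.
    move: X0le; clear; lra.
  have h2 := ler_wpM2l (exprn_ge0 2 (ltW b0)) h1.
  have e1 : b ^+ 2 * (2 * a * f + X0) = 2 * b * f * (a * b) + b ^+ 2 * X0 by ring.
  have e2 : b ^+ 2 * (a ^+ 2 * del) = (a * b) ^+ 2 * del by ring.
  by move: h2; rewrite e1 e2 AB expr1n mulr1 mul1r.
have chi0 : 0 <= chi by apply: le_trans hchi; rewrite mulr_ge0 ?subr_ge0 ?(ltW a0) ?(ltW a1).
have hcd := ler_wpM2l chi0 dle.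
have h1 : 2 * eta * f <= chi * (2 * b * f).
  have := ler_wpM2r (ltW (mulr_gt0 b0 f0)) hf.
  have -> : a * eta * (b * f) = (a * b) * eta * f by ring.
  rewrite AB; clear; lra.
have chX : 0 <= chi * (b ^+ 2 * X0) by rewrite mulr_ge0// mulr_ge0// exprn_ge0// ltW.
have [r0|r0] := leP 0 rho0; last first.
  exists 0; first by rewrite lexx subr_ge0 ltW.
  move=> r r1; rewrite subr0 mulr1 => r1'.
  have -> : r = 1 by apply/le_anti/andP.
  rewrite subrr mul0r mulr0 mul0r expr0n /= mulr0 !addr0 subr0.
  have h2 : om * eta <= f.
    have := ler_wpM2l (ltW om0) (ltW r0); rewrite mulr0 /rho0 mulrBr mulrCA omi mulr1 subr_le0.
    by [].
  have h3 := ler_wpM2r eta0 h2.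
  have fe0 : 0 <= f * eta by rewrite mulr_ge0// ltW.
  move: h1 h3 fe0 hcd chX; clear; nra.
have rho1 : rho0 <= 1 - a.
  have : f * 1 <= f * i by rewrite ler_wpM2l// ltW.
  rewrite /rho0; move: s1; rewrite sE; clear; lra.
exists rho0; first by rewrite r0.
move=> r r1 hr.
have ra : (r - 1) * a ^+ 2 <= chi.
  apply: le_trans hchi; rewrite expr2 mulrA [a * (1 - a)]mulrC (ler_wpM2r (ltW a0))//.
  have : r * a <= r * (1 - rho0).
    by rewrite ler_wpM2l//; [apply: le_trans r1|move: rho1; clear; lra].
  move: hr; clear; lra.
have e1 : Z - 2 * rho0 * Y + om * rho0 ^+ 2 = X0 by rewrite YE' /X0; ring.
have e2 : om * eta ^+ 2 - 2 * rho0 * Y + om * rho0 ^+ 2 = 2 * eta * f - f ^+ 2 * i.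
  have -> : om * eta ^+ 2 - 2 * rho0 * Y + om * rho0 ^+ 2 =
     2 * eta * f * (om * i) - f ^+ 2 * i * (om * i) by rewrite YE' /rho0; ring.
  by rewrite omi !mulr1.
rewrite e1.
have h2 : (r - 1) * X0 <= chi * (b ^+ 2 * X0).
  have := ler_wpM2r (mulr_ge0 (exprn_ge0 2 (ltW b0)) X00) ra.
  have -> : (r - 1) * a ^+ 2 * (b ^+ 2 * X0) = (a * b) ^+ 2 * ((r - 1) * X0) by ring.
  by rewrite AB expr1n mul1r.
have -> : om * eta ^+ 2 - chi * del + (r - 1) * X0 - 2 * rho0 * Y + om * rho0 ^+ 2 =
   (om * eta ^+ 2 - 2 * rho0 * Y + om * rho0 ^+ 2) + (r - 1) * X0 - chi * del by ring.
rewrite e2; move: h1 h2 hcd fi0; clear; lra.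
Qed.

(** * The planes, their motion, and the induction step *)

Section planes.
Context {R : rcfType} (a b : R).
Hypotheses (a_gt0 : 0 < a) (a_sq : 2 * a ^+ 2 <= 1) (ab : a * b = 1).

(** The hyperbolic sine of the logarithm of [u]. *)
Definition skew (u : R) : R := (u - u^-1) / 2.

(** Placed so that at variance 1 the plane touches [b_fun] at distance [u] to the right of the
    vertex if [u <= 1], and at distance [u^-1] if [u >= 1]. *)
Definition vertex (j : nat) (u : R) : R := skew u - 1 - j%:R * (b - a).

Definition slope (j : nat) (u : R) : R := (a ^+ 2) ^+ j * u.

(* Affine in [p] and [p ^+ 2 + v]; for [u = 1] and [j] the plane touches the graph of
   [b_fun] at [p = - j * (b - a)], and [j.+1, b] is the same plane as [j, a]. *)
Definition plane (j : nat) (u p v : R) : R :=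
  slope j u / 2 * ((p - vertex j u) ^+ 2 + v).

(** At [j = 0] the planes with [u > 1] would touch at some [p > 0], outside the domain. *)
Definition admissible (j : nat) (u : R) : Prop := a <= u <= b /\ (j = 0%N -> u <= 1).

(** At [j = 0] the reach is unlimited: there is no period above, and these planes bound jumps of
    every height ([plane_jump]). *)
Definition dominated (p v S : R) : Prop := forall j u, admissible j u ->
  (j = 0%N \/ p - vertex j u <= b) -> S <= plane j u p v.

Lemma a_lt1 : a < 1. Proof. move: a_gt0 a_sq ab => A0 A2 AB; nra. Qed.
Lemma a_le34 : a <= 3 / 4. Proof. move: a_gt0 a_sq ab => A0 A2 AB; nra. Qed.
Lemma b_gt1 : 1 < b. Proof. move: a_gt0 a_sq ab => A0 A2 AB; have := a_lt1; nra. Qed.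

Lemma b_ge43 : 4 / 3 <= b. Proof. move: a_gt0 a_sq ab => A0 A2 AB; have := a_le34; nra. Qed.
Lemma tau_gt0 : 0 < b - a. Proof. move: a_gt0 a_sq ab => A0 A2 AB; have := a_lt1; have := b_gt1;
  lra. Qed.
Lemma half_tau_ge : 1 - a <= (b - a) / 2.
Proof. move: a_gt0 a_sq ab => A0 A2 AB; have := a_lt1; have := b_gt1; nra. Qed.

Lemma skewE u w : u * w = 1 -> skew u = (u - w) / 2.
Proof.
move: a_gt0 a_sq ab => A0 A2 AB; move=> uw; rewrite /skew; suff -> : u^-1 = w by [].
have u0 : u != 0 by apply/eqP => u0; move: uw; rewrite u0; lra.
by apply: (mulfI u0); rewrite uw divff.
Qed.

Lemma mul_inv (u : R) : 0 < u -> u * u^-1 = 1.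
Proof. by move=> u0; rewrite divff// gt_eqF. Qed.

Lemma skew_a : skew a = (a - b) / 2. Proof. exact: skewE. Qed.
Lemma skew_b : skew b = (b - a) / 2. Proof. by rewrite (@skewE _ a)// mulrC. Qed.
Lemma skew1 : skew 1 = 0. Proof. by rewrite /skew invr1 subrr mul0r. Qed.

Lemma skew_le u v : 0 < u -> u <= v -> skew u <= skew v.
Proof.
move: a_gt0 a_sq ab => A0 A2 AB; move=> u0 uv; have v0 : 0 < v by lra.
have := mul_inv u0; have := mul_inv v0; rewrite /skew.
have : v^-1 <= u^-1 by rewrite lef_pV2.
lra.
Qed.

Lemma skew_lt u v : 0 < u -> u < v -> skew u < skew v.
Proof.
move: a_gt0 a_sq ab => A0 A2 AB; move=> u0 uv; have v0 : 0 < v by lra.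
rewrite /skew; have : v^-1 <= u^-1 by rewrite lef_pV2// ltW.
lra.
Qed.

Lemma skew_surj (r : R) : exists2 u, 0 < u & skew u = r.
Proof.
move: a_gt0 a_sq ab => A0 A2 AB; have h : 0 <= r ^+ 2 + 1 by nra.
set s := Num.sqrt (r ^+ 2 + 1); have s2 : s ^+ 2 = r ^+ 2 + 1 by rewrite sqr_sqrtr.
have s0 : 0 <= s by exact: sqrtr_ge0.
exists (r + s); first by nra.
by rewrite (@skewE _ (s - r)); [lra|nra].
Qed.

Lemma skew_between r : (a - b) / 2 <= r <= (b - a) / 2 ->
  exists2 u, a <= u <= b & skew u = r.
Proof.
move: a_gt0 a_sq ab => A0 A2 AB; move=> /andP[h1 h2]; have [u u0 ur] := skew_surj r; exists u => //.
have b0 : 0 < b by have := b_gt1; lra.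
apply/andP; split; rewrite leNgt; apply/negP => h.
  by have := skew_lt u0 h; rewrite ur skew_a; lra.
by have := skew_lt b0 h; rewrite ur skew_b; lra.
Qed.

Lemma admissible_gt0 j u : a <= u <= b -> 0 < slope j u.
Proof.
move: a_gt0 a_sq ab => A0 A2 AB; move=> /andP[h _]; apply: mulr_gt0; last by lra.
by rewrite exprn_gt0// exprn_gt0.
Qed.

Lemma slopeS j u : slope j.+1 u = a ^+ 2 * slope j u.
Proof. by rewrite /slope exprS mulrA. Qed.

Lemma vertexS j u : vertex j.+1 u = vertex j u - (b - a).
Proof. by rewrite /vertex -natr1; ring. Qed.

(* [1 - slope/slope'] is at most the distance of the vertices, because the
   logarithmic derivative of the slope with respect to the vertex is at most 1. *)
Lemma skew_slope u u' : 0 < u -> u <= u' -> u' * (1 - (skew u' - skew u)) <= u.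
Proof.
move: a_gt0 a_sq ab => A0 A2 AB; move=> u0 uu'; have u'0 : 0 < u' by lra.
have := mul_inv u0; have := mul_inv u'0; rewrite /skew.
set w := u^-1; set w' := u'^-1 => e' e.
have w0 : 0 < w by rewrite invr_gt0.
have -> : u' * (1 - ((u' - w') / 2 - (u - w) / 2)) =
  u' - (u' ^+ 2 - u' * w' - u * u' + u' * w) / 2 by field.
rewrite e'.
have h1 : 2 <= u + w := amgm1 u0 w0 e.
have h2 : 0 <= (u' - u) * (u' + w - 2) by rewrite mulr_ge0//; lra.
have -> : u' - (u' ^+ 2 - 1 - u * u' + u' * w) / 2 =
  u' - ((u' - u) * (u' + w - 2) + 2 * u' - u - 1 * 1 + u * w - u) / 2 by field.
rewrite e; lra.
Qed.

(** While the vertex moves right, [u] increases up to [b], where the index passes to [j.-1] and [u]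
    restarts at [a] with the same plane. A move of at most one period crosses this seam at most
    once, and the last clause records whether it does. *)
Lemma shift_plane j u d : a <= u <= b -> (0 < j)%N -> 0 <= d <= b - a ->
  exists j' u', [/\ a <= u' <= b, vertex j' u' = vertex j u + d,
    slope j u <= slope j' u' &
    (j' = j /\ u <= u') \/ (j = j'.+1 /\ b - a < skew u + d + (b - a) / 2)].
Proof.
move: a_gt0 a_sq ab => A0 A2 AB; move=> ju j0 /andP[d0 dtau]; have /andP[au ub] := ju.
have u0 : 0 < u by lra.
have b1 := b_gt1; have b0 : 0 < b by lra.
have l1 := skew_le a_gt0 au; have l2 := skew_le u0 ub.
rewrite skew_a in l1; rewrite skew_b in l2.
have p0 k : 0 < (a ^+ 2) ^+ k by rewrite exprn_gt0// exprn_gt0.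
have [h|h] := leP (skew u + d) ((b - a) / 2).
  have [|u' u'P e] := @skew_between (skew u + d); first by apply/andP; split; lra.
  have uu' : u <= u'.
    rewrite leNgt; apply/negP => lt; have u'0 : 0 < u' by lra.
    have := skew_lt u'0 lt; lra.
  exists j, u'; split=> //; first by rewrite /vertex e; lra.
    by rewrite /slope ler_wpM2l// ltW.
  by left.
case: j ju j0 => // j ju _.
have [|u' u'P e] := @skew_between (skew u + d - (b - a)).
  by apply/andP; split; lra.
exists j, u'; split=> //; first by rewrite vertexS /vertex e; lra.
  rewrite slopeS /slope [leLHS]mulrCA ler_wpM2l//; first exact: ltW.
  have /andP[? _] := u'P.
  have : a ^+ 2 * b = a by rewrite expr2 -mulrA ab mulr1.
  nra.
by right; split=> //; lra.
Qed.

Lemma shift_plane_slope j u d : a <= u <= b -> (0 < j)%N -> 0 <= d <= 1 - a ->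
  exists j' u', [/\ a <= u' <= b, vertex j' u' = vertex j u + d,
    slope j u <= slope j' u' & slope j' u' * (1 - d) <= slope j u].
Proof.
move: a_gt0 a_sq ab => A0 A2 AB; move=> ju j0 /andP[d0 d1].
have ht := half_tau_ge; have t0 := tau_gt0.
have [|j' [u' [u'P e l c]]] := @shift_plane j u d ju j0; first by apply/andP; split; lra.
exists j', u'; split=> //.
have /andP[au ub] := ju; have /andP[au' u'b] := u'P.
have u0 : 0 < u by lra.
have p0 k : 0 < (a ^+ 2) ^+ k by rewrite exprn_gt0// exprn_gt0.
case: c => [[jj uu']|[jj c]].
  have {}e : skew u' = skew u + d by move: e; rewrite jj /vertex; lra.
  have := skew_slope u0 uu'; rewrite e => h.
  rewrite jj /slope -mulrA ler_wpM2l//; first exact: ltW.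
  by apply: le_trans h; rewrite ler_wpM2l; lra.
have {}e : skew u' = skew u + d - (b - a).
  by move: e; rewrite jj vertexS /vertex; lra.
rewrite jj slopeS /slope [leRHS]mulrCA -mulrA ler_wpM2l//; first exact: ltW.
have b1 := b_gt1.
have h1 := skew_slope u0 ub; have h2 := skew_slope a_gt0 au'.
rewrite skew_b in h1; rewrite skew_a in h2; rewrite e in h2.
(* The displacement is split at the seam; the two estimates of the slope combine because
   [1 - d <= (1 - d1') * (1 - d2')]. *)
set d1' := (b - a) / 2 - skew u in h1.
set d2' := skew u + d - (b - a) - (a - b) / 2 in h2.
have dd : d = d1' + d2' by rewrite /d1' /d2'; lra.
have d1'0 : 0 <= d1'.
  by have := skew_le u0 ub; rewrite skew_b /d1'; lra.
have d2'0 : 0 <= d2' by rewrite /d2'; lra.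
have d1'1 : d1' <= 1 by have := a_gt0; lra.
have h3 : u' * (1 - d) <= u' * ((1 - d2') * (1 - d1')).
  by rewrite ler_wpM2l; [|lra|nra].
apply: le_trans h3 _; rewrite mulrA.
have h4 : u' * (1 - d2') * (1 - d1') <= a * (1 - d1').
  by rewrite ler_wpM2r//; lra.
apply: le_trans h4 _.
have -> : a * (1 - d1') = a ^+ 2 * (b * (1 - d1')).
  have -> : a ^+ 2 * (b * (1 - d1')) = a * (a * b) * (1 - d1') by ring.
  by rewrite ab mulr1.
by rewrite ler_wpM2l// exprn_ge0// ltW.
Qed.

(** Multiplying the slope by [t ^+ 2] moves the vertex by at least [t - t^-1], so a vertex moved by
    exactly this much has its slope multiplied by at most [t ^+ 2]. *)
Lemma skew_dilate u t : 0 < u -> 1 <= t ->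
  t - t^-1 <= skew (t ^+ 2 * u) - skew u.
Proof.
move: a_gt0 a_sq ab => A0 A2 AB; move=> u0 t1; have t0 : 0 < t by lra.
have := mul_inv u0; have := mul_inv t0; rewrite /skew.
have -> : (t ^+ 2 * u)^-1 = t^-1 ^+ 2 * u^-1 by rewrite invfM exprVn.
set w := u^-1; set s := t^-1 => ts uw.
have w0 : 0 < w by rewrite invr_gt0.
have s0 : 0 < s by rewrite invr_gt0.
have s1 : s <= 1 by nra.
(* AM-GM for [t u] and [s w] *)
have h : 2 <= t * u + s * w.
  have e : (t * u) * (s * w) = 1 by rewrite mulrACA ts uw mulr1.
  by apply: amgm1 => //; rewrite mulr_gt0.
have -> : (t ^+ 2 * u - s ^+ 2 * w) / 2 - (u - w) / 2 =
  (t - s) * (t * u + s * w) / 2 + (t * s - 1) * (u - w) / 2 by field.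
rewrite ts subrr mul0r mul0r addr0.
have : 0 <= t - s by lra.
nra.
Qed.

(** Turns a distance [t] to the vertex into [t^-1] without raising the plane at variance 1, because
    [t ^+ 2 * (t^-1 ^+ 2 + 1) = t ^+ 2 + 1]. *)
Lemma shift_plane_dilate j u t : a <= u <= b -> (0 < j)%N -> 1 <= t <= b ->
  exists j' u', [/\ a <= u' <= b, vertex j' u' = vertex j u + (t - t^-1),
    slope j u <= slope j' u' & slope j' u' <= t ^+ 2 * slope j u].
Proof.
move: a_gt0 a_sq ab => A0 A2 AB; move=> ju j0 /andP[t1 tb].
have t0 : 0 < t by lra.
have ts := mul_inv t0; set s := t^-1 in ts *.
have b1 := b_gt1; have a1 := a_lt1.
have s0 : 0 < s by rewrite invr_gt0.
have sa : a <= s by nra.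
have ts0 : 0 <= t - s by nra.
have [|j' [u' [u'P e l c]]] := @shift_plane j u (t - s) ju j0; first by apply/andP; split; lra.
exists j', u'; split=> //.
have /andP[au ub] := ju; have /andP[au' u'b] := u'P.
have u0 : 0 < u by lra.
have u'0 : 0 < u' by lra.
have p0 k : 0 < (a ^+ 2) ^+ k by rewrite exprn_gt0// exprn_gt0.
have dil := skew_dilate u0 t1; rewrite -/s in dil.
have t20 : 0 < t ^+ 2 * u by rewrite mulr_gt0// exprn_gt0.
case: c => [[jj uu']|[jj c]].
  have {}e : skew u' = skew u + (t - s) by move: e; rewrite jj /vertex; lra.
  rewrite jj /slope [leRHS]mulrCA ler_wpM2l//; first exact: ltW.
  rewrite leNgt; apply/negP => h; have := skew_lt t20 h; lra.
have {}e : skew u' = skew u + (t - s) - (b - a).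
  by move: e; rewrite jj vertexS /vertex; lra.
rewrite jj slopeS /slope.
rewrite (_ : t ^+ 2 * _ = (a ^+ 2) ^+ j' * (a ^+ 2 * (t ^+ 2 * u))); last by ring.
rewrite ler_wpM2l//; first exact: ltW.
rewrite leNgt; apply/negP => h.
have tub : b < t ^+ 2 * u.
  rewrite ltNge; apply/negP => h'.
  have := skew_le t20 h'; rewrite skew_b; lra.
have a20 : 0 < a ^+ 2 by rewrite exprn_gt0.
have g0 : 0 < a ^+ 2 * (t ^+ 2 * u) by rewrite mulr_gt0.
have := skew_lt g0 h; rewrite e.
rewrite /skew.
have -> : (a ^+ 2 * (t ^+ 2 * u))^-1 = b ^+ 2 * (s ^+ 2 * u^-1).
  have a0' : a != 0 by rewrite gt_eqF.
  suff -> : b = a^-1 by rewrite /s; field; rewrite !gt_eqF.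
  by apply: (mulfI a0'); rewrite ab divff.
have := mul_inv u0; set w := u^-1 => uw.
have w0 : 0 < w by rewrite invr_gt0.
(* Past the seam the dilated parameter [t ^+ 2 * u] reads [g ^+ 2 * u] at the index [j'];
   [dilate_wrap] shows that its vertex is still far enough to the right. *)
set g := a * t.
have g1 : g <= 1 by rewrite /g; clear -AB tb A0; nra.
have gt0 : 0 < g by rewrite /g mulr_gt0.
have u1E : a ^+ 2 * (t ^+ 2 * u) = g ^+ 2 * u by rewrite /g; ring.
have ag : a <= g ^+ 2 * u.
  rewrite -u1E expr2 -mulrA ler_peMr//; first exact: ltW.
  by rewrite -AB ler_wpM2l// ltW.
rewrite u1E.
have -> : b ^+ 2 * (s ^+ 2 * w) = (b * s) ^+ 2 * w by ring.
set k := b * s.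
have gk : g * k = 1 by rewrite /g /k mulrACA ab ts mulr1.
have tE : t = b * g by rewrite /g mulrA [b * a]mulrC ab mul1r.
have sE : s = a * k by rewrite /k mulrA ab mul1r.
rewrite tE sE.
have ak1 : a * k <= 1 by rewrite /k mulrA AB mul1r; clear -ts t1 s0; nra.
have s1 : s <= 1 by clear -ts t1 s0; nra.
have kb : k <= b by rewrite /k ler_piMr //; apply: ltW (lt_trans ltr01 b1).
move=> h1; have h2 := dilate_wrap A0 gt0 w0 g1 ub ag kb ak1 AB gk uw; clear -h1 h2; lra.
Qed.

(** A child above the level gains at most its mean plus its standard deviation [w]. The reach cannot
    be enlarged here: equality holds for [j = 1], [u = b], [w = 1] at distance [b]. *)
Lemma plane_jump j u p w : admissible j u -> 0 < p -> 0 <= w <= 1 ->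
  j = 0%N \/ p - vertex j u <= b -> p + w <= plane j u p (w ^+ 2).
Proof.
move: a_gt0 a_sq ab => A0 A2 AB [/andP[au ub] j1] p0 /andP[w0 w1] c.
have B1 := b_gt1; have A1 := a_lt1; have T0 := tau_gt0.
have u0 : 0 < u by lra.
have := mul_inv u0; set z := u^-1 => uz.
have z0 : 0 < z by rewrite invr_gt0.
have skE := skewE uz.
case: j => [|[|j]] in j1 c *.
- have {j1} u1 := j1 erefl.
  rewrite /plane /slope expr0 mul1r /vertex mul0r subr0 skE.
  have -> : u / 2 * ((p - ((u - z) / 2 - 1)) ^+ 2 + w ^+ 2) =
    u / 2 * (p + 1 - (u - z) / 2 - z) ^+ 2 + (u * z) * (p + 1 - (u - z) / 2) - (u * z) * z / 2
    + u / 2 * w ^+ 2 by field.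
  rewrite uz.
  have h1 : 0 <= u / 2 * (p + 1 - (u - z) / 2 - z) ^+ 2.
    by rewrite mulr_ge0 ?sqr_ge0//; lra.
  have h2 : 0 <= (1 - w) * (1 - u * (1 + w) / 2) by rewrite mulr_ge0//; nra.
  have h3 : (1 - w) * (1 - u * (1 + w) / 2) = 1 - w - u / 2 + u / 2 * w ^+ 2 by field.
  lra.
- have {c} c : p - vertex 1 u <= b by case: c.
  have [u1|u1] := leP u 1.
    have := skew_le u0 u1; rewrite skew1 => h.
    move: c; rewrite /vertex; lra.
  have bz : 1 <= b * z.
    have : 0 <= (b - u) * z by rewrite mulr_ge0//; lra.
    rewrite mulrBl uz; lra.
  rewrite /plane /slope expr1.
  move: c; rewrite /vertex mul1r skE.
  set s := (p - _) => sb.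
  have -> : p = s + (u - z) / 2 - 1 - (b - a) by rewrite /s; ring.
  have a2b2 : a ^+ 2 * b ^+ 2 = 1 by rewrite -exprMn ab expr1n.
  have e1 : a ^+ 2 * u / 2 * (s - b ^+ 2 * z) ^+ 2 =
     a ^+ 2 * u / 2 * s ^+ 2 - (a ^+ 2 * b ^+ 2) * (u * z) * s
     + (a ^+ 2 * b ^+ 2) * (u * z) * b ^+ 2 * z / 2 by field.
  (* The square is smallest at [b ^+ 2 * z >= b], so within the reach the worst case is [s = b]. *)
  have h1 : a ^+ 2 * u / 2 * (b - b ^+ 2 * z) ^+ 2 <=
            a ^+ 2 * u / 2 * (s - b ^+ 2 * z) ^+ 2.
    rewrite ler_wpM2l//; first by rewrite mulr_ge0 ?mulr_ge0 ?exprn_ge0//; lra.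
    have h : b <= b ^+ 2 * z by rewrite expr2 -mulrA ler_peMr//; lra.
    have : 0 <= (b - s) * (2 * (b ^+ 2 * z) - b - s) by rewrite mulr_ge0//; lra.
    lra.
  have e2 : a ^+ 2 * u / 2 * (b - b ^+ 2 * z) ^+ 2 =
     (a ^+ 2 * b ^+ 2) * u / 2 - (a ^+ 2 * b ^+ 2) * (u * z) * b
     + (a ^+ 2 * b ^+ 2) * (u * z) * b ^+ 2 * z / 2 by field.
  rewrite e1 e2 a2b2 uz in h1.
  have h2 : 0 <= (1 - w) * (1 - a ^+ 2 * u * (1 + w) / 2).
    have h : a ^+ 2 * u <= 1 by clear -A0 A1 ub AB u0; nra.
    have h' : 0 <= a ^+ 2 * u by rewrite mulr_ge0 ?exprn_ge0// ltW.
    rewrite mulr_ge0 ?subr_ge0//; clear -h h' w0 w1; nra.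
  have h3 : (1 - w) * (1 - a ^+ 2 * u * (1 + w) / 2) =
     1 - w - a ^+ 2 * u / 2 + a ^+ 2 * u / 2 * w ^+ 2 by field.
  (* this is [a ^+ 2 * (u - 2 b + b^2 z) / 2 >= 0], a square over [u] *)
  have h4 : 0 <= z * (a * u - 1) ^+ 2 by rewrite mulr_ge0 ?sqr_ge0// ltW.
  have h5 : z * (a * u - 1) ^+ 2 = a ^+ 2 * u * (u * z) - 2 * a * (u * z) + z by ring.
  rewrite h5 uz in h4.
  rewrite mulrDr; lra.
- exfalso; have {c} c : p - vertex j.+2 u <= b by case: c.
  have b0 : 0 < b by lra.
  have := skew_le u0 ub; rewrite skew_b => h.
  have hj : 2 * (b - a) <= j.+2%:R * (b - a).
    by rewrite ler_wpM2r ?ler_nat//; lra.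
  by move: c; rewrite /vertex; lra.
Qed.

(** Both planes are affine in [v], and the steeper one falls faster as [v] decreases from 1. *)
Lemma plane_le_slope j u j' u' p v : v <= 1 -> slope j u <= slope j' u' ->
  plane j' u' p 1 <= plane j u p 1 -> plane j' u' p v <= plane j u p v.
Proof.
rewrite /plane; move: (p - vertex j u) (p - vertex j' u') (slope j u) (slope j' u') => s s' k k'.
move=> v1 kk'; rewrite !mulrDr.
have : 0 <= (k' - k) * (1 - v) by rewrite mulr_ge0//; lra.
clear; lra.
Qed.

Lemma plane01 p v : plane 0 1 p v = ((p + 1) ^+ 2 + v) / 2.
Proof. by rewrite /plane /slope /vertex skew1 expr0 mul1r mul0r; field. Qed.

(** Replaces the inadmissible planes with [j = 0] and [u > 1] that a shift may produce. *)
Lemma plane01_le u p : 1 <= u -> p <= 0 -> plane 0 1 p 1 <= plane 0 u p 1.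
Proof.
move=> u1 p0; rewrite plane01 /plane /slope /vertex expr0 mul1r mul0r subr0.
have u0 : 0 < u by lra.
set P := p + 1.
have -> : p - (skew u - 1) = P - skew u by rewrite /P; ring.
have -> : u / 2 * ((P - skew u) ^+ 2 + 1) =
   (P ^+ 2 + 1) / 2 + ((u - 1) * ((P - 1) * (P - u)) + (u - 1) ^+ 4 * u^-1 / 4) / 2.
  by rewrite /skew; field; rewrite gt_eqF.
have : 0 <= (u - 1) * ((P - 1) * (P - u)).
  by rewrite mulr_ge0 ?mulr_le0 /P//; lra.
have : 0 <= (u - 1) ^+ 4 * u^-1 by rewrite mulr_ge0 ?exprn_ge0 ?invr_ge0//; lra.
lra.
Qed.

(* A child above the level, or the largest one below it, seen from the plane
   one period up; there [u > 1] and [dominated] does not apply to the plane. *)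
Lemma overshoot_bound u p v S : 1 <= u -> 0 <= v <= 1 ->
  (0 < p -> S <= p + Num.sqrt v) -> (p <= 0 -> dominated p v S) ->
  S <= plane 0 u p v + (u - 1) / 2 * (1 - v).
Proof.
move: a_gt0 a_sq ab => A0 A2 AB u1 /andP[v0 v1] hp hn.
have B1 := b_gt1; have A1 := a_lt1.
have u0 : 0 < u by lra.
have e : plane 0 u p v + (u - 1) / 2 * (1 - v) = plane 0 u p 1 - (1 - v) / 2.
  by rewrite /plane /slope expr0 mul1r; field.
rewrite e; have [p0|p0] := leP p 0.
  apply: (@le_trans _ _ (plane 0 1 p v)).
    apply: hn => //; last by left.
    by split => //; apply/andP; split; lra.
  have := plane01_le u1 p0; rewrite !plane01; lra.
apply: (le_trans (hp p0)).
have h : Num.sqrt v <= (1 + v) / 2.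
  have := sqr_ge0 (Num.sqrt v - 1); have := sqr_sqrtr v0; nra.
suff : p + 1 <= plane 0 u p 1 by lra.
rewrite /plane /slope /vertex expr0 mul1r mul0r subr0.
have -> : u / 2 * ((p - (skew u - 1)) ^+ 2 + 1) =
   p + 1 + u / 2 * (p - (skew u - 1) - u^-1) ^+ 2.
  by rewrite /skew; field; rewrite gt_eqF.
rewrite lerDl mulr_ge0 ?sqr_ge0//; lra.
Qed.

(** Here [p] lies beyond the contact point of its plane on the affine piece. The plane that touches
    exactly at [p] is lower; if its parameter would exceed [b], the plane at the seam is used
    instead. *)
Lemma reduce_tangent u p : 1 <= u <= b -> u^-1 < p - vertex 1 u -> p - vertex 1 u <= 1 ->
  exists w, [/\ u <= w <= b, plane 1 w p 1 <= plane 1 u p 1 &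
    w = b \/ p - vertex 1 w = w^-1].
Proof.
move: a_gt0 a_sq ab => A0 A2 AB /andP[u1 ub].
have B1 := b_gt1; have A1 := a_lt1.
have u0 : 0 < u by lra.
rewrite /plane /slope /vertex mul1r.
set P := p + 1 + (b - a).
have PE w : p - (skew w - 1 - (b - a)) = P - skew w by rewrite /P; ring.
rewrite !PE => s1 s2.
have P1 : (u + u^-1) / 2 < P by move: s1; rewrite /skew; lra.
have P2 : P <= 1 + skew u by lra.
have := mul_inv u0; have : 0 < u^-1 by rewrite invr_gt0.
move=> z0 uz; have hz := amgm1 u0 z0 uz.
have h : 0 <= P ^+ 2 - 1 by nra.
set q := Num.sqrt (P ^+ 2 - 1); have q2 : q ^+ 2 = P ^+ 2 - 1 by rewrite sqr_sqrtr.
have q0 : 0 <= q by exact: sqrtr_ge0.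
(* The larger root of [w + w^-1 = 2 * P], which is the tangency condition [P - skew w = w^-1]. *)
set w := P + q.
have w0 : 0 < w by rewrite /w; lra.
have wz : w * (P - q) = 1.
  have -> : w * (P - q) = P ^+ 2 - q ^+ 2 by rewrite /w; ring.
  by rewrite q2; ring.
have uw : u <= w.
  rewrite leNgt; apply/negP => lt.
  have k : 0 < (u - w) * (u - (P - q)) by rewrite mulr_gt0//; rewrite /w in lt *; lra.
  have k2 : (u - w) * (u - (P - q)) = u ^+ 2 - 2 * u * P + w * (P - q).
    by rewrite /w; ring.
  move: k; rewrite k2 wz.
  have -> : u ^+ 2 - 2 * u * P + 1 = 2 * u * ((u + u^-1) / 2 - P) + (1 - u * u^-1) by field;
    rewrite gt_eqF.
  rewrite uz subrr addr0; nra.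
have wi : w^-1 = P - q.
  by apply: (mulfI (lt0r_neq0 w0)); rewrite wz divff// gt_eqF.
have [wb|bw] := leP w b.
  exists w; split; first by apply/andP.
    rewrite PE; have -> : (a ^+ 2) ^+ 1 * w / 2 * ((P - skew w) ^+ 2 + 1) = a ^+ 2 * P.
      rewrite /skew wi expr1.
      have -> : P - (w - (P - q)) / 2 = P - q by rewrite /w; field.
      have -> : a ^+ 2 * w / 2 * ((P - q) ^+ 2 + 1) =
        a ^+ 2 / 2 * ((w * (P - q)) * (P - q) + w) by field.
      by rewrite wz /w; field.
    have -> : (a ^+ 2) ^+ 1 * u / 2 * ((P - skew u) ^+ 2 + 1) =
       a ^+ 2 * P + a ^+ 2 * u / 2 * (P - skew u - u^-1) ^+ 2.
      by rewrite /skew expr1; field; rewrite gt_eqF.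
    by rewrite lerDl mulr_ge0 ?sqr_ge0// mulr_ge0 ?mulr_ge0 ?exprn_ge0//; lra.
  by right; rewrite PE /skew wi /w; field.
exists b; split; [by apply/andP; split; lra| |by left].
have aE w' X : a ^+ 2 * w' / 2 * X = a ^+ 2 * (w' / 2 * X) by ring.
rewrite PE expr1 !aE ler_wpM2l ?exprn_ge0//; first lra.
have ba : b^-1 = a by apply: (mulfI (lt0r_neq0 (lt_trans ltr01 B1))); rewrite divff ?gt_eqF ?[b *
  a]mulrC ?AB//; lra.
have Pb : (b + a) / 2 <= P.
  have k : 0 <= (w - b) * (b - (P - q)).
    by rewrite mulr_ge0//; nra.
  have k2 : (w - b) * (b - (P - q)) = 2 * P * b - b ^+ 2 - w * (P - q) by rewrite /w; ring.
  move: k; rewrite k2 wz => k.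
  have : 0 <= a * (2 * P * b - b ^+ 2 - 1) by rewrite mulr_ge0//; lra.
  have -> : a * (2 * P * b - b ^+ 2 - 1) = 2 * P * (a * b) - (a * b) * b - a by ring.
  rewrite AB; lra.
(* A quadratic in [P], symmetric about [(b + u) / 2] and nonpositive at [(b + a) / 2]; [P] lies
   between this point and its reflection. *)
set bracket := fun P => P ^+ 2 - P * (b + u) + (b ^+ 2 + b * u + u ^+ 2 + 2 - a * u^-1) / 4.
have key : b / 2 * ((P - skew b) ^+ 2 + 1) - u / 2 * ((P - skew u) ^+ 2 + 1) =
  (b - u) / 2 * bracket P.
  rewrite /bracket /skew -ba; field; rewrite !gt_eqF//; lra.
rewrite -subr_le0 key mulr_ge0_le0 ?divr_ge0 ?subr_ge0//.
have b1 : bracket ((b + a) / 2) <= 0.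
  have -> : bracket ((b + a) / 2) = - ((b - u) * (u - a) ^+ 2 * u^-1) / 4.
    rewrite /bracket -ba; field; rewrite !gt_eqF//; lra.
  have : 0 <= (b - u) * (u - a) ^+ 2 * u^-1.
    by apply: mulr_ge0 (ltW z0); rewrite mulr_ge0 ?sqr_ge0 ?subr_ge0.
  by rewrite mulNr oppr_le0 => h0; rewrite divr_ge0.
have b2 : 0 <= (P - (b + a) / 2) * (b + u - P - (b + a) / 2).
  rewrite mulr_ge0 ?subr_ge0//; move: P2 hz; rewrite /skew; clear -ub u1 A1; lra.
have -> : bracket P = bracket ((b + a) / 2) - (P - (b + a) / 2) * (b + u - P - (b + a) / 2).
  by rewrite /bracket; ring.
by rewrite subr_le0 (le_trans b1).
Qed.

Lemma slope_le j u : a <= u <= b -> (0 < j)%N -> slope j u <= a.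
Proof.
case: j => // j /andP[au ub] _; rewrite /slope exprSr -mulrA.
have h : 0 <= a ^+ 2 * u by rewrite mulr_ge0 ?exprn_ge0 ?(le_trans _ au)// ltW.
have a1 : a ^+ 2 <= 1 by move: (a_sq); rewrite mulr_natl mulr2n => h1; apply: le_trans h1;
  rewrite lerDl exprn_ge0// ltW.
apply: (@le_trans _ _ (a ^+ 2 * u)).
  by rewrite ler_piMl// exprn_ile1// ?exprn_ge0// ltW.
apply: (@le_trans _ _ (a ^+ 2 * b)); first by rewrite ler_wpM2l// exprn_ge0// ltW.
by rewrite expr2 -mulrA ab mulr1.
Qed.

Lemma plane_wrap p v : plane 1 b p v = plane 0 a p v.
Proof.
rewrite /plane /slope /vertex skew_a skew_b expr1 expr0 mul1r mul1r mul0r subr0.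
have -> : a ^+ 2 * b = a by rewrite expr2 -mulrA ab mulr1.
by congr (_ / 2 * (_ ^+ 2 + _)); field.
Qed.

Lemma admissible0 u : a <= u <= 1 -> admissible 0 u.
Proof.
move=> /andP[h1 h2]; split=> //; rewrite h1 (le_trans h2)//; exact/ltW/b_gt1.
Qed.

(** The second bound limits the derivative of the plane in [p]. For [j = 1] it says that the
    distance to the vertex is at most [u^-1], which the far child estimate needs when [u > 1]. *)
Lemma reduce_short j u p v : admissible j u -> v <= 1 -> p - vertex j u <= 1 ->
  exists j' u', [/\ admissible j' u', plane j' u' p v <= plane j u p v &
    j' = 0%N \/ (p - vertex j' u' <= 1 /\ slope j' u' * (p - vertex j' u') <= a ^+ 2)].
Proof.
move=> adm v1 s1; have [/andP[au ub] _] := adm.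
have [j0|j0] := posnP j; first by exists j, u; split=> //; left.
have [h|h] := leP (slope j u * (p - vertex j u)) (a ^+ 2).
  by exists j, u; split=> //; right.
have sl0 : 0 < slope j u by apply: admissible_gt0; exact/andP.
have a20 : 0 < a ^+ 2 by rewrite exprn_gt0.
have sla : a ^+ 2 < slope j u.
  by apply: (lt_le_trans h); rewrite ler_piMr// ltW.
case: j => [//|[|j]] in adm s1 h sl0 sla j0 *; last first.
  exfalso; have := @slope_le j.+1 u; rewrite au ub => /(_ erefl erefl) k.
  move: sla; rewrite slopeS -[ltLHS]mulr1 ltr_pM2l// ltNge (le_trans k)//.
  exact/ltW/a_lt1.
have u1 : 1 < u by move: sla; rewrite /slope expr1 -[ltLHS]mulr1 ltr_pM2l.
have u0 : 0 < u by apply: lt_trans u1.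
have su : u^-1 < p - vertex 1 u.
  move: h; rewrite /slope expr1 -mulrA -[ltLHS]mulr1 ltr_pM2l// => h.
  by rewrite -[ltLHS]mul1r ltr_pdivrMr// mulrC.
have [|w [/andP[uw wb] le c]] := @reduce_tangent u p _ su s1; first by rewrite (ltW u1).
have le' : plane 1 w p v <= plane 1 u p v.
  by apply: plane_le_slope => //; rewrite /slope ler_wpM2l// expr1 ltW.
case: c => [wE|wE].
  exists 0%N, a; split; last by left.
    by apply: admissible0; rewrite lexx ltW// a_lt1.
  by move: le'; rewrite wE plane_wrap.
have w1 : 1 < w := lt_le_trans u1 uw.
have w0 : 0 < w := lt_trans ltr01 w1.
exists 1%N, w; split=> //.
  by split=> //; rewrite wb (le_trans au).
right; rewrite wE; split; first by rewrite invf_le1// ltW.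
by rewrite /slope expr1 mulfK// gt_eqF.
Qed.

(* It suffices to consider the planes whose tangency point lies to the right. *)
Lemma reduce j u p v : admissible j u -> p <= 0 -> v <= 1 ->
  j = 0%N \/ p - vertex j u <= b ->
  exists j' u', [/\ admissible j' u', plane j' u' p v <= plane j u p v &
    j' = 0%N \/ (p - vertex j' u' <= 1 /\ slope j' u' * (p - vertex j' u') <= a ^+ 2)].
Proof.
move=> adm p0 v1 c; have [h _] := adm.
have [j0|j0] := posnP j; first by exists j, u; split=> //; left.
have [s1|s1] := leP (p - vertex j u) 1; first exact: reduce_short.
have {c} sb : p - vertex j u <= b by case: c => // c; rewrite c in j0.
set s := p - vertex j u in s1 sb.
have s0 : 0 < s := lt_trans ltr01 s1.
have [|j' [u' [h' vE le1 le2]]] := @shift_plane_dilate j u s h j0.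
  by rewrite sb ltW.
have sE : p - vertex j' u' = s^-1 by rewrite vE /s; ring.
have ple : plane j' u' p 1 <= plane j u p 1.
  rewrite /plane sE -/s.
  have -> : slope j u / 2 * (s ^+ 2 + 1) = s ^+ 2 * slope j u / 2 * (s^-1 ^+ 2 + 1).
    by field; rewrite gt_eqF.
  rewrite ler_wpM2r ?addr_ge0 ?sqr_ge0// ler_wpM2r// invr_ge0//.
have plv : plane j' u' p v <= plane j u p v by exact: plane_le_slope.
have [adm'|nadm] : admissible j' u' \/ j' = 0%N /\ 1 < u'.
  have [j'0|j'0] := posnP j'.
    have [u1|u1] := leP u' 1; [left|by right].
    by split.
  by left; split=> // e; rewrite e in j'0.
  have [|j2 [u2 [a2 l2 c2]]] := @reduce_short j' u' p v adm' v1; last first.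
    by exists j2, u2; split=> //; exact: le_trans plv.
  by rewrite sE invf_le1// ltW.
case: nadm => j'0 u1; subst j'.
exists 0%N, 1; split; last by left.
  by apply: admissible0; rewrite lexx ltW// a_lt1.
apply: plane_le_slope => //.
  apply: (le_trans (slope_le h j0)); rewrite /slope expr0 mul1r; exact/ltW/a_lt1.
by apply: le_trans ple; apply: plane01_le => //; exact: ltW.
Qed.

Local Notation final_ineq_left := (final_ineq_left a_gt0 a_sq ab).
Local Notation final_ineq_right := (final_ineq_right a_gt0 a_sq ab).

(** * One generation: from the children to the parent *)

Section step.
Context (B : finType) (pp vv : B -> R) (p v : R).
Hypothesis hB : #|B|%:R * a ^+ 2 = 1.
Hypothesis hp : a ^+ 2 * \sum_i pp i = p.
Hypothesis hq : a ^+ 2 * \sum_i (pp i ^+ 2 + vv i) = p ^+ 2 + v.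

Lemma mean_square m : a ^+ 2 * \sum_i ((pp i - m) ^+ 2 + vv i) = (p - m) ^+ 2 + v.
Proof.
have -> : \sum_i ((pp i - m) ^+ 2 + vv i) =
  \sum_i (pp i ^+ 2 + vv i) - 2 * m * \sum_i pp i + \sum_(i in B) m ^+ 2.
  rewrite mulr_sumr -sumrB -big_split /=; apply: eq_bigr => i _; ring.
rewrite mulrDr mulrBr hq sumr_const.
have -> : a ^+ 2 * (m ^+ 2 *+ #|B|) = m ^+ 2.
  by rewrite -mulr_natr mulrCA [a ^+ 2 * _]mulrC hB mulr1.
have -> : a ^+ 2 * (2 * m * \sum_i pp i) = 2 * m * p by rewrite -hp; ring.
ring.
Qed.

Lemma mean_plane j u : a ^+ 2 * \sum_i plane j u (pp i) (vv i) = plane j u p v.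
Proof. by rewrite /plane -mulr_sumr mulrCA mean_square. Qed.

Hypothesis hv : forall i, 0 <= vv i <= 1.
Hypothesis v1 : v <= 1.

Lemma mean_square_two m (y1 y2 : B) : y1 != y2 ->
  a ^+ 2 * ((pp y1 - m) ^+ 2 + vv y1 + ((pp y2 - m) ^+ 2 + vv y2)) <= (p - m) ^+ 2 + v.
Proof.
move=> y12; rewrite -mean_square ler_wpM2l ?exprn_ge0 ?(ltW a_gt0)//.
rewrite (bigD1 y1)//= (bigD1 y2) 1?eq_sym//= [leRHS]addrA lerDl sumr_ge0// => i _.
by rewrite addr_ge0 ?sqr_ge0//; case/andP: (hv i).
Qed.

Lemma mean_square_one m (y : B) :
  a ^+ 2 * ((pp y - m) ^+ 2 + vv y) <= (p - m) ^+ 2 + v.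
Proof.
rewrite -mean_square ler_wpM2l ?exprn_ge0 ?(ltW a_gt0)//.
rewrite (bigD1 y)//= lerDl sumr_ge0// => i _.
by rewrite addr_ge0 ?sqr_ge0//; case/andP: (hv i).
Qed.

(** Otherwise the child would be at distance more than [b + a] from [p - a], while the mean square
    about [p - a] is at most [a ^+ 2 + 1], less than [a ^+ 2 * (b + a) ^+ 2 = (1 + a ^+ 2) ^+ 2]. *)
Lemma far_child_gt0 m y : b < pp y - m -> 0 < p - m.
Proof.
move=> hy; rewrite ltNge; apply/negP => s0.
have := mean_square_one (p - a) y.
have vy : 0 <= vv y by case/andP: (hv y).
have a0 := a_gt0; have a2 := a_sq; have AB := ab.
have -> : p - (p - a) = a by ring.
have h1 : b + a <= pp y - (p - a) by lra.
have b0 : 0 < b := lt_trans ltr01 b_gt1.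
have h2 : (b + a) ^+ 2 <= (pp y - (p - a)) ^+ 2.
  have h2 : 0 <= b + a by rewrite addr_ge0 ?(ltW a0) ?(ltW b0).
  by rewrite ler_sqr ?nnegrE// (le_trans h2).
have h3 := ler_wpM2l (exprn_ge0 2 (ltW a0)) h2.
have h4 : 0 <= a ^+ 2 * vv y by rewrite mulr_ge0 ?exprn_ge0 ?(ltW a0).
have h5 : a ^+ 2 * (b + a) ^+ 2 = (a * b + a ^+ 2) ^+ 2 by ring.
rewrite h5 AB in h3; rewrite mulrDr => h6.
have h7 : 0 < a ^+ 2 by rewrite exprn_gt0.
have h8 : (1 + a ^+ 2) ^+ 2 = 1 + 2 * a ^+ 2 + (a ^+ 2) ^+ 2 by ring.
have h9 : 0 <= (a ^+ 2) ^+ 2 by rewrite sqr_ge0.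
rewrite h8 in h3; move: (v1); lra.
Qed.

(** Each far child contributes more than 1 to the mean square about [m], which is at most 2. *)
Lemma far_child_unique m y i : p - m <= 1 -> b < pp y - m -> i != y -> pp i - m <= b.
Proof.
move=> s1 hy iy; rewrite leNgt; apply/negP => hi.
have s0 := far_child_gt0 hy.
have := mean_square_two m iy.
have a0 := a_gt0; have AB := ab; have b0 : 0 < b := lt_trans ltr01 b_gt1.
have vy : 0 <= vv y by case/andP: (hv y).
have vi : 0 <= vv i by case/andP: (hv i).
have sq x : b < x -> 1 < a ^+ 2 * x ^+ 2.
  move=> bx; have : 1 < a * x by rewrite -AB ltr_pM2l.
  by rewrite -exprMn => ?; rewrite exprn_egt1.
have h1 := sq _ hy; have h2 := sq _ hi.
have h3 : 0 <= a ^+ 2 * vv y by rewrite mulr_ge0 ?exprn_ge0 ?(ltW a0).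
have h4 : 0 <= a ^+ 2 * vv i by rewrite mulr_ge0 ?exprn_ge0 ?(ltW a0).
have h5 : (p - m) ^+ 2 <= 1 by rewrite expr_le1// ltW.
rewrite !mulrDr => h6.
move: h1 h2 h3 h4 h5 h6 (v1); lra.
Qed.

Hypothesis p0 : p <= 0.
Variable S_ : B -> R.
Hypothesis S_gt0 : forall i, 0 < pp i -> S_ i <= pp i + Num.sqrt (vv i).
Hypothesis S_le0 : forall i, pp i <= 0 -> dominated (pp i) (vv i) (S_ i).

Lemma child_le_plane i j u : admissible j u ->
  j = 0%N \/ pp i - vertex j u <= b -> S_ i <= plane j u (pp i) (vv i).
Proof.
move=> adm c; have [h|h] := leP (pp i) 0; first exact: S_le0.
apply: (le_trans (S_gt0 h)); have /andP[v0 v1'] := hv i.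
rewrite -[X in plane _ _ _ X](sqr_sqrtr v0); apply: plane_jump => //.
by rewrite sqrtr_ge0 -[leRHS]sqrtr1 ler_wsqrtr.
Qed.

Lemma bellman_step : dominated p v (a ^+ 2 * \sum_i S_ i).
Proof.
move=> j0 u0 adm0 c0.
have [j [u [adm le c]]] := reduce adm0 p0 v1 c0.
apply: le_trans le => {j0 u0 adm0 c0}.
have a0 := a_gt0; have a2 := a_sq; have AB := ab; have A1 := a_lt1.
have a20 : 0 < a ^+ 2 by rewrite exprn_gt0.
have b1 := b_gt1; have b0 : 0 < b := lt_trans ltr01 b1.
have [/forallP near|] := boolP [forall i, (j == 0%N) || (pp i - vertex j u <= b)].
  rewrite -mean_plane ler_wpM2l ?(ltW a20)//; apply: ler_sum => i _.
  by apply: child_le_plane => //; case/orP: (near i) => [/eqP|]; [left|right].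
rewrite negb_forall => /existsP[y]; rewrite negb_or -ltNge => /andP[j0 hy].
case: c => [c|[s1 sk]]; first by rewrite c in j0.
have {}j0 : (0 < j)%N by rewrite lt0n.
have [ub _] := adm; have /andP[au u_b] := ub.
have u0 : 0 < u := lt_le_trans a0 au.
set m := vertex j u in hy s1 sk *.
set k := slope j u in sk *.
have k0 : 0 < k by exact: admissible_gt0.
have ka : k <= a by exact: slope_le.
set s := p - m in s1 sk.
set eta := pp y - m - b.
have eta0 : 0 < eta by rewrite /eta subr_gt0.
have /andP[vy0 vy1] := hv y.
set del := 1 - vv y.
have del01 : 0 <= del <= 1 by rewrite /del; apply/andP; split; lra.
have s0 : 0 < s by exact: far_child_gt0 hy.
(* [Z] and [Y] are the second and first moments of the siblings about [m]: the totals minus the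
   share of [y]. *)
set Z := s ^+ 2 + v - a ^+ 2 * ((b + eta) ^+ 2 + vv y).
set Y := s - a ^+ 2 * (b + eta).
have CS rho : 0 <= Z - 2 * rho * Y + (1 - a ^+ 2) * rho ^+ 2.
  have := mean_square_one (m + rho) y; rewrite -subr_ge0.
  have -> : p - (m + rho) = s - rho by rewrite /s; ring.
  have -> : pp y - (m + rho) = b + eta - rho by rewrite /eta; ring.
  suff -> : (s - rho) ^+ 2 + v - a ^+ 2 * ((b + eta - rho) ^+ 2 + vv y) =
     Z - 2 * rho * Y + (1 - a ^+ 2) * rho ^+ 2 by [].
  by rewrite /Z /Y; ring.
have om0 : 0 < 1 - a ^+ 2 by move: a2 a20; lra.
(* The Cauchy-Schwarz inequality for the siblings, read off at the minimum of the nonnegative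
   quadratic in [rho]. *)
have YZ : Y ^+ 2 <= (1 - a ^+ 2) * Z.
  have := mulr_ge0 (ltW om0) (CS (Y / (1 - a ^+ 2))).
  have -> : (1 - a ^+ 2) * (Z - 2 * (Y / (1 - a ^+ 2)) * Y +
    (1 - a ^+ 2) * (Y / (1 - a ^+ 2)) ^+ 2) = (1 - a ^+ 2) * Z - Y ^+ 2.
    by field; rewrite gt_eqF.
  by rewrite subr_ge0.
have aab : a ^+ 2 * b = a by rewrite expr2 -mulrA AB mulr1.
have aabb : a ^+ 2 * b ^+ 2 = 1 by rewrite -exprMn AB expr1n.
have YE : Y = s - a - a ^+ 2 * eta by rewrite /Y mulrDr aab; ring.
have ZE : Z = s ^+ 2 + v - 1 - 2 * a * eta - a ^+ 2 * eta ^+ 2 - a ^+ 2 + a ^+ 2 * del.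
  have -> : Z = s ^+ 2 + v - a ^+ 2 * b ^+ 2 - 2 * (a ^+ 2 * b) * eta - a ^+ 2 * eta ^+ 2
     - a ^+ 2 + a ^+ 2 * del by rewrite /Z /del; ring.
  by rewrite aabb aab; ring.
have ZE' : Z <= s ^+ 2 - 2 * a * eta - a ^+ 2 * eta ^+ 2 - a ^+ 2 + a ^+ 2 * del.
  by rewrite ZE; move: (v1); lra.
have pyE : pp y - (m + (b - a)) = a + eta by rewrite /eta; ring.
(* [chi] is the gain per unit of [del] in the bound for the far child *)
have [chi [chi1 chi2 hSy]] : exists chi : R, [/\ a * (1 - a) <= chi,
    a + eta - s <= 1 - a -> a * eta <= chi &
    a + eta - s <= 1 - a ->
    a ^+ 2 * S_ y <= k / 2 * ((a + eta) ^+ 2 + vv y + (1 - a ^+ 2 - chi) * del)].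
  (* For [k <= a ^+ 2] the plane one period up is admissible and the gain is [1 - a ^+ 2]. Otherwise
     [j = 1] and [u > 1]; [overshoot_bound] replaces that plane and reduces the gain to
     [u^-1 - a ^+ 2]. *)
  have [ka2|ka2] := leP k (a ^+ 2).
    have a1a : 0 <= 1 - a by rewrite subr_ge0 ltW.
    have om : 1 - a ^+ 2 = (1 + a) * (1 - a) by ring.
    exists (1 - a ^+ 2); split=> [|h|h].
    - by rewrite om ler_wpM2r// lerDr.
    - rewrite om; have h1 : a * eta <= a * (2 * (1 - a)) by rewrite ler_wpM2l ?(ltW a0)//; lra.
      apply: (le_trans h1); rewrite mulrA ler_wpM2r//; move: A1; lra.
    rewrite subrr mul0r addr0.
    have [j1 jE] : exists j1, j = j1.+1 by case: (j) j0 => // j1 _; exists j1.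
    have adm' : admissible j1 u.
      split=> // j1E; rewrite leNgt; apply/negP => u1.
      move: ka2; rewrite leNgt => /negP; apply.
      by rewrite /k jE j1E /slope expr1 ltr_pMr.
    have mE : vertex j1 u = m + (b - a) by rewrite /m jE vertexS; ring.
    have kE : k = a ^+ 2 * slope j1 u by rewrite /k jE slopeS.
    have := @child_le_plane y j1 u adm'; rewrite /plane mE pyE => hh.
    have {}hh : S_ y <= slope j1 u / 2 * ((a + eta) ^+ 2 + vv y).
      apply: hh; right.
      (* Since [2 - a <= b] amounts to [b * (1 - a) ^+ 2 >= 0], the far child is within reach of the
         plane one period up. *)
      have h1 : a + eta <= 2 - a by move: h s1; lra.
      apply: (le_trans h1).
      have h2 : 0 <= b * (1 - a) ^+ 2 by rewrite mulr_ge0 ?sqr_ge0// ltW.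
      have h3 : b * (1 - a) ^+ 2 = b - 2 * (a * b) + (a * b) * a by ring.
      by move: h2; rewrite h3 AB; lra.
    have {}hh := ler_wpM2l (ltW a20) hh.
    suff e : k / 2 * ((a + eta) ^+ 2 + vv y) =
      a ^+ 2 * (slope j1 u / 2 * ((a + eta) ^+ 2 + vv y)) by rewrite e.
    by rewrite kE; ring.
  have jE : j = 1%N.
    move: j0 ka2; rewrite /k; case: (j) => [//|[//|j1]] _.
    have h := @slope_le j1.+1 u ub isT.
    by rewrite slopeS -[ltLHS]mulr1 ltr_pM2l// ltNge (le_trans h)// ltW.
  have kE : k = a ^+ 2 * u by rewrite /k jE /slope expr1.
  have u1 : 1 < u by move: ka2; rewrite kE -[ltLHS]mulr1 ltr_pM2l.
  have uV0 : 0 < u^-1 by rewrite invr_gt0.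
  have uu : u * u^-1 = 1 by rewrite mul_inv.
  have au1 : a <= u^-1.
    by rewrite -(ler_pM2l u0) uu -AB mulrC ler_pM2l.
  have su : s <= u^-1.
    rewrite -(ler_pM2l u0) uu -(ler_pM2l a20) mulr1 mulrA -kE; exact: sk.
  exists (u^-1 - a ^+ 2); split=> [|h|h].
  - have -> : a * (1 - a) = a - a ^+ 2 by ring.
    by rewrite lerD2r.
  - have h1 : a * (1 - a) <= u^-1 * (1 - a) by rewrite ler_wpM2r// subr_ge0 ltW.
    have h2 : a * (a + eta - s) <= a * (1 - a) by rewrite ler_wpM2l// ltW.
    have h3 : a * s <= a * u^-1 by rewrite ler_wpM2l// ltW.
    have h4 : a * eta = a * (a + eta - s) + a * s - a ^+ 2 by ring.
    rewrite h4 lerD2r.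
    have h5 : u^-1 * (1 - a) = u^-1 - a * u^-1 by ring.
    rewrite h5 in h1; move: h1 h2 h3; lra.
  have vy01 : 0 <= vv y <= 1 by apply/andP.
  have := overshoot_bound (ltW u1) vy01 (S_gt0 (i := y)) (S_le0 (i := y)).
  have mE : vertex 0 u = m + (b - a) by rewrite /m jE /vertex; ring.
  rewrite /plane mE pyE /slope expr0 mul1r => hh.
  apply: (le_trans (ler_wpM2l (ltW a20) hh)).
  rewrite le_eqVlt; apply/orP; left; apply/eqP.
  by rewrite kE /del; field; rewrite gt_eqF.
have [rho /andP[rho0 rho1] [fle hrho]] : exists2 rho, 0 <= rho <= 1 - a &
    a + eta - s <= 1 - a /\ forall r, 1 <= r -> r * (1 - rho) <= 1 ->
  (1 - a ^+ 2) * eta ^+ 2 - chi * del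
   + (r - 1) * (Z - 2 * rho * Y + (1 - a ^+ 2) * rho ^+ 2)
   - 2 * rho * Y + (1 - a ^+ 2) * rho ^+ 2 <= 0.
  (* The sign tells whether the siblings lie on average at least [eta] to the right of the
     vertex. *)
  have [e0|e0] := leP 0 (s - a - eta).
    have del0 : 0 <= del by case/andP: del01.
    have sE : s = a + eta + (s - a - eta) by ring.
    have YE' : Y = s - a - eta + (1 - a ^+ 2) * eta by rewrite YE; ring.
    have [etaa h] := final_ineq_right (ltW eta0) del0 s1 sE e0 YE' ZE' chi1.
    exists eta; first by rewrite (ltW eta0).
    split=> //; move: e0 A1; lra.
  have sE : s = a + eta - (a + eta - s) by ring.
  have YE' : Y = (1 - a ^+ 2) * eta - (a + eta - s) by rewrite YE; ring.
  have f0 : 0 < a + eta - s by move: e0; lra.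
  have [fa [rho h1 h2]] := final_ineq_left (ltW eta0) del01 s1 sE f0 YE' ZE' YZ chi1 chi2.
  by exists rho.
have {}hSy := hSy fle.
have [|j' [u' [ub' vE kk' k'r]]] := @shift_plane_slope j u rho ub j0; first by rewrite rho0.
rewrite -/m in vE; rewrite -/k in kk' k'r.
set k' := slope j' u' in kk' k'r.
(* To reach [j' = 0] with [u' > 1] the vertex would have to move by more than half a period, whereas
   [rho <= 1 - a]. *)
have adm' : admissible j' u'.
  split=> // j'E; rewrite leNgt; apply/negP => u'1.
  have := skew_lt ltr01 u'1; rewrite skew1 => sk0.
  have hb := skew_le u0 u_b; rewrite skew_b in hb.
  have ht := half_tau_ge; have t0 := tau_gt0.
  have hj : 1 * (b - a) <= j%:R * (b - a) by apply: (ler_wpM2r (ltW t0)); rewrite ler1n.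
  have := vE; rewrite j'E /m /vertex; move: hj hb ht sk0 rho1; lra.
have Sle : a ^+ 2 * \sum_i S_ i <=
    a ^+ 2 * S_ y + (plane j' u' p v - a ^+ 2 * plane j' u' (pp y) (vv y)).
  rewrite -mean_plane -mulrBr -mulrDr ler_wpM2l ?(ltW a20)//.
  rewrite (bigD1 y)//= [in leRHS](bigD1 y)//= [X in _ + (X - _)]addrC addrK lerD2l.
  apply: ler_sum => i iy; apply: child_le_plane => //; right.
  by have := far_child_unique s1 hy iy; rewrite vE; move: rho0; lra.
apply: (le_trans Sle).
have k'0 : 0 < k' := lt_le_trans k0 kk'.
set r := k' / k.
have k'E : k' = r * k by rewrite /r divfK// gt_eqF.
have r1 : 1 <= r by rewrite /r ler_pdivlMr// mul1r.
have rrho : r * (1 - rho) <= 1 by rewrite /r mulrAC ler_pdivrMr// mul1r.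
have {}hrho := hrho r r1 rrho.
have XE : plane j' u' p v - a ^+ 2 * plane j' u' (pp y) (vv y) =
   k / 2 * (r * (Z - 2 * rho * Y + (1 - a ^+ 2) * rho ^+ 2)).
  rewrite /plane -/k' vE.
  have -> : p - (m + rho) = s - rho by rewrite /s; ring.
  have -> : pp y - (m + rho) = b + eta - rho by rewrite /eta; ring.
  by rewrite k'E /Z /Y; ring.
rewrite XE; apply: (le_trans (lerD hSy (lexx _))).
rewrite -mulrDr /plane -/k -/m -/s ler_wpM2l ?divr_ge0 ?(ltW k0)//.
have -> : s ^+ 2 + v = Z + a ^+ 2 * b ^+ 2 + 2 * (a ^+ 2 * b) * eta + a ^+ 2 * eta ^+ 2
   + a ^+ 2 - a ^+ 2 * del by rewrite /Z /del; ring.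
rewrite aabb aab -subr_le0; apply: le_trans hrho.
rewrite le_eqVlt; apply/orP; left; apply/eqP.
have -> : vv y = 1 - del by rewrite /del; ring.
ring.
Qed.
End step.

End planes.

(** * The function [Phi] as an envelope *)

Section Phi_properties.
Context {R : realType} (n : nat).
Hypothesis n_gt0 : (0 < n)%N.

Definition root_alpha : R := Num.sqrt (alpha n).
Local Notation a := root_alpha.
Local Notation b := (a^-1).

Lemma root_alpha_gt0 : 0 < a.
Proof. by rewrite sqrtr_gt0 invr_gt0 exprn_gt0. Qed.

Lemma alphaE : alpha n = a ^+ 2.
Proof. by rewrite sqr_sqrtr// invr_ge0 exprn_ge0. Qed.

Lemma root_alpha_sq : 2 * a ^+ 2 <= 1.
Proof.
rewrite -alphaE /alpha ler_pdivrMr ?exprn_gt0// mul1r -[leLHS]expr1.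
by rewrite ler_weXn2l// ler1n.
Qed.

Lemma root_alphaV : a * b = 1.
Proof. by rewrite divff// gt_eqF// root_alpha_gt0. Qed.

Let a_gt0 := root_alpha_gt0.
Let a_sq := root_alpha_sq.
Let ab := root_alphaV.

(** A rational parametrization: [u] solves [3 * u - u^-1 = 2 * y] on the curve and is the larger
    root of [u + u^-1 = 2 * P] on the line. It is also the parameter of the plane that touches
    [b_fun] at [p]. *)
Lemma b_fun_spec (p : R) : p <= 0 ->
  (exists k u, [/\ a <= u <= 1, p = (3 * u - u^-1) / 2 - 1 - k%:R * (b - a) &
     b_fun n p = (a ^+ 2) ^+ k * ((u + u ^+ 3) / 2)]) \/
  (exists k u, [/\ 1 <= u <= b, p = (u + u^-1) / 2 - 1 - k.+1%:R * (b - a) &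
     b_fun n p = (a ^+ 2) ^+ k.+1 * ((u + u^-1) / 2)]).
Proof.
move=> p0; have a0 := a_gt0; have AB := ab.
have t0 : 0 < b - a := tau_gt0 a_gt0 a_sq ab.
have a1 : a < 1 := a_lt1 a_gt0 a_sq ab.
have b0 : 0 < b by rewrite invr_gt0.
rewrite /b_fun; set k := Num.truncn _.
have tE : tau n = b - a :> R by [].
have pE j : p_ n j = (a + b) / 2 - 1 - j%:R * (b - a) :> R.
  by rewrite /p_ tE -/a invfM; field; rewrite gt_eqF.
have q0 : 0 <= - p / (b - a) by rewrite divr_ge0 ?oppr_ge0 ?(ltW t0).
have /andP[k1 k2] := truncn_itv q0.
rewrite -tE -/k in k1 k2; rewrite tE ler_pdivlMr// in k1; rewrite tE ltr_pdivrMr// in k2.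
rewrite tE alphaE pE.
case: ifPn => h; [left; exists k|right; exists k].
- set y := p + k%:R * (b - a) + 1.
  have y1 : y <= 1 by rewrite /y; lra.
  have y2 : (3 * a - b) / 2 <= y by move: h; rewrite /y -[k.+1%:R]natr1; lra.
  have s0 : 0 <= y ^+ 2 + 3 by rewrite addr_ge0 ?sqr_ge0.
  set s := Num.sqrt (y ^+ 2 + 3).
  have s2 : s ^+ 2 = y ^+ 2 + 3 by rewrite sqr_sqrtr.
  have sge0 : 0 <= s by exact: sqrtr_ge0.
  set u := (y + s) / 3.
  have u0 : 0 < u by rewrite /u; nra.
  have uV : u^-1 = s - y.
    apply: (mulfI (lt0r_neq0 u0)); rewrite divff ?gt_eqF// /u.
    have -> : (y + s) / 3 * (s - y) = (s ^+ 2 - y ^+ 2) / 3 by field.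
    by rewrite s2; field.
  exists u; split.
  - apply/andP; split.
      rewrite leNgt; apply/negP => ua.
      have : b < u^-1 by rewrite ltf_pV2.
      rewrite uV; move: ua y2; rewrite /u; lra.
    rewrite leNgt; apply/negP => u1.
    have : u^-1 < 1 by rewrite invf_lt1.
    rewrite uV; move: u1 y1; rewrite /u; lra.
  - by rewrite uV /u /y; field; exact: lt0r_neq0.
  congr (_ * _); rewrite /fcurve -/s /u.
  have -> : ((y + s) / 3 + ((y + s) / 3) ^+ 3) / 2 =
    ((9 * y + 9 * s) + (y ^+ 3 + 3 * y ^+ 2 * s + 3 * y * s ^+ 2 + s ^+ 2 * s)) / 54 by field.
  by rewrite s2; field.
set P := p + k.+1%:R * (b - a) + 1.
have P1 : 1 <= P by move: k2; rewrite /P; lra.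
have P2 : P <= (a + b) / 2 by move: h; rewrite -ltNge /P; lra.
have s0 : 0 <= P ^+ 2 - 1 by nra.
set q := Num.sqrt (P ^+ 2 - 1).
have q2 : q ^+ 2 = P ^+ 2 - 1 by rewrite sqr_sqrtr.
have qge0 : 0 <= q by exact: sqrtr_ge0.
set u := P + q.
have u1 : 1 <= u by rewrite /u; lra.
have u0 : 0 < u by rewrite (lt_le_trans _ u1).
have uV : u^-1 = P - q.
  apply: (mulfI (lt0r_neq0 u0)); rewrite divff ?gt_eqF// /u.
  have -> : (P + q) * (P - q) = P ^+ 2 - q ^+ 2 by ring.
  by rewrite q2; ring.
exists u; split.
- rewrite u1 /= leNgt; apply/negP => bu.
  have h1 : u^-1 < a by rewrite -[ltRHS]invrK ltf_pV2 ?posrE.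
  have h2 : 0 < (u - b) * (b - u^-1).
    by rewrite mulr_gt0 ?subr_gt0// (lt_trans h1)// -subr_gt0.
  have h3 : (u - b) * (b - u^-1) = b * (u + u^-1) - u / u - b ^+ 2 by ring.
  rewrite h3 divff ?gt_eqF// in h2.
  have h4 : u + u^-1 <= a + b by rewrite uV /u; lra.
  have := ler_wpM2l (ltW b0) h4.
  have -> : b * (a + b) = a * b + b ^+ 2 by ring.
  rewrite AB; lra.
- by rewrite uV /u /P; field; exact: lt0r_neq0.
by congr (_ * _); rewrite uV /u /P; field; exact: lt0r_neq0.
Qed.

Lemma dominated_b_fun (p v S : R) : p <= 0 -> v <= 1 -> dominated a b p v S ->
  S <= b_fun n p.
Proof.
move=> p0 v1 dom; have a0 := a_gt0.
have a1 : a < 1 := a_lt1 a_gt0 a_sq ab.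
have b1 : 1 < b := b_gt1 a_gt0 a_sq ab.
have sl k u : 0 < u -> 0 <= slope a k u.
  by move=> u0; rewrite /slope mulr_ge0 ?(ltW u0)// !exprn_ge0// ltW.
have plane1 k u : 0 < u -> plane a b k u p v <= plane a b k u p 1.
  by move=> u0; rewrite /plane ler_wpM2l ?divr_ge0 ?sl// lerD2l.
case: (b_fun_spec p0) => [[k [u [/andP[au u1] pE ->]]]|[k [u [/andP[u1 ub] pE ->]]]].
  have u0 : 0 < u := lt_le_trans a0 au.
  have sE : p - vertex a b k u = u by rewrite pE /vertex /skew; field; rewrite !gt_eqF.
  apply: (@le_trans _ _ (plane a b k u p v)).
    apply: dom; first by split=> //; rewrite au (le_trans u1)// ltW.
    by right; rewrite sE (le_trans u1)// ltW.
  apply: (le_trans (plane1 _ _ u0)); rewrite /plane sE /slope le_eqVlt.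
  by apply/orP; left; apply/eqP; field.
have u0 : 0 < u by apply: lt_le_trans u1.
have sE : p - vertex a b k.+1 u = u^-1 by rewrite pE /vertex /skew; field; rewrite !gt_eqF.
apply: (@le_trans _ _ (plane a b k.+1 u p v)).
  apply: dom; first by split=> //; rewrite (le_trans (ltW a1) u1).
  by right; rewrite sE (@le_trans _ _ 1) ?(ltW b1)// invf_le1.
apply: (le_trans (plane1 _ _ u0)); rewrite /plane sE /slope le_eqVlt.
by apply/orP; left; apply/eqP; field; rewrite gt_eqF.
Qed.

(* The tangent lines of [b_fun n]; it is their supremum over [a <= u <= 1]. *)
Definition tangent (k : nat) (u p : R) : R :=
  (a ^+ 2) ^+ k * (u + (p + k%:R * (b - a) + 1) * u ^+ 2 - u ^+ 3).

Lemma tangent_wrap k p : tangent k a p = tangent k.+1 1 p.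
Proof.
rewrite /tangent (exprSr (a ^+ 2) k) -mulrA; congr (_ * _).
rewrite -[k.+1%:R]natr1; field; exact: lt0r_neq0 a_gt0.
Qed.

(** Together with [tangent_left]: outside the contact points of a period, the highest tangent is the
    one at the nearer end, and [tangent_wrap] hands it over to the next period. *)
Lemma tangent_right k u p : a <= u <= 1 -> 1 <= p + k%:R * (b - a) + 1 ->
  tangent k u p <= tangent k 1 p.
Proof.
move=> /andP[au u1]; rewrite /tangent; set y := p + _ + 1 => y1.
have u0 : 0 < u := lt_le_trans a_gt0 au.
rewrite ler_wpM2l ?exprn_ge0//; first exact/ltW/a_gt0.
rewrite -subr_ge0.
have -> : 1 + y * 1 ^+ 2 - 1 ^+ 3 - (u + y * u ^+ 2 - u ^+ 3) = (1 - u) * (1 + u) * (y - u) by ring.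
by rewrite !mulr_ge0 ?subr_ge0 ?(le_trans u1)// addr_ge0// ltW.
Qed.

Lemma tangent_left k u p : a <= u <= 1 -> p + k%:R * (b - a) + 1 <= (3 * a - b) / 2 ->
  tangent k u p <= tangent k a p.
Proof.
move=> /andP[au u1]; rewrite /tangent; set y := p + _ + 1 => y1.
have a0 := a_gt0; have u0 : 0 < u := lt_le_trans a_gt0 au.
rewrite ler_wpM2l ?exprn_ge0//; first exact/ltW/a_gt0.
rewrite -subr_ge0.
have -> : a + y * a ^+ 2 - a ^+ 3 - (u + y * u ^+ 2 - u ^+ 3) =
  (u - a) * (((3 * a - b) / 2 - y) * (u + a) + (u - a) * (b / 2 + u + a / 2)).
  by field; exact: lt0r_neq0.
have b0 : 0 < b by rewrite invr_gt0.
apply: mulr_ge0; rewrite ?subr_ge0//; apply: addr_ge0; apply: mulr_ge0.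
- by rewrite subr_ge0.
- by rewrite addr_ge0 ?(ltW a0) ?(ltW u0).
- by rewrite subr_ge0.
by rewrite !addr_ge0 ?divr_ge0 ?(ltW a0) ?(ltW u0) ?(ltW b0).
Qed.

Lemma tangent_up d k u p : a <= u <= 1 ->
  (forall i, (i < d)%N -> p + (k + i)%:R * (b - a) + 1 <= (3 * a - b) / 2) ->
  exists2 u', a <= u' <= 1 & tangent k u p <= tangent (k + d) u' p.
Proof.
elim: d k u => [|d IH] k u hu h; first by exists u; rewrite ?addn0.
have a1 : a < 1 := a_lt1 a_gt0 a_sq ab.
have [||u' h1 h2] := IH k.+1 1.
- by rewrite lexx ltW.
- by move=> i id; rewrite addSnnS h// ltnS.
exists u' => //; rewrite -addSnnS; apply: le_trans h2.
rewrite -tangent_wrap; apply: tangent_left => //.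
by have := h 0%N isT; rewrite addn0.
Qed.

Lemma tangent_down d k u p : a <= u <= 1 ->
  (forall i, (0 < i <= d)%N -> 1 <= p + (k + i)%:R * (b - a) + 1) ->
  exists2 u', a <= u' <= 1 & tangent (k + d) u p <= tangent k u' p.
Proof.
elim: d u => [|d IH] u hu h; first by exists u; rewrite ?addn0.
have a1 : a < 1 := a_lt1 a_gt0 a_sq ab.
have [||u' h1 h2] := IH a.
- by rewrite lexx ltW.
- by move=> i /andP[i0 id]; rewrite h// i0 ltnW.
exists u' => //; apply: le_trans h2; rewrite addnS tangent_wrap -addnS.
by apply: tangent_right => //; apply: h; rewrite leqnn.
Qed.

(** The tangent is first moved to the period of [p]; there the gap on the curve is a square times a
    positive factor. *)
Lemma tangent_le k u p : p <= 0 -> a <= u <= 1 -> tangent k u p <= b_fun n p.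
Proof.
move=> p0 hu; have a0 := a_gt0; have AB := ab.
have t0 : 0 < b - a := tau_gt0 a_gt0 a_sq ab.
have a1 : a < 1 := a_lt1 a_gt0 a_sq ab.
have b0 : 0 < b by rewrite invr_gt0.
have ab2 : 2 <= a + b := amgm1 a_gt0 b0 ab.
have mon i j : (i < j)%N -> i%:R * (b - a) + (b - a) <= j%:R * (b - a) :> R.
  by move=> ij; rewrite -[X in _ + X]mul1r -mulrDl natr1 ler_wpM2r ?(ltW t0)// ler_nat.
have inv_le w : a <= w -> 0 < w -> w^-1 <= b by move=> aw w0; rewrite lef_pV2.
case: (b_fun_spec p0) => [[l [w [/andP[aw w1] pE ->]]]|[l [w [/andP[w1 wb] pE ->]]]].
- have w0 : 0 < w := lt_le_trans a0 aw.
  have wV := inv_le _ aw w0; have wV1 : 1 <= w^-1 by rewrite invf_ge1.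
  have [w' /andP[aw' w'1] le'] : exists2 u', a <= u' <= 1 & tangent k u p <= tangent l u' p.
    have [kl|lk] := leqP k l.
      rewrite -(subnKC kl); apply: tangent_up => // i; rewrite ltn_subRL => il.
      have := mon _ _ il; rewrite pE; lra.
    rewrite -(subnKC (ltnW lk)); apply: tangent_down => // i /andP[i0 il].
    have : (l < l + i)%N by rewrite -addn1 leq_add2l.
    by move/mon; rewrite pE; lra.
  apply: (le_trans le'); rewrite /tangent.
  have -> : p + l%:R * (b - a) + 1 = (3 * w - w^-1) / 2 by rewrite pE; ring.
  rewrite ler_wpM2l ?exprn_ge0 ?(ltW a0)// -subr_ge0.
  have -> : (w + w ^+ 3) / 2 - (w' + (3 * w - w^-1) / 2 * w' ^+ 2 - w' ^+ 3) =
    (w' - w) ^+ 2 * (w' + (w + w^-1) / 2) by field; rewrite gt_eqF.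
  have w'0 : 0 < w' := lt_le_trans a0 aw'.
  by rewrite mulr_ge0 ?sqr_ge0// addr_ge0 ?divr_ge0 ?addr_ge0 ?(ltW w'0) ?(ltW w0) ?invr_ge0
    ?(ltW w0).
have w0 : 0 < w by apply: lt_le_trans w1.
have wV : w^-1 <= 1 by rewrite invf_le1.
have ww : w + w^-1 <= a + b.
  have aw : a <= w^-1 by rewrite -[leLHS]invrK lef_pV2 ?posrE.
  have : 0 <= (b - w) * (b - w^-1) by rewrite mulr_ge0 ?subr_ge0// (le_trans wV)// -[leLHS]invr1
    lef_pV2 ?posrE// ltW.
  have -> : (b - w) * (b - w^-1) = b * (b - w - w^-1) + w / w by ring.
  rewrite divff ?gt_eqF// -[X in _ + X]AB [a * b]mulrC -mulrDr pmulr_rge0//; lra.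
have w2 : 2 <= w + w^-1.
  by apply: amgm1 => //; rewrite ?invr_gt0// divff// gt_eqF.
have [w' /andP[aw' w'1] le'] : exists2 u', a <= u' <= 1 & tangent k u p <= tangent l.+1 u' p.
  have [kl|lk] := leqP k l.+1.
    rewrite -(subnKC kl); apply: tangent_up => // i; rewrite ltn_subRL => il.
    have := mon _ _ il; rewrite pE; lra.
  rewrite -(subnKC (ltnW lk)); apply: tangent_down => // i /andP[i0 il].
  have : (l.+1 < l.+1 + i)%N by rewrite -[ltnLHS]addn0 ltn_add2l.
  by move/mon; rewrite pE; lra.
apply: (le_trans le'); apply: (@le_trans _ _ (tangent l.+1 1 p)).
  by apply: tangent_right; rewrite ?aw'// pE; lra.
rewrite /tangent le_eqVlt; apply/orP; left; apply/eqP; congr (_ * _).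
by rewrite pE; ring.
Qed.

Lemma b_fun_tangent p : p <= 0 ->
  exists k u, a <= u <= 1 /\ b_fun n p = tangent k u p.
Proof.
move=> p0; have a0 := a_gt0; have a1 : a < 1 := a_lt1 a_gt0 a_sq ab.
case: (b_fun_spec p0) => [[k [u [hu pE ->]]]|[k [u [hu pE ->]]]].
  exists k, u; split=> //; rewrite /tangent; congr (_ * _).
  have u0 : 0 < u by case/andP: hu => /(lt_le_trans a0).
  by rewrite pE; field; rewrite gt_eqF//= gt_eqF.
exists k.+1, 1; rewrite lexx (ltW a1); split=> //; rewrite /tangent; congr (_ * _).
by rewrite pE; ring.
Qed.

Lemma tangent_lt k u p q : a <= u -> p < q -> tangent k u p < tangent k u q.
Proof.
move=> au pq; have u0 : 0 < u := lt_le_trans a_gt0 au.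
rewrite /tangent ltr_pM2l ?exprn_gt0 ?exprn_gt0 ?a_gt0//.
by rewrite ltrD2r ltrD2l ltr_pM2r ?exprn_gt0// !ltrD2r.
Qed.

Lemma Phi_decr : {in `[0, +oo[ &, {homo (Phi n : R -> R) : s t / s < t >-> t < s}}.
Proof.
move=> s t; rewrite !in_itv /= !andbT => s0 t0 st; rewrite /Phi.
have [|k [u [hu ->]]] := @b_fun_tangent (- t); first by rewrite oppr_le0.
apply: (lt_le_trans (@tangent_lt k u _ (- s) _ _)); first by case/andP: hu.
  by rewrite ltrN2.
by apply: tangent_le; rewrite ?oppr_le0.
Qed.

Lemma Phi_convex : convex_function (`[0, +oo[%classic : set R) (Phi n : R -> R).
Proof.
move=> t x y; rewrite !inE /= !in_itv /= !andbT => x0 y0; rewrite !convRE /Phi /unstable.onem.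
have [t0 t1] : 0 <= t%:num /\ t%:num <= 1 by split.
have [|k [u [hu ->]]] := @b_fun_tangent (- (t%:num * x + (1 - t%:num) * y)).
  by rewrite oppr_le0 addr_ge0 ?mulr_ge0 ?subr_ge0.
have -> : tangent k u (- (t%:num * x + (1 - t%:num) * y)) =
  t%:num * tangent k u (- x) + (1 - t%:num) * tangent k u (- y).
  by rewrite /tangent; ring.
by rewrite lerD// ler_wpM2l ?subr_ge0// tangent_le ?oppr_le0.
Qed.

Lemma b_fun_vertex k : b_fun n (- (k%:R * (b - a))) = (a ^+ 2) ^+ k.
Proof.
have t0 : 0 < b - a := tau_gt0 a_gt0 a_sq ab.
have ab2 : 2 <= a + b by apply: amgm1 ab; rewrite ?invr_gt0 ?a_gt0.
have tE : tau n = b - a :> R by [].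
rewrite (@b_curve _ _ n_gt0 k) ?tE//.
  have -> : - (k%:R * (b - a)) + k%:R * (b - a) + 1 = 1 by ring.
  rewrite alphaE -[RHS]mulr1; congr (_ * _).
  rewrite /fcurve (_ : 1 ^+ 2 + 3 = 2 ^+ 2); last by ring.
  by rewrite sqrtr_sqr ger0_norm//; field.
rewrite /p_ tE -/a invfM -[k.+1%:R]natr1.
have a1 : a < 1 := a_lt1 a_gt0 a_sq ab.
have : 2^-1 * b = b / 2 by rewrite mulrC.
move=> ->; have := b_ge43 a_gt0 a_sq ab; have := a_le34 a_gt0 a_sq ab; lra.
Qed.

Lemma Phi0 : Phi n 0 = 1 :> R.
Proof. by have := b_fun_vertex 0; rewrite mul0r expr0. Qed.

Lemma Phi_vertex k :
  Phi n (k%:R * (2 `^ (n%:R / 2) - 2 `^ (- (n%:R / 2)))) = 2 ^- (n * k) :> R.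
Proof.
have aE : a = 2 `^ (- (n%:R / 2)).
  rewrite /root_alpha /alpha powRN sqrtrV ?exprn_ge0//; congr (_^-1).
  rewrite -powR12_sqrt ?exprn_ge0// -powR_mulrn// -powRrM.
  by congr (_ `^ _); field.
have bE : b = 2 `^ (n%:R / 2) by rewrite aE powRN invrK.
by rewrite -bE -aE /Phi b_fun_vertex -alphaE /alpha -exprVn -exprM exprVn.
Qed.

Lemma Phi_le1 t : 0 <= t -> Phi n t <= 1 :> R.
Proof.
rewrite le_eqVlt => /predU1P[<-|t0]; first by rewrite Phi0.
by rewrite -Phi0 ltW// Phi_decr// in_itv /= ?lexx// ltW.
Qed.

End Phi_properties.

(** * The recursion for stopped maxima, on an abstract family of nodes *)

Section stopped_max.
Context {R : rcfType} {I : Type} {B : finType}.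
Implicit Types (al : R) (child : I -> B -> I) (X q : I -> R) (psi : R -> R).

(* The mean over [i] of [psi] of the maximum of [L] and the values of [X] on the
   first [d] generations. *)
Fixpoint smax al child X psi d i L : R :=
  if d is d'.+1 then
    al * \sum_e smax al child X psi d' (child i e) (Num.max L (X i))
  else psi (Num.max L (X i)).

Context (al : R) (child : I -> B -> I).
Hypothesis card_al : #|B|%:R * al = 1.

Lemma al_gt0 : 0 < al.
Proof.
have h : 0 < #|B|%:R * al by rewrite card_al.
by have := ler0n R #|B|; rewrite le_eqVlt => /predU1P[e|/pmulr_rgt0 <-//];
   rewrite -e mul0r ltxx in h.
Qed.

Lemma mean_cst c : al * \sum_(e : B) c = c.
Proof. by rewrite sumr_const -mulr_natr mulrCA [al * _]mulrC card_al mulr1. Qed.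

Lemma smax_max X psi d i L : smax al child X psi d i (Num.max L (X i)) =
  smax al child X psi d i L.
Proof. by case: d => [|d] /=; rewrite -maxA maxxx. Qed.

Lemma smax_mono X d i L L' : L <= L' ->
  smax al child X id d i L <= smax al child X id d i L'.
Proof.
elim: d i L L' => [|d IH] i L L' LL' /=; first by rewrite ge_max !le_max LL' lexx orbT.
rewrite ler_wpM2l ?(ltW al_gt0)//; apply: ler_sum => e _; apply: IH.
by rewrite ge_max !le_max LL' lexx orbT.
Qed.

Lemma smax_ge X d i L : L <= smax al child X id d i L.
Proof.
elim: d i L => [|d IH] i L /=; first by rewrite le_max lexx.
rewrite -[leLHS]mean_cst ler_wpM2l ?(ltW al_gt0)//; apply: ler_sum => e _.
by apply: le_trans (IH _ _); rewrite le_max lexx.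
Qed.

(** Levels may be negative; the truncation makes the integrands nonnegative, as monotone convergence
    requires. *)
Lemma smax_trunc X c d i L : c <= L ->
  smax al child X (fun w => Num.max (w - c) 0) d i L = smax al child X id d i L - c.
Proof.
elim: d i L => [|d IH] i L cL /=.
  by apply/max_idPl; rewrite subr_ge0 le_max cL.
rewrite -[X in _ - X]mean_cst -mulrBr -sumrB; congr (_ * _).
by apply: eq_bigr => e _; apply: IH; rewrite le_max cL.
Qed.

Lemma smax_scale X c d i L : 0 < c ->
  smax al child (fun i => X i / c) id d i (L / c) = smax al child X id d i L / c.
Proof.
move=> c0; have mc x y : Num.max (x / c) (y / c) = Num.max x y / c.
  by rewrite -maxr_pMl// invr_ge0 ltW.
elim: d i L => [|d IH] i L /=; first by rewrite mc.
rewrite -mulrA mulr_suml; congr (_ * _); apply: eq_bigr => e _.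
by rewrite mc IH.
Qed.

Context (D : I -> Prop) (X q : I -> R).
Hypothesis Dchild : forall i e, D i -> D (child i e).
Hypothesis X_mean : forall i, D i -> X i = al * \sum_e X (child i e).
Hypothesis q_mean : forall i, D i -> q i = al * \sum_e q (child i e).
Hypothesis qX : forall i, D i -> X i ^+ 2 <= q i.

Lemma mean_sqrt_le (w : B -> R) : (forall e, 0 <= w e) ->
  al * \sum_e Num.sqrt (w e) <= Num.sqrt (al * \sum_e w e).
Proof.
move=> w0; have a0 := ltW al_gt0.
have s0 : 0 <= al * \sum_e Num.sqrt (w e).
  by rewrite mulr_ge0// sumr_ge0// => e _; exact: sqrtr_ge0.
rewrite -[leLHS]ger0_norm// -sqrtr_sqr ler_wsqrtr//.
set m := al * _.
have : 0 <= al * \sum_e (Num.sqrt (w e) - m) ^+ 2.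
  by rewrite mulr_ge0// sumr_ge0// => e _; exact: sqr_ge0.
have -> : al * \sum_e (Num.sqrt (w e) - m) ^+ 2 =
  al * \sum_e w e - 2 * m * (al * \sum_e Num.sqrt (w e)) + al * \sum_(e : B) m ^+ 2.
  rewrite mulrCA -!mulrBr -!mulrDr; congr (_ * _); rewrite mulr_sumr -sumrB -big_split /=.
  by apply: eq_bigr => e _; rewrite sqrrB sqr_sqrtr//; ring.
rewrite mean_cst -/m; lra.
Qed.

(** The mean plus the root mean square distance from the level. A child above [L] raises the level
    to its own mean, which shortens the distance, and the concavity of the square root closes the
    induction. *)
Lemma smax_le_sqrt d i L : D i -> X i <= L ->
  smax al child X id d i L <= X i + Num.sqrt (q i - 2 * L * X i + L ^+ 2).
Proof.
elim: d i L => [|d IH] i L Di XL /=; rewrite (max_idPl XL).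
  have h : `|X i - L| <= Num.sqrt (q i - 2 * L * X i + L ^+ 2).
    rewrite -sqrtr_sqr ler_wsqrtr// sqrrB.
    by have := qX Di; move: (X i) (q i) => x y; nra.
  move: h; rewrite ler0_norm ?subr_le0//; lra.
have w0 e : 0 <= q (child i e) - 2 * L * X (child i e) + L ^+ 2.
  have := qX (Dchild e Di); have := sqr_ge0 (X (child i e) - L); rewrite sqrrB.
  move: (X _) (q _) => x y; lra.
apply: (@le_trans _ _ (al * \sum_e (X (child i e) +
   Num.sqrt (q (child i e) - 2 * L * X (child i e) + L ^+ 2)))).
  rewrite ler_wpM2l ?(ltW al_gt0)//; apply: ler_sum => e _.
  have [h|h] := leP (X (child i e)) L; first exact: IH (Dchild e Di) h.
  rewrite -smax_max (max_idPr (ltW h)).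
  apply: (le_trans (IH _ _ (Dchild e Di) (lexx _))); rewrite lerD2l ler_wsqrtr//.
  have := sqr_ge0 (X (child i e) - L); rewrite sqrrB.
  move: (X _) (q _) => x y; nra.
rewrite big_split /= mulrDr -X_mean// lerD2l.
apply: (le_trans (mean_sqrt_le w0)); rewrite ler_wsqrtr// le_eqVlt.
apply/orP; left; apply/eqP.
rewrite q_mean// X_mean// mulrCA -mulrBr big_split /= sumrB -mulr_sumr mulrDr.
by rewrite [in LHS](mean_cst (L ^+ 2)).
Qed.

(** The centre [m] is free and need not be the mean: far to the left it brings the bound below 1 as
    soon as the mean is less than [c]. *)
Lemma smax_chebyshev c m d i L : D i -> m < c -> L <= c ->
  smax al child X (fun w => (c < w)%R%:R) d i L <=
  (q i - 2 * m * X i + m ^+ 2) / (c - m) ^+ 2.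
Proof.
move=> Di mc; have c0 : 0 < (c - m) ^+ 2 by rewrite exprn_gt0// subr_gt0.
have w0 j : D j -> 0 <= q j - 2 * m * X j + m ^+ 2.
  move=> Dj; have := qX Dj; have := sqr_ge0 (X j - m); rewrite sqrrB.
  move: (X j) (q j) => x y; lra.
have w1 j : D j -> c < X j -> 1 <= (q j - 2 * m * X j + m ^+ 2) / (c - m) ^+ 2.
  move=> Dj cX; rewrite ler_pdivlMr// mul1r; have := qX Dj.
  move: (X j) (q j) cX => x y; nra.
elim: d i L Di => [|d IH] i L Di Lc /=.
  have [h|h] := ltP; last by rewrite divr_ge0 ?w0// ltW.
  by apply: w1 => //; move: h; rewrite lt_max ltNge Lc.
have [XL|LX] := leP (X i) c.
  apply: (@le_trans _ _ (al * \sum_e (q (child i e) - 2 * m * X (child i e) + m ^+ 2) / (c - m)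
    ^+ 2)).
    rewrite ler_wpM2l ?(ltW al_gt0)//; apply: ler_sum => e _.
    by apply: IH; [exact: Dchild|rewrite ge_max Lc].
  rewrite -mulr_suml mulrA ler_wpM2r ?invr_ge0 ?(ltW c0)// le_eqVlt.
  apply/orP; left; apply/eqP.
  rewrite q_mean// X_mean// mulrCA -mulrBr big_split /= sumrB -mulr_sumr mulrDr.
  by rewrite [in LHS](mean_cst (m ^+ 2)).
apply: le_trans (w1 _ Di LX).
have bnd d' j L' : smax al child X (fun w => (c < w)%R%:R) d' j L' <= 1.
  elim: d' j L' => [|d' IH'] j L' /=; first by case: ltP.
  rewrite -[leRHS]mean_cst ler_wpM2l ?(ltW al_gt0)//; apply: ler_sum => e _; exact: IH'.
rewrite -[leRHS]mean_cst ler_wpM2l ?(ltW al_gt0)//; apply: ler_sum => e _; exact: bnd.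
Qed.

Context (a b : R).
Hypotheses (a_gt0 : 0 < a) (a_sq : 2 * a ^+ 2 <= 1) (ab : a * b = 1).
Hypothesis alE : al = a ^+ 2.
Hypothesis v_le1 : forall i, D i -> q i - X i ^+ 2 <= 1.

Lemma smax_dominated d i L : D i -> X i <= L ->
  dominated a b (X i - L) (q i - X i ^+ 2) (smax al child X id d i L - L).
Proof.
elim: d i L => [|d IH] i L Di XL /=; rewrite (max_idPl XL).
  move=> j u [hu _] _; rewrite subrr /plane mulr_ge0 ?divr_ge0//.
    exact/ltW/(admissible_gt0 a_gt0 a_sq ab).
  by rewrite addr_ge0 ?sqr_ge0// subr_ge0 qX.
have -> : al * \sum_e smax al child X id d (child i e) L - L =
  a ^+ 2 * \sum_e (smax al child X id d (child i e) L - L).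
  by rewrite -alE sumrB mulrBr mean_cst.
apply: (@bellman_step _ a b a_gt0 a_sq ab B (fun e => X (child i e) - L)
   (fun e => q (child i e) - X (child i e) ^+ 2)) => //.
- by rewrite -alE.
- by rewrite -alE sumrB mulrBr mean_cst -X_mean.
- have h e : (X (child i e) - L) ^+ 2 + (q (child i e) - X (child i e) ^+ 2) =
     q (child i e) - 2 * L * X (child i e) + L ^+ 2 by rewrite sqrrB; ring.
  rewrite -alE (eq_bigr _ (fun e _ => h e)) big_split /= sumrB -mulr_sumr mulrDr mulrBr.
  by rewrite mean_cst mulrCA -X_mean// -q_mean// sqrrB; ring.
- by move=> e; rewrite subr_ge0 qX ?v_le1//; exact: Dchild.
- exact: v_le1.
- by rewrite subr_le0.
(* A child above the level starts afresh, with its own mean as the level. *)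
- move=> e; rewrite subr_gt0 => h; rewrite -smax_max (max_idPr (ltW h)).
  have Dc := Dchild e Di.
  have := smax_le_sqrt d Dc (lexx _).
  have -> : q (child i e) - 2 * X (child i e) * X (child i e) + X (child i e) ^+ 2 =
    q (child i e) - X (child i e) ^+ 2 by ring.
  lra.
by move=> e; rewrite subr_le0 => h; apply: IH => //; exact: Dchild.
Qed.

End stopped_max.

(** Carries the maximum of a finite tree over to the cubes that realize it. *)
Lemma smax_congr (R : rcfType) (I J : Type) (B : finType) (al : R)
    (child : I -> B -> I) (child' : J -> B -> J) (X : I -> R) (X' : J -> R)
    (rel : I -> J -> Prop) psi :
  (forall i j e, rel i j -> rel (child i e) (child' j e)) ->
  (forall i j, rel i j -> X i = X' j) ->
  forall d i j L, rel i j ->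
  smax al child X psi d i L = smax al child' X' psi d j L.
Proof.
move=> relc relX; elim=> [|d IH] i j L ij /=; rewrite (relX _ _ ij)//.
by congr (_ * _); apply: eq_bigr => e _; apply: IH; exact: relc.
Qed.

(** * Finite trees that nearly attain the bound *)

Section trees.
Context {R : realType} {B : finType}.

(** A function on a cube: a leaf is a constant, and a node puts a copy of [U] on each child in [A]
    and a copy of [V] on each other child. *)
Inductive tree := Leaf (c : R) | Node (A : {set B}) (U V : tree).

Definition tchild (T : tree) (e : B) : tree :=
  match T with Leaf c => Leaf c | Node A U V => if e \in A then U else V end.

Fixpoint height (T : tree) : nat :=
  match T with Leaf _ => 0%N | Node _ U V => (maxn (height U) (height V)).+1 end.

Fixpoint tshift (r : R) (T : tree) : tree :=
  match T with
  | Leaf c => Leaf (c + r)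
  | Node A U V => Node A (tshift r U) (tshift r V)
  end.

Context (al : R).
Hypothesis card_al : #|B|%:R * al = 1.

Fixpoint tmoment (f : R -> R) (T : tree) : R :=
  match T with
  | Leaf c => f c
  | Node A U V => al * #|A|%:R * tmoment f U + (1 - al * #|A|%:R) * tmoment f V
  end.

Local Notation tmean := (tmoment id).
Local Notation tsq := (tmoment (fun x => x ^+ 2)).

Fixpoint tmax (T : tree) (L : R) : R :=
  match T with
  | Leaf c => Num.max L c
  | Node A U V => let M := Num.max L (tmean T) in
     al * #|A|%:R * tmax U M + (1 - al * #|A|%:R) * tmax V M
  end.

Fixpoint tbmo (T : tree) : Prop :=
  match T with
  | Leaf _ => True
  | Node A U V => [/\ tsq T - tmean T ^+ 2 <= 1, tbmo U & tbmo V]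
  end.

Let al0 : 0 < al := al_gt0 card_al.

Lemma weight01 (A : {set B}) : 0 <= al * #|A|%:R <= 1.
Proof.
rewrite mulr_ge0 ?(ltW al0)//= mulrC.
have h : #|A|%:R <= #|B|%:R :> R by rewrite ler_nat max_card.
by apply: le_trans (ler_wpM2r (ltW al0) h) _; rewrite card_al.
Qed.

Lemma mean_split (A : {set B}) (x y : R) : al * \sum_e (if e \in A then x else y) =
  al * #|A|%:R * x + (1 - al * #|A|%:R) * y.
Proof.
rewrite (bigID (mem A)) /=.
rewrite (eq_bigr (fun=> x)); last by move=> e ->.
rewrite [X in _ + X](eq_bigr (fun=> y)); last by move=> e /negbTE ->.
rewrite !sumr_const mulrDr -(mulr_natr x) -(mulr_natr y).
have -> : #|[pred i | i \notin A]|%:R = #|B|%:R - #|A|%:R :> R.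
  by rewrite -(cardC (mem A)) natrD addrAC subrr add0r.
have -> : 1 - al * #|A|%:R = al * (#|B|%:R - #|A|%:R).
  by rewrite mulrBr [al * #|B|%:R]mulrC card_al.
ring.
Qed.

Lemma tmoment_child f T : tmoment f T = al * \sum_e tmoment f (tchild T e).
Proof.
case: T => [c|A U V] /=; first by rewrite mean_cst.
by rewrite -mean_split; congr (_ * _); apply: eq_bigr => e _; case: ifP.
Qed.

Lemma tmax_smax T d L : (height T <= d)%N -> smax al tchild tmean id d T L = tmax T L.
Proof.
elim: d T L => [|d IH] [c|A U V] L //=.
  move=> _; rewrite [in LHS](eq_bigr (fun=> Num.max L c)) ?mean_cst// => e _.
  by rewrite IH//= -maxA maxxx.
rewrite ltnS geq_max => /andP[hU hV]; rewrite -[RHS]mean_split; congr (_ * _).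
by apply: eq_bigr => e _; case: ifP => _; rewrite IH.
Qed.

Lemma tmean_sq_le T : tmean T ^+ 2 <= tsq T.
Proof.
elim: T => [c|A U hU V hV] //=; have /andP[w0 w1] := weight01 A.
set w := al * _ in w0 w1 *.
have h1 := ler_wpM2l w0 hU; have h2 : (1 - w) * tmean V ^+ 2 <= (1 - w) * tsq V.
  by rewrite ler_wpM2l// subr_ge0.
have h3 : 0 <= w * (1 - w) * (tmean U - tmean V) ^+ 2.
  by rewrite mulr_ge0 ?sqr_ge0// mulr_ge0// subr_ge0.
move: (tmean U) (tmean V) (tsq U) (tsq V) h1 h2 h3 => x y x2 y2; lra.
Qed.

Lemma tbmo_child T e : tbmo T -> tbmo (tchild T e).
Proof. by case: T => [//|A U V] /= [_ hU hV]; case: ifP. Qed.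

Lemma tbmo_var T : tbmo T -> tsq T - tmean T ^+ 2 <= 1.
Proof. by case: T => [c _|A U V []//] /=; rewrite subrr. Qed.

Lemma tmoment_shift r T : tmean (tshift r T) = tmean T + r /\
  tsq (tshift r T) = tsq T + 2 * r * tmean T + r ^+ 2.
Proof.
elim: T => [c|A U [U1 U2] V [V1 V2]] /=; first by split=> //; ring.
by rewrite U1 U2 V1 V2; split; ring.
Qed.

Lemma tbmo_shift r T : tbmo T -> tbmo (tshift r T).
Proof.
elim: T => [//|A U hU V hV] h; have [h1 /hU h2 /hV h3] := h; split=> //.
by have [-> ->] := tmoment_shift r (Node A U V); move: h1 => /=; lra.
Qed.

Lemma tmax_shift r T L : tmax (tshift r T) (L + r) = tmax T L + r.
Proof.
have mx x y : Num.max (x + r) (y + r) = Num.max x y + r by rewrite addr_maxl.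
elim: T L => [c|A U hU V hV] L /=; first exact: mx.
have [e1 _] := tmoment_shift r (Node A U V); rewrite /= in e1; rewrite e1 mx hU hV; ring.
Qed.

Lemma tmax_mono T L L' : L <= L' -> tmax T L <= tmax T L'.
Proof. by move=> h; rewrite -!(tmax_smax _ (leqnn _)) smax_mono. Qed.

Lemma tmax_ge T L : L <= tmax T L.
Proof. by rewrite -(tmax_smax _ (leqnn _)) smax_ge. Qed.

Lemma tmax_mean T L : tmax T (Num.max L (tmean T)) = tmax T L.
Proof. by rewrite -!(tmax_smax _ (leqnn _)) smax_max. Qed.

Lemma tmax_Node (A : {set B}) U V L :
  al * #|A|%:R * tmax U L + (1 - al * #|A|%:R) * tmax V L <= tmax (Node A U V) L.
Proof.
have /andP[w0 w1] := weight01 A.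
by rewrite /= lerD// ler_wpM2l ?subr_ge0// tmax_mono// le_max lexx.
Qed.

(** Makes the supremum in [achieve_sup] finite. *)
Lemma tmax_le1 T : tbmo T -> tmean T <= 0 -> tmax T 0 <= 1.
Proof.
move=> hT p0; rewrite -(tmax_smax _ (leqnn _)).
have := @smax_le_sqrt R tree B al tchild card_al (fun=> True) tmean tsq
  (fun _ _ _ => I) (fun T _ => tmoment_child id T) (fun T _ => tmoment_child _ T)
  (fun T _ => tmean_sq_le T) (height T) T 0 I p0.
move=> /le_trans; apply; rewrite mulr0 mul0r subr0 expr0n addr0.
rewrite -lerBrDl; have h := tbmo_var hT.
rewrite -[leRHS]ger0_norm; last by rewrite subr_ge0 (le_trans p0).
rewrite -sqrtr_sqr ler_wsqrtr//; move: (tmean T) (tsq T) p0 h => x y; nra.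
Qed.

Context (H : {set B}) (e0 : B).
Hypothesis halfH : al * #|H|%:R = 2^-1.

Definition between (U V : tree) (th : R) : Prop := exists T,
  [/\ tmean T = th * tmean U + (1 - th) * tmean V,
      tsq T = th * tsq U + (1 - th) * tsq V, tbmo T &
      th * tmax U 0 + (1 - th) * tmax V 0 <= tmax T 0].

(** Bisection along the binary digits of the weight, using half of the children. The moments of
    every intermediate node lie on the segment between those of [U] and [V], where [seg] bounds the
    variance. *)
Lemma between_dyadic U V k j : tbmo U -> tbmo V ->
  (forall th, 0 <= th <= 1 -> th * tsq U + (1 - th) * tsq V
      - (th * tmean U + (1 - th) * tmean V) ^+ 2 <= 1) ->
  (j <= 2 ^ k)%N -> between U V (j%:R / 2 ^+ k).
Proof.
move=> hU hV seg; elim: k j => [|k IH] j jk.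
  case: j jk => [|[|//]] _; rewrite expr0 divr1; [exists V|exists U].
    by split=> //; rewrite mul0r add0r subr0 mul1r.
  by split=> //; rewrite subrr mul0r addr0 mul1r.
have hj : (j./2 <= 2 ^ k)%N by rewrite -(doubleK (2 ^ k)%N) half_leq// -mul2n -expnS.
have jE2 : j%:R = 2 * j./2%:R + (odd j)%:R :> R.
  by rewrite -[j in LHS]odd_double_half natrD -muln2 natrM; ring.
case: (boolP (odd j)) => oj; last first.
  have -> : j%:R / 2 ^+ k.+1 = j./2%:R / 2 ^+ k :> R.
    by rewrite jE2 (negbTE oj) mulr0n addr0 exprS; field; rewrite expf_neq0.
  exact: IH.
have hj' : (j./2.+1 <= 2 ^ k)%N.
  have := jk; rewrite -[j in (j <= _)%N]odd_double_half oj expnS mul2n add1n ltn_double//.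
have [T1 [m1 s1 b1 x1]] := IH _ hj; have [T2 [m2 s2 b2 x2]] := IH _ hj'.
set th1 := _ / _ in m1 s1 x1; set th2 := _ / _ in m2 s2 x2.
have thE : j%:R / 2 ^+ k.+1 = 2^-1 * th1 + (1 - 2^-1) * th2.
  by rewrite jE2 oj mulr1n /th1 /th2 -[j./2.+1%:R]natr1 exprS; field; rewrite expf_neq0.
have th01 : 0 <= (j%:R / 2 ^+ k.+1 : R) <= 1.
  rewrite divr_ge0 ?exprn_ge0//= ler_pdivrMr ?exprn_gt0// mul1r -natrX ler_nat//.
exists (Node H T1 T2); have mE : tmean (Node H T1 T2) =
   j%:R / 2 ^+ k.+1 * tmean U + (1 - j%:R / 2 ^+ k.+1) * tmean V.
  by rewrite /= halfH m1 m2 thE; field.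
have sE : tsq (Node H T1 T2) =
   j%:R / 2 ^+ k.+1 * tsq U + (1 - j%:R / 2 ^+ k.+1) * tsq V.
  by rewrite /= halfH s1 s2 thE; field.
split=> //; first by split=> //; rewrite mE sE; exact: seg.
apply: le_trans (tmax_Node H T1 T2 0); rewrite halfH thE.
move: x1 x2; move: (tmax _ _) (tmax _ _) (tmax _ _) (tmax _ _) => y1 y2 y3 y4; lra.
Qed.

(** The level is normalised to 0, and the variance is exactly 1, where the planes touch [b_fun]. *)
Definition achieve (p c : R) : Prop := forall eps, 0 < eps -> exists T,
  [/\ tmean T = p, tsq T = p ^+ 2 + 1, tbmo T & c - eps <= tmax T 0].

Lemma achieve_le p c c' : c' <= c -> achieve p c -> achieve p c'.
Proof.
move=> cc h eps eps0; have [T [? ? ? hT]] := h _ eps0; exists T; split=> //.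
by apply: le_trans hT; rewrite lerD2r.
Qed.

Lemma achieve0 p : achieve p 0.
Proof.
move=> eps eps0; exists (Node H (Leaf (p + 1)) (Leaf (p - 1))).
have mE : tmean (Node H (Leaf (p + 1)) (Leaf (p - 1))) = p.
  by rewrite /= halfH; field.
have sE : tsq (Node H (Leaf (p + 1)) (Leaf (p - 1))) = p ^+ 2 + 1.
  by rewrite /= halfH; field.
split=> //; first by split=> //; rewrite mE sE addrAC subrr add0r.
by apply: le_trans (tmax_ge _ _); rewrite sub0r oppr_le0 ltW.
Qed.

Lemma achieve_le1 p c : p <= 0 -> achieve p c -> c <= 1.
Proof.
move=> p0 h; apply/ler_addgt0Pr => e e_gt0.
have [T [mT _ bT hT]] := h _ e_gt0.
have := tmax_le1 bT; rewrite mT => /(_ p0); lra.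
Qed.

(** Having an optimal value allows [achieve_jump] to insert a nearly optimal tree at [p] into
    another tree at [p]. *)
Lemma achieve_sup p : p <= 0 -> exists c, achieve p c /\
  (forall c', achieve p c' -> c' <= c).
Proof.
move=> p0; have hs : has_sup [set c | achieve p c].
  split; first by exists 0; exact: achieve0.
  by exists 1 => c; exact: achieve_le1.
exists (sup [set c | achieve p c]); split; last first.
  by move=> c' hc; apply: ub_le_sup => //; case: hs.
move=> eps eps0; have e2 : 0 < eps / 2 by rewrite divr_gt0.
have [c hc cs] := sup_adherent e2 hs.
have [T [? ? ? hT]] := hc _ e2; exists T; split=> //; lra.
Qed.

Lemma achieve_shift h c : 0 <= h -> achieve 0 c -> achieve h (h + c).
Proof.
move=> h0 hc eps eps0; have [T [m s bT hT]] := hc _ eps0.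
have [m' s'] := tmoment_shift h T; exists (tshift h T); split.
- by rewrite m' m add0r.
- by rewrite s' m s; ring.
- exact: tbmo_shift.
rewrite -tmax_mean m' m add0r (max_idPr h0).
by have := tmax_shift h T 0; rewrite add0r => ->; lra.
Qed.

(** One child jumps up by [(1 - u ^+ 2) / u]; of the others, a share [om] restarts at [p] and the
    rest stops at [p - u]. Over repeated restarts the jump has probability [u ^+ 2], which is the
    equation for [om], and the two displacements keep the mean at [p] and the variance at 1. Instead
    of iterating, the optimal value [s] is shown to satisfy [al * c + (1 - al) * om * s <= s]. *)
Lemma achieve_jump p u om k j c : p <= 0 -> 0 < u ->
  om = j%:R / 2 ^+ k -> (j < 2 ^ k)%N -> u ^+ 2 * (1 - (1 - al) * om) = al ->
  achieve (p + (1 - u ^+ 2) / u) c -> achieve p (u ^+ 2 * c).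
Proof.
move=> p0 u0 omE jk uE hc.
have [s [hs smax_]] := achieve_sup p0.
have al1 : al <= 1.
  have := weight01 [set e0]; rewrite cards1 mulr1 => /andP[]//.
have om0 : 0 <= om by rewrite omE divr_ge0 ?exprn_ge0.
have om1 : om < 1 by rewrite omE ltr_pdivrMr ?exprn_gt0// mul1r -natrX ltr_nat.
have u1 : u ^+ 2 <= 1.
  rewrite -(ler_pM2r (_ : 0 < 1 - (1 - al) * om)).
    rewrite uE mul1r lerBrDr; have : (1 - al) * om <= (1 - al) * 1.
      by rewrite ler_wpM2l ?subr_ge0// ltW.
    lra.
  by rewrite -(pmulr_rgt0 _ (exprn_gt0 2 u0)) uE.
apply: (@achieve_le _ s) => //.
have key eps : 0 < eps -> al * (c - eps) + (1 - al) * om * (s - eps) <= s.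
  move=> eps0; have [Y [mY sY bY xY]] := hc _ eps0.
  have [X [mX sX bX xX]] := hs _ eps0.
  have seg th : 0 <= th <= 1 -> th * tsq X + (1 - th) * tsq (Leaf (p - u))
      - (th * tmean X + (1 - th) * tmean (Leaf (p - u))) ^+ 2 <= 1.
    move=> /andP[t0 t1]; rewrite mX sX /=.
    have -> : th * (p ^+ 2 + 1) + (1 - th) * (p - u) ^+ 2 - (th * p + (1 - th) * (p - u)) ^+ 2
      = 1 - (1 - th) * (1 - th * u ^+ 2) by ring.
    rewrite gerBl mulr_ge0 ?subr_ge0//.
    by apply: (le_trans _ u1); rewrite ler_piMl ?sqr_ge0.
  have [Z [mZ sZ bZ xZ]] := between_dyadic bX (I : tbmo (Leaf (p - u))) seg (ltnW jk).
  rewrite -omE mX sX /= in mZ sZ xZ.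
  have aomE : al * (1 - u ^+ 2) = (1 - al) * (1 - om) * u ^+ 2.
    apply/eqP; rewrite -subr_eq0; apply/eqP.
    rewrite (_ : _ - _ = al - u ^+ 2 * (1 - (1 - al) * om)); last by ring.
    by rewrite uE subrr.
  have mE : tmean (Node [set e0] Y Z) = p.
    rewrite /= cards1 mulr1 mY mZ.
    have -> : al * (p + (1 - u ^+ 2) / u) + (1 - al) * (om * p + (1 - om) * (p - u)) =
      p + (al * (1 - u ^+ 2) - (1 - al) * (1 - om) * u ^+ 2) / u.
      by field; exact: lt0r_neq0.
    by rewrite aomE subrr mul0r addr0.
  have sE : tsq (Node [set e0] Y Z) = p ^+ 2 + 1.
    rewrite /= cards1 mulr1 sY sZ.
    have -> : al * ((p + (1 - u ^+ 2) / u) ^+ 2 + 1)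
       + (1 - al) * (om * (p ^+ 2 + 1) + (1 - om) * (p - u) ^+ 2) =
      p ^+ 2 + al + (1 - al) * om + 2 * p * ((al * (1 - u ^+ 2) - (1 - al) * (1 - om) * u ^+ 2) / u)
      + (al * (1 - u ^+ 2)) * (1 - u ^+ 2) / u ^+ 2 + (1 - al) * (1 - om) * u ^+ 2.
      by field; exact: lt0r_neq0.
    rewrite aomE subrr mul0r mulr0 addr0.
    by field; exact: lt0r_neq0.
  apply: smax_ => eps' eps'0; exists (Node [set e0] Y Z); split=> //.
    by split=> //; rewrite mE sE addrAC subrr add0r.
  apply: le_trans (tmax_Node _ _ _ _); rewrite cards1 mulr1.
  have h1 := ler_wpM2l (ltW al0) xY.
  have h2 : om * (s - eps) <= tmax Z 0.
    apply: le_trans xZ; apply: (@le_trans _ _ (om * tmax X 0)).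
      by rewrite ler_wpM2l.
    by rewrite lerDl mulr_ge0 ?subr_ge0 ?(ltW om1)// le_max lexx.
  have h3 : (1 - al) * (om * (s - eps)) <= (1 - al) * tmax Z 0 by rewrite ler_wpM2l// subr_ge0.
  lra.
have {}key : al * c + (1 - al) * om * s <= s.
  apply/ler_addgt0Pr => e ePos; have := key _ ePos.
  have : (al + (1 - al) * om) * e <= 1 * e.
    rewrite ler_wpM2r ?(ltW ePos)//; have : (1 - al) * om <= (1 - al) * 1.
      by rewrite ler_wpM2l ?subr_ge0// ltW.
    lra.
  lra.
have uV : 0 < u ^+ 2 by rewrite exprn_gt0.
have D0 : 0 < 1 - (1 - al) * om by rewrite -(pmulr_rgt0 _ uV) uE.
rewrite -(ler_pM2r D0) mulrAC uE; lra.
Qed.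

Context (a b : R).
Hypotheses (a_gt0 : 0 < a) (a_sq : 2 * a ^+ 2 <= 1) (ab : a * b = 1).
Hypothesis alE : al = a ^+ 2.

Lemma pow2_small (eps : R) : 0 < eps -> exists k, (2 ^+ k)^-1 <= eps.
Proof.
move=> eps0; exists (Num.truncn eps^-1).+1.
rewrite -[leRHS]invrK lef_pV2 ?posrE ?exprn_gt0 ?invr_gt0//.
apply: (le_trans (ltW (truncnS_gt _))).
by rewrite -natrX ler_nat ltnW// ltn_expl.
Qed.

(* The dyadic numbers [om] approximate the one that makes [u ^+ 2] the jump probability. *)
Lemma dyadic_jump u eps : a <= u -> u < 1 -> 0 < eps -> exists u' om k j,
  [/\ a <= u' <= u, u - u' <= eps, om = j%:R / 2 ^+ k, (j < 2 ^ k)%N &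
      u' ^+ 2 * (1 - (1 - al) * om) = al].
Proof.
move=> au u1 eps0; have a0 := a_gt0.
have u0 : 0 < u := lt_le_trans a0 au.
have a1 : a < 1 := le_lt_trans au u1.
have al1 : al < 1 by rewrite alE expr_lt1// ltW.
have del0 : 0 < eps * (2 * a) * al by rewrite !mulr_gt0.
have [k hk] := pow2_small del0.
have u20 : 0 < u ^+ 2 by rewrite exprn_gt0.
have aluu : al <= u ^+ 2 by rewrite alE ler_sqr ?nnegrE ?(ltW a0) ?(ltW u0).
have onem : 0 < 1 - al by rewrite subr_gt0.
set om := (1 - al / u ^+ 2) / (1 - al).
have om0 : 0 <= om by rewrite divr_ge0 ?(ltW onem)// subr_ge0 ler_pdivrMr// mul1r.
have om1 : om < 1.
  rewrite ltr_pdivrMr// mul1r ltrD2l ltrN2 ltr_pdivlMr// gtr_pMr//.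
  by rewrite expr_lt1// ltW.
have k0 : 0 < 2 ^+ k :> R by rewrite exprn_gt0.
set j := Num.truncn (om * 2 ^+ k).
have /andP[j1 j2] : j%:R <= om * 2 ^+ k < j.+1%:R.
  by apply: truncn_itv; rewrite mulr_ge0// ltW.
have jk : (j < 2 ^ k)%N.
  rewrite -(ltr_nat R) natrX; apply: (le_lt_trans j1).
  by rewrite -[ltRHS]mul1r ltr_pM2r.
pose om' : R := j%:R / 2 ^+ k.
have om'1 : om' <= om by rewrite ler_pdivrMr.
have om'2 : om - om' <= (2 ^+ k)^-1.
  rewrite lerBlDr -[(2 ^+ k)^-1]mul1r -mulrDl ler_pdivlMr// addrC.
  by rewrite natr1 ltW.
have om'0 : 0 <= om' by rewrite divr_ge0// ltW.
set E := 1 - (1 - al) * om'.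
have DE : al / u ^+ 2 <= E.
  have : (1 - al) * om' <= (1 - al) * om by rewrite ler_wpM2l// ltW.
  have -> : (1 - al) * om = 1 - al / u ^+ 2 by rewrite mulrC divfK// gt_eqF.
  rewrite /E; lra.
have E1 : E <= 1 by rewrite gerBl mulr_ge0// ltW.
have alu : al <= al / u ^+ 2.
  by rewrite ler_pdivlMr// ler_piMr ?(ltW al0)// expr_le1// ltW.
have E0 : 0 < E by apply: lt_le_trans DE; rewrite divr_gt0.
have alE0 : 0 <= al / E by rewrite divr_ge0 ?(ltW al0) ?(ltW E0).
set u' := Num.sqrt (al / E).
have u'2 : u' ^+ 2 = al / E by rewrite sqr_sqrtr.
have u'0 : 0 <= u' by exact: sqrtr_ge0.
have au' : a <= u'.
  rewrite -ler_sqr ?nnegrE ?(ltW a0)// u'2 -alE ler_pdivlMr// ler_piMr// ltW//.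
have u'u : u' <= u.
  rewrite -ler_sqr ?nnegrE ?(ltW u0)// u'2 ler_pdivrMr// mulrC.
  by rewrite -ler_pdivrMr.
exists u', om', k, j; split=> //; first by rewrite au'.
  have h1 : (u - u') * (2 * a) <= u ^+ 2 - u' ^+ 2.
    rewrite subr_sqr ler_wpM2l ?subr_ge0//; lra.
  have h2 : (u ^+ 2 - u' ^+ 2) * al <= (2 ^+ k)^-1.
    rewrite u'2.
    have -> : (u ^+ 2 - al / E) * al = (E - al / u ^+ 2) * (u ^+ 2 * (al / E)).
      by field; rewrite !lt0r_neq0.
    have -> : E - al / u ^+ 2 = (1 - al) * (om - om').
      have -> : al / u ^+ 2 = 1 - (1 - al) * om by rewrite [_ * om]mulrC divfK ?gt_eqF//; ring.
      by rewrite /E; ring.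
    have q1 : al / E <= 1 by rewrite ler_pdivrMr// mul1r (le_trans alu).
    have q2 : u ^+ 2 <= 1 by rewrite expr_le1// ltW.
    have q3 : u ^+ 2 * (al / E) <= 1 by apply: mulr_ile1 => //; exact: ltW.
    have q4 : 1 - al <= 1 by rewrite gerBl ltW.
    apply: le_trans om'2; rewrite -mulrA mulrCA ler_piMr ?subr_ge0//.
    by apply: mulr_ile1 => //; [exact: ltW|rewrite mulr_ge0// ltW].
  rewrite -(ler_pM2r (_ : 0 < 2 * a)) ?mulr_gt0// -(ler_pM2r al0).
  apply: le_trans hk; apply: le_trans h2; by rewrite ler_wpM2r// ltW.
by rewrite u'2 -/E divfK// gt_eqF.
Qed.

(** A jump from 0 leads to a shifted copy of the optimal tree at 0. The resulting inequality
    [u' ^+ 2 * (h + s) <= s] gives [u' <= s], with [u'] as close to 1 as desired. *)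
Lemma achieve01 : achieve 0 1.
Proof.
have [s [hs smax_]] := achieve_sup (lexx 0).
apply: (@achieve_le _ s) => //; apply/ler_addgt0Pr => e e_gt0.
have a0 := a_gt0; have a1 : a < 1 := a_lt1 a_gt0 a_sq ab.
have e2 : 0 < e / 2 by rewrite divr_gt0.
set u := Num.max a (1 - e / 2).
have u1 : u < 1 by rewrite gt_max a1 gtrBl.
have au : a <= u by rewrite le_max lexx.
have ue : 1 - e / 2 <= u by rewrite le_max lexx orbT.
have [u' [om [k [j [/andP[au' u'u] ue' omE jk uE]]]]] := dyadic_jump au u1 e2.
have u'0 : 0 < u' := lt_le_trans a0 au'.
have u'1 : u' < 1 := le_lt_trans u'u u1.
have o0 : 0 < 1 - u' ^+ 2 by rewrite subr_gt0 expr_lt1// ltW.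
set h := 0 + (1 - u' ^+ 2) / u'.
have h0 : 0 <= h by rewrite /h add0r divr_ge0// ltW.
have := smax_ _ (achieve_jump (lexx 0) u'0 omE jk uE (achieve_shift h0 hs)).
have -> : u' ^+ 2 * (h + s) = u' * (1 - u' ^+ 2) + u' ^+ 2 * s.
  by rewrite /h; field; exact: lt0r_neq0.
rewrite -lerBrDr.
have -> : s - u' ^+ 2 * s = s * (1 - u' ^+ 2) by ring.
rewrite ler_pM2r//; lra.
Qed.

Lemma achieve_curve0 u : a <= u <= 1 -> achieve ((3 * u - u^-1) / 2 - 1) ((u + u ^+ 3) / 2).
Proof.
move=> /andP[au]; have a0 := a_gt0; have a1 : a < 1 := a_lt1 a_gt0 a_sq ab.
have u0 : 0 < u := lt_le_trans a0 au.
rewrite le_eqVlt => /predU1P[->|u1].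
  have -> : (3 * 1 - 1^-1) / 2 - 1 = 0 :> R by rewrite invr1; field.
  have -> : (1 + 1 ^+ 3) / 2 = 1 :> R by rewrite expr1n; field.
  exact: achieve01.
move=> eps eps0; set p := _ - 1.
have uV1 : 1 < u^-1 by rewrite invf_gt1.
have p0 : p <= 0 by rewrite /p; lra.
have b0 : 0 < b := lt_trans ltr01 (b_gt1 a_gt0 a_sq ab).
have e2 : 0 < eps / 2 by rewrite divr_gt0.
set C := 1 + (1 + u^-1) / 2.
have C0 : 0 < C by rewrite /C; lra.
set del := Num.min 1 (eps / 2 / C).
have del0 : 0 < del by rewrite lt_min ltr01 divr_gt0.
have [u' [om [k [j [/andP[au' u'u] ue' omE jk uE]]]]] := dyadic_jump au u1 del0.
have u'0 : 0 < u' := lt_le_trans a0 au'.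
set h := p + (1 - u' ^+ 2) / u'.
(* Approximating [u] from below lengthens the jump, so it still lands at or above the level. *)
have h0 : 0 <= h.
  have e1 : (1 - u' ^+ 2) / u' = u'^-1 - u' by field; exact: lt0r_neq0.
  have : u^-1 <= u'^-1 by rewrite lef_pV2.
  rewrite /h e1 /p.
  have : 0 < u^-1 by rewrite invr_gt0.
  have := @amgm1 _ u u^-1 u0; rewrite invr_gt0 => /(_ u0); rewrite divff ?gt_eqF// => /(_ erefl).
  lra.
have hj := achieve_jump p0 u'0 omE jk uE (achieve_shift h0 achieve01).
have [T [? ? ? hT]] := hj _ e2; exists T; split=> //; apply: le_trans hT.
(* The jump with parameter [u'] from [p] yields [u' + (p + 1) * u' ^+ 2 - u' ^+ 3], which is a
   tangent of [b_fun] evaluated at [p]. The value [u] is critical for it, hence a quadratic loss. *)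
have gE : (u + u ^+ 3) / 2 - u' ^+ 2 * (h + 1) = (u' - u) ^+ 2 * (u' + (u + u^-1) / 2).
  by rewrite /h /p; field; rewrite !lt0r_neq0.
have g1 : (u' - u) ^+ 2 * (u' + (u + u^-1) / 2) <= eps / 2.
  have h1 : (u' - u) ^+ 2 <= del.
    rewrite -sqrrN opprB; apply: le_trans (_ : del ^+ 2 <= del).
      by rewrite ler_sqr ?nnegrE ?subr_ge0// ltW.
    by rewrite expr2 ler_piMr ?(ltW del0)// ge_min lexx.
  have h2 : u' + (u + u^-1) / 2 <= C by rewrite /C; lra.
  have h3 : 0 <= u' + (u + u^-1) / 2.
    by rewrite addr_ge0 ?(ltW u'0)// divr_ge0// addr_ge0 ?invr_ge0 ?(ltW u0).
  apply: (le_trans (ler_pM (sqr_ge0 _) h3 h1 h2)).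
  by rewrite -ler_pdivlMr// ge_min lexx orbT.
lra.
Qed.

(** Without restarts the jump has the probability [a ^+ 2] of a single child, and its height is one
    period. *)
Lemma achieve_period p c : p <= 0 -> achieve (p + (b - a)) c -> achieve p (a ^+ 2 * c).
Proof.
move=> p0 h; apply: (@achieve_jump p a 0 0 0 c p0 a_gt0).
- by rewrite mul0r.
- by rewrite expn0.
- by rewrite mulr0 subr0 mulr1 alE.
suff -> : (1 - a ^+ 2) / a = b - a by [].
have -> : b = a^-1.
  by apply: (mulfI (lt0r_neq0 a_gt0)); rewrite ab divff// gt_eqF ?a_gt0.
by field; exact: lt0r_neq0 a_gt0.
Qed.

Lemma achieve_curve k u : a <= u <= 1 ->
  achieve ((3 * u - u^-1) / 2 - 1 - k%:R * (b - a)) ((a ^+ 2) ^+ k * ((u + u ^+ 3) / 2)).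
Proof.
move=> hu; have /andP[au u1] := hu; have u0 := lt_le_trans a_gt0 au.
have t0 := tau_gt0 a_gt0 a_sq ab.
elim: k => [|k IH]; first by rewrite mul0r subr0 expr0 mul1r; exact: achieve_curve0.
rewrite exprS -mulrA; apply: achieve_period.
  have : 1 <= u^-1 by rewrite invf_ge1.
  have : 0 <= k.+1%:R * (b - a) by rewrite mulr_ge0// ltW.
  lra.
by rewrite -[k.+1%:R]natr1 (_ : _ + (b - a) = (3 * u - u^-1) / 2 - 1 - k%:R * (b - a)); last ring.
Qed.

(** On the affine pieces the last jump lands at or above the level, at [(u + u^-1) / 2 - 1], where a
    shifted tree from [achieve01] takes over. *)
Lemma achieve_line k u : 1 <= u <= b ->
  achieve ((u + u^-1) / 2 - 1 - k.+1%:R * (b - a)) ((a ^+ 2) ^+ k.+1 * ((u + u^-1) / 2)).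
Proof.
move=> /andP[u1 ub]; have u0 : 0 < u := lt_le_trans ltr01 u1.
have t0 := tau_gt0 a_gt0 a_sq ab; have a1 := a_lt1 a_gt0 a_sq ab.
have b1 := b_gt1 a_gt0 a_sq ab.
have uV0 : 0 < u^-1 by rewrite invr_gt0.
have uV1 : u^-1 <= 1 by rewrite invf_le1.
have am : 2 <= u + u^-1 by apply: amgm1 => //; rewrite divff// gt_eqF.
elim: k => [|k IH]; rewrite exprS -mulrA; apply: achieve_period.
- rewrite mul1r; lra.
- rewrite expr0 mul1r mul1r.
  have -> : (u + u^-1) / 2 - 1 - (b - a) + (b - a) = (u + u^-1) / 2 - 1 by ring.
  have {2}-> : (u + u^-1) / 2 = (u + u^-1) / 2 - 1 + 1 by ring.
  by apply: achieve_shift achieve01; lra.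
- have : 1 * (b - a) <= k.+2%:R * (b - a).
    by rewrite ler_wpM2r ?ler1n// ltW.
  lra.
by rewrite -[k.+2%:R]natr1 (_ : _ + (b - a) = (u + u^-1) / 2 - 1 - k.+1%:R * (b - a)); last ring.
Qed.

End trees.

(** * Geometry and measure of dyadic cubes *)

Section cubes.
Context {R : realType} {n : nat}.
Local Notation mu := (@lebesgue R n).
Local Notation B := {ffun 'I_n -> bool}.
Implicit Types (m : int) (z : 'I_n -> int).

Definition vol (m : int) : R := ((2 : R) ^ (- m)) ^+ n.

Definition child z (e : B) : 'I_n -> int := fun i => z i * 2 + (e i)%:Z.

Lemma side_gt0 m : 0 < (2 : R) ^ (- m). Proof. exact: exprz_gt0. Qed.

Lemma sideD m (k : nat) : (2 : R) ^ (- m) = 2 ^ (- (m + k%:Z)) * 2 ^+ k.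
Proof. by rewrite [2 ^+ k]exprnP -expfzDr// opprD addrNK. Qed.

Lemma sideS m : (2 : R) ^ (- m) = 2 ^ (- (m + 1)) * 2.
Proof. by rewrite (sideD m 1). Qed.

Lemma vol_gt0 m : 0 < vol m.
Proof. by rewrite exprn_gt0// side_gt0. Qed.

Lemma volS m : vol m = vol (m + 1) * 2 ^+ n.
Proof. by rewrite /vol (sideS m) exprMn. Qed.

Lemma measurable_box (A : 'I_n -> set (measurableTypeR R)) :
  (forall i, measurable (A i)) -> measurable [set x : Rn R n | forall i, A i (tnth x i)].
Proof.
move=> mA; rewrite (_ : [set x | _] =
  \bigcap_(i in [set: 'I_n]) ((fun x => tnth x i) @^-1` A i)).
  apply: fin_bigcap_measurable => // i _.
  by rewrite -[X in measurable X]setTI; exact: measurable_tnth.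
by apply/seteqP; split => x /= h i; [move=> _|]; apply: h.
Qed.

Definition side_itv m z (i : 'I_n) : set (measurableTypeR R) :=
  `](2 : R) ^ (- m) * (z i)%:~R, 2 ^ (- m) * (z i + 1)%:~R[%classic.

Lemma measurable_side m z i : measurable (side_itv m z i).
Proof. exact: measurable_itv. Qed.

Lemma cube_box m z : cube m z = [set x : Rn R n | forall i, side_itv m z i (tnth x i)].
Proof. by apply/seteqP; split => x /= h i; have := h i; rewrite /side_itv /= in_itv. Qed.

Lemma measurable_cube m z : measurable (cube m z : set (Rn R n)).
Proof. by rewrite cube_box; apply: measurable_box => i; exact: measurable_side. Qed.

Lemma lebesgue_cube m z : mu (cube m z) = (vol m)%:E.
Proof.
rewrite cube_box lebesgue_box; last by move=> i; exact: measurable_side.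
rewrite (eq_bigr (fun=> ((2 : R) ^ (- m))%:E)).
  by rewrite prodEFin big_const_ord iter_mulr_1.
move=> i _; rewrite lebesgue_measure_itv /= lte_fin.
rewrite ltr_pM2l ?side_gt0// ltr_int ltrDl ltr01 -EFinD.
by congr EFin; rewrite intrD; ring.
Qed.

Lemma fine_cube m z : fine (mu (cube m z)) = vol m.
Proof. by rewrite lebesgue_cube. Qed.

Lemma hyperplane_null (i : 'I_n) (c : R) : mu [set x | tnth x i = c] = 0%E.
Proof.
pose A (j : 'I_n) : set (measurableTypeR R) := if j == i then [set c] else setT.
have mA j : measurable (A j) by rewrite /A; case: ifP.
rewrite (_ : [set x | _] = [set x : Rn R n | forall j, A j (tnth x j)]).
  by rewrite lebesgue_box// (bigD1 i)//= /A eqxx lebesgue_measure_set1 mul0e.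
apply/seteqP; split => x /=.
  by move=> xc j; rewrite /A; case: eqP => [->|].
by move=> /(_ i); rewrite /A eqxx.
Qed.

Lemma measurable_hyperplane (i : 'I_n) (c : R) : measurable [set x : Rn R n | tnth x i = c].
Proof.
have -> : [set x : Rn R n | tnth x i = c] = (fun x : Rn R n => tnth x i) @^-1` [set c] by [].
by rewrite -[X in measurable X]setTI; apply: measurable_tnth => //; exact: measurable_set1.
Qed.

Lemma ae_imp (P Q : Rn R n -> Prop) : (forall x, P x -> Q x) ->
  {ae mu, forall x, P x} -> {ae mu, forall x, Q x}.
Proof. by move=> PQ; apply: filterS => //; exact: (ae_filter_ringOfSetsType mu). Qed.

Lemma ae_and (P Q : Rn R n -> Prop) : {ae mu, forall x, P x} ->
  {ae mu, forall x, Q x} -> {ae mu, forall x, P x /\ Q x}.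
Proof. by move=> hP hQ; apply: filterI => //; exact: (ae_filter_ringOfSetsType mu). Qed.

(** Points off all dyadic hyperplanes; each of them lies in an open cube of every generation. *)
Definition generic (x : Rn R n) := forall i (m k : int), tnth x i <> 2 ^ (- m) * k%:~R.

Lemma ae_generic : {ae mu, forall x, generic x}.
Proof.
have h : {ae mu, forall x, forall N : nat,
    if unpickle N is Some (i, m, k) then
      tnth x (i : 'I_n) <> 2 ^ (- (m : int)) * (k : int)%:~R :> R else True}.
  apply: ae_foralln => N; case: unpickle => [[[i m] k]|]; last exact: aeW.
  exists [set x | tnth x i = 2 ^ (- m) * k%:~R]; split.
  - exact: measurable_hyperplane.
  - exact: hyperplane_null.
  - by move=> x /= /contrapT.
by apply: ae_imp h => x h i m k; have := h (pickle (i, m, k)); rewrite pickleK.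
Qed.

Lemma childE z e i (k : int) :
  (child z e i + k)%:~R = (z i)%:~R * 2 + (e i : nat)%:R + k%:~R :> R.
Proof. by rewrite /child !intrD intrM. Qed.

Lemma child0E z e i : (child z e i)%:~R = (z i)%:~R * 2 + (e i : nat)%:R :> R.
Proof. by rewrite -[child z e i]addr0 childE addr0. Qed.

Lemma cube_child_sub m z e : cube (m + 1) (child z e) `<=` (cube m z : set (Rn R n)).
Proof.
move=> x h i; have := h i; rewrite childE child0E (sideS m); have s0 := side_gt0 (m + 1).
set s := 2 ^ _ in s0 *; rewrite intrD; move: (tnth x i) ((z i)%:~R : R) => y w.
by case: (e i); rewrite ?mulr1n ?mulr0n ?mulr1z => /andP[h1 h2]; apply/andP; split; lra.
Qed.

Lemma trivIset_child m z (D : set B) :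
  trivIset D (fun e => cube (m + 1) (child z e) : set (Rn R n)).
Proof.
move=> e e' _ _ [x [h h']]; apply/ffunP => i; have := h i; have := h' i.
rewrite !childE !child0E; have s0 := side_gt0 (m + 1).
set s := 2 ^ _ in s0 *; move: (tnth x i) ((z i)%:~R : R) => y w.
by case: (e i); case: (e' i) => //=; rewrite ?mulr1n ?mulr0n ?mulr1z => /andP[h1 h2] /andP[h3
  h4]; lra.
Qed.

Lemma cube_child_cover m z (x : Rn R n) : generic x -> cube m z x ->
  exists e, cube (m + 1) (child z e) x.
Proof.
move=> gx h.
exists [ffun i => 2 ^ (- (m + 1)) * (z i * 2 + 1)%:~R < tnth x i] => i.
have := h i; rewrite childE child0E ffunE (sideS m).
have s0 := side_gt0 (m + 1).
have := gx i (m + 1) (z i * 2 + 1).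
set s := 2 ^ _ in s0 *; rewrite !intrD !intrM; move: (tnth x i) ((z i)%:~R : R) => y w.
have -> : 2%:~R = 2 :> R by []; have -> : 1%:~R = 1 :> R by [].
case: (ltgtP (s * (w * 2 + 1)) y) => [h1 _|h1 _|e ne]; last by case: ne; rewrite e.
1,2: by rewrite ?mulr1n ?mulr0n ?mulr1z => /andP[h2 h3]; apply/andP; split; lra.
Qed.

(** In units of the finer side, a common point gives strict inequalities between integers, which
    sharpen to the inclusion of the index intervals. *)
Lemma cube_nested m m' z z' (x : Rn R n) : m' <= m -> cube m z x -> cube m' z' x ->
  cube m z `<=` (cube m' z' : set (Rn R n)).
Proof.
move=> mm hx hx'.
have [k mE] : exists k : nat, m = m' + k%:Z.
  by exists `|m - m'|%N; rewrite gez0_abs ?subr_ge0// [RHS]addrC subrK.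
have s0 := side_gt0 m.
have e (w : int) : 2 ^+ k * w%:~R = (w * 2 ^+ k)%:~R :> R.
  by rewrite intrM rmorphXn /= mulrC.
have key i : z' i * 2 ^+ k <= z i /\ z i + 1 <= (z' i + 1) * 2 ^+ k.
  have /andP[h1 h2] := hx i; have /andP[h3 h4] := hx' i.
  rewrite (sideD m' k) -mE -!mulrA !e in h3 h4.
  have h5 := lt_trans h3 h2; have h6 := lt_trans h1 h4.
  rewrite ltr_pM2l// ltr_int in h5; rewrite ltr_pM2l// ltr_int in h6.
  by rewrite -ltzD1 h5 lezD1.
move=> y hy i; have /andP[h1 h2] := hy i; have [k1 k2] := key i.
rewrite (sideD m' k) -mE -!mulrA !e; apply/andP; split.
  by apply: le_lt_trans h1; rewrite ler_wpM2l ?ler_int// ltW.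
by apply: (lt_le_trans h2); rewrite ler_wpM2l ?ler_int// ltW.
Qed.

(** The index of the half-open cube, so that it is defined on boundaries as well. *)
Definition idx m (x : Rn R n) : 'I_n -> int := fun i => Num.floor (2 ^ m * tnth x i).

Lemma idx_cube m z (x : Rn R n) : cube m z x -> idx m x = z.
Proof.
move=> h; apply/funext => i; apply: floor_def; have /andP[h1 h2] := h i.
have s0 : 0 < (2 : R) ^ m by exact: exprz_gt0.
have e (y : R) : 2 ^ m * (2 ^ (- m) * y) = y.
  by rewrite mulrA -expfzDr// subrr expr0z mul1r.
rewrite -[(z i)%:~R]e -[(z i + 1)%:~R]e ler_pM2l// ltr_pM2l//.
by rewrite (ltW h1).
Qed.

Lemma cube_idx m (x : Rn R n) : generic x -> cube m (idx m x) x.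
Proof.
move=> gx i; have s0 : 0 < (2 : R) ^ m by exact: exprz_gt0.
have e : tnth x i = 2 ^ (- m) * (2 ^ m * tnth x i).
  by rewrite mulrA -expfzDr// addNr expr0z mul1r.
have /andP[h1 h2] := floor_itv (2 ^ m * tnth x i).
suff : 2 ^ (- m) * (idx m x i)%:~R < 2 ^ (- m) * (2 ^ m * tnth x i)
    < 2 ^ (- m) * (idx m x i + 1)%:~R by rewrite -e.
rewrite !ltr_pM2l ?side_gt0// h2 andbT lt_neqAle h1 andbT.
by apply/eqP => h; apply: (gx i m (idx m x i)); rewrite h.
Qed.

End cubes.

(** * Averages over cubes and the truncated maximal function *)

Section averages.
Context {R : realType} {n : nat}.
Local Notation mu := (@lebesgue R n).
Local Notation B := {ffun 'I_n -> bool}.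
Local Notation node := (int * ('I_n -> int))%type.
Implicit Types (i : node) (f g : Rn R n -> R).

Definition ncube i : set (Rn R n) := cube i.1 i.2.
Definition nchild i (e : B) : node := (i.1 + 1, child i.2 e).
Definition nmean f i : R := mean (ncube i) f.

Lemma measurable_ncube i : measurable (ncube i).
Proof. exact: measurable_cube. Qed.

Lemma lebesgue_ncube i : mu (ncube i) = (vol (R := R) (n := n) i.1)%:E.
Proof. exact: lebesgue_cube. Qed.

Lemma integral_ae_sub (U J : set (Rn R n)) (f : Rn R n -> \bar R) :
  measurable U -> measurable J -> U `<=` J -> {ae mu, forall x, J x -> U x} ->
  measurable_fun J f -> (\int[mu]_(x in J) f x = \int[mu]_(x in U) f x)%E.
Proof.
move=> mU mJ UJ ae mf; rewrite integral_mkcond [RHS]integral_mkcond.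
apply: ae_eq_integral => //.
- exact/(measurable_restrictT _ mJ).
- by apply/(measurable_restrictT _ mU); exact: measurable_funS mf.
apply: ae_imp ae => x h _; rewrite !patchE.
case: ifPn => [/set_mem Jx|Jx]; first by rewrite mem_set//; exact: h.
by rewrite ifF//; apply: contraNF Jx => /set_mem /UJ /mem_set.
Qed.

Lemma big_children i :
  \big[setU/set0]_(e <- index_enum B) ncube (nchild i e) = \bigcup_e ncube (nchild i e).
Proof.
rewrite -bigcup_seq; apply: eq_bigcupl; split => e _ //.
by rewrite /= mem_index_enum.
Qed.

Lemma children_sub i : \bigcup_e ncube (nchild i e) `<=` ncube i.
Proof. by move=> x [e _]; exact: cube_child_sub. Qed.

Lemma integral_children i f : measurable_fun (ncube i) f ->
  (\int[mu]_(x in ncube i) (f x)%:E =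
   \sum_e \int[mu]_(x in ncube (nchild i e)) (f x)%:E)%E.
Proof.
move=> mf; have mU : measurable (\bigcup_e ncube (nchild i e)).
  by rewrite -big_children; apply: bigsetU_measurable => e _; exact: measurable_ncube.
rewrite (@integral_ae_sub (\bigcup_e ncube (nchild i e))) //.
- rewrite -big_children integral_bigsetU_EFin //.
  + by move=> e; exact: measurable_ncube.
  + exact: index_enum_uniq.
  + exact: trivIset_child.
  + rewrite big_children; apply/measurable_EFinP; exact: (measurable_funS (measurable_ncube i)
      (@children_sub i) mf).
- exact: measurable_ncube.
- exact: children_sub.
- apply: ae_imp ae_generic => x gx Jx.
  by have [e he] := cube_child_cover gx Jx; exists e.
exact/measurable_EFinP.
Qed.

Definition nint i f := mu.-integrable (ncube i) (EFin \o f).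

Lemma nint_measurable i f : nint i f -> measurable_fun (ncube i) f.
Proof. by move=> /integrableP[/measurable_EFinP]. Qed.

Lemma nint_sub i (J : set (Rn R n)) f : measurable J -> ncube i `<=` J ->
  mu.-integrable J (EFin \o f) -> nint i f.
Proof. by move=> mJ sub; apply: integrableS => //; exact: measurable_ncube. Qed.

Lemma nint_child i e f : nint i f -> nint (nchild i e) f.
Proof. by apply: nint_sub; [exact: measurable_ncube|exact: cube_child_sub]. Qed.

Lemma nint_cst i c : nint i (fun=> c).
Proof.
apply/integrableP; split; first exact/measurable_EFinP.
rewrite /= integral_cst; last exact: measurable_ncube.
by rewrite [X in (_ * X)%E](lebesgue_ncube i) -EFinM ltry.
Qed.

Lemma nintD i f g : nint i f -> nint i g -> nint i (fun x => f x + g x).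
Proof. by move=> hf hg; exact: (integrableD (measurable_ncube i) hf hg). Qed.

Lemma nintZ i c f : nint i f -> nint i (fun x => c * f x).
Proof. by move=> hf; exact: (integrableZl (measurable_ncube i) c hf). Qed.

Lemma nint_abs i f : nint i f -> nint i (fun x => `|f x|).
Proof. by move=> hf; exact: (integrable_abse hf). Qed.

Lemma nint_le i f g : measurable_fun (ncube i) f -> (forall x, `|f x| <= g x) ->
  nint i g -> nint i f.
Proof.
move=> mf fg ig; apply: le_integrable ig; first exact: measurable_ncube.
  exact/measurable_EFinP.
by move=> x _; rewrite lee_fin (le_trans (fg x))// ler_norm.
Qed.

Lemma nint_sq i f : measurable_fun (ncube i) f -> nint i (fun x => f x ^+ 2) -> nint i f.
Proof.
move=> mf i2; apply: nint_le (nintD (nint_cst i 1) i2) => // x.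
rewrite -[f x ^+ 2]real_normK ?num_real//; have := sqr_ge0 (`|f x| - 1).
have := normr_ge0 (f x); move: `|f x| => y; rewrite sqrrB; nra.
Qed.

Lemma vol_neq0 m : vol (R := R) (n := n) m != 0.
Proof. by rewrite gt_eqF// vol_gt0. Qed.

Lemma nmeanE i f : nmean f i = (vol (R := R) (n := n) i.1)^-1 * \int[mu]_(x in ncube i) f x.
Proof. by rewrite /nmean /mean fine_cube. Qed.

Lemma nmean_int i f : nint i f ->
  (\int[mu]_(x in ncube i) (f x)%:E = (vol (R := R) (n := n) i.1 * nmean f i)%:E)%E.
Proof.
move=> hf; rewrite nmeanE mulrA mulfV ?vol_neq0// mul1r fineK//.
exact: (integrable_fin_num (measurable_ncube i) hf).
Qed.

Lemma nmeanD i f g : nint i f -> nint i g ->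
  nmean (fun x => f x + g x) i = nmean f i + nmean g i.
Proof. by move=> hf hg; rewrite !nmeanE RintegralD ?mulrDr//; exact: measurable_ncube. Qed.

Lemma nmeanZ i c f : nint i f -> nmean (fun x => c * f x) i = c * nmean f i.
Proof. by move=> hf; rewrite !nmeanE RintegralZl// 1?mulrCA//; exact: measurable_ncube. Qed.

Lemma nmean_cst i c : nmean (fun=> c) i = c.
Proof.
rewrite nmeanE Rintegral_cst; last exact: measurable_ncube.
by rewrite [X in fine X](lebesgue_ncube i) /= mulrCA mulVf ?vol_neq0 ?mulr1.
Qed.

Lemma nmean_le i f g : nint i f -> nint i g -> (forall x, ncube i x -> f x <= g x) ->
  nmean f i <= nmean g i.
Proof.
move=> hf hg fg; rewrite !nmeanE ler_wpM2l ?invr_ge0 ?(ltW (vol_gt0 _))//.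
by apply: le_Rintegral => //; exact: measurable_ncube.
Qed.

Lemma nmean_eq i f g : (forall x, ncube i x -> f x = g x) -> nmean f i = nmean g i.
Proof.
move=> fg; rewrite !nmeanE; congr (_ * _); congr fine; apply: eq_integral => x.
by move=> /set_mem /fg ->.
Qed.

Lemma nmean_children i f : nint i f ->
  nmean f i = alpha n * \sum_e nmean f (nchild i e).
Proof.
move=> hf; have := integral_children (nint_measurable hf).
rewrite nmean_int// (eq_bigr (fun e => (vol (R := R) (n := n) (i.1 + 1) * nmean f (nchild i
  e))%:E)).
  rewrite sumEFin => -[]; rewrite volS -mulr_sumr -mulrA.
  move=> /(mulfI (vol_neq0 _)) <-; rewrite mulrA [alpha n * _]mulVf ?mul1r//.
by move=> e _; rewrite nmean_int//; exact: nint_child.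
Qed.

Lemma nmean_sqB i f c : measurable_fun (ncube i) f -> nint i (fun x => f x ^+ 2) ->
  nint i (fun x => (f x - c) ^+ 2) /\
  nmean (fun x => (f x - c) ^+ 2) i = nmean (fun x => f x ^+ 2) i - 2 * c * nmean f i + c ^+ 2.
Proof.
move=> mf i2; have i1 := nint_sq mf i2.
have e : (fun x => (f x - c) ^+ 2) = (fun x => (f x ^+ 2 + (- (2 * c)) * f x) + c ^+ 2).
  by apply/funext => x; ring.
have h := nintZ (- (2 * c)) i1; rewrite e.
split; first by apply: (nintD (nintD i2 h)); exact: nint_cst.
rewrite nmeanD; [|exact: (nintD i2 h)|exact: nint_cst].
by rewrite nmeanD// nmeanZ// nmean_cst mulNr.
Qed.

Lemma nmean_sq_le i f : measurable_fun (ncube i) f -> nint i (fun x => f x ^+ 2) ->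
  nmean f i ^+ 2 <= nmean (fun x => f x ^+ 2) i.
Proof.
move=> mf i2; have [h e] := nmean_sqB (nmean f i) mf i2.
have : 0 <= nmean (fun x => (f x - nmean f i) ^+ 2) i.
  rewrite -[leLHS](nmean_cst i 0); apply: nmean_le => //; first exact: nint_cst.
  by move=> x _; exact: sqr_ge0.
by rewrite e -mulrA -expr2; lra.
Qed.

Lemma nmean_abs i f : nint i f -> `|nmean f i| <= nmean (fun x => `|f x|) i.
Proof.
move=> hf; have ha := nint_abs hf; rewrite ler_norml; apply/andP; split.
  rewrite lerNl -mulN1r -nmeanZ//; apply: nmean_le => //; first exact: nintZ.
  by move=> x _; rewrite mulN1r -normrN ler_norm.
by apply: nmean_le => // x _; exact: ler_norm.
Qed.

(** The maximal function restricted to the generations from [m] to [m + d]. Locating the cubes by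
    [idx] makes it finite and measurable everywhere. *)
Fixpoint gmax f (d : nat) (m : int) (x : Rn R n) : R :=
  let y := nmean f (m, idx m x) in
  if d is d'.+1 then Num.max y (gmax f d' (m + 1) x) else y.

Lemma measurable_idx (g : ('I_n -> int) -> R) m :
  measurable_fun [set: Rn R n] (fun x => g (idx m x)).
Proof.
move=> _ A mA; rewrite setTI.
(* Finite functions are used as indices because they form a countable type. *)
rewrite (_ : _ @^-1` _ = \bigcup_(z : {ffun 'I_n -> int})
   (if g z \in A then [set x : Rn R n | idx m x = z] else set0)).
  apply: countable_bigcupT_measurable => [|z]; first exact: countableP.
  case: ifP => // _.
  rewrite (_ : [set x | _] = [set x : Rn R n | forall i : 'I_n,
    `[(2 : R) ^ (- m) * (z i)%:~R, 2 ^ (- m) * (z i + 1)%:~R[%classic (tnth x i)]).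
    apply: (@measurable_box R n (fun i : 'I_n => [set` `[(2 : R) ^ (- m) * (z i)%:~R, 2 ^ (- m) *
      (z i + 1)%:~R[])) => i.
    exact: measurable_itv.
  have s0 : 0 < (2 : R) ^ m by exact: exprz_gt0.
  have e (y : R) : 2 ^ m * (2 ^ (- m) * y) = y.
    by rewrite mulrA -expfzDr// subrr expr0z mul1r.
  apply/seteqP; split => x /=.
    move=> h i; have := floor_itv (2 ^ m * tnth x i).
    rewrite -/(idx m x i) h in_itv /=.
    move=> /andP[h1 h2]; apply/andP; split.
      by rewrite -(ler_pM2l s0) e.
    by rewrite -(ltr_pM2l s0) e.
  move=> h; apply/funext => i; apply: floor_def; have := h i; rewrite in_itv /=.
  by move=> /andP[h1 h2]; apply/andP; split;
    [rewrite -[leLHS]e (ler_pM2l s0)|rewrite -[ltRHS]e (ltr_pM2l s0)].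
apply/seteqP; split => x /=.
  move=> Ax; exists [ffun i => idx m x i] => //.
  have e : [ffun i => idx m x i] = idx m x :> (_ -> _) by apply/funext => i; rewrite ffunE.
  by rewrite e mem_set.
by move=> [z _]; case: ifPn => [/set_mem Az ->|].
Qed.

Lemma measurable_gmax f d m : measurable_fun [set: Rn R n] (gmax f d m).
Proof.
elim: d m => [|d IH] m /=; first exact: (measurable_idx (fun z => nmean f (m, z))).
apply: measurable_maxr; last exact: IH.
exact: (measurable_idx (fun z => nmean f (m, z))).
Qed.

(** Identifies the abstract recursion with an integral; [psi] will be a truncation for the mean and
    an indicator for the essential infimum. *)
Lemma integral_gmax f psi d i L : measurable_fun setT psi ->
  (\int[mu]_(x in ncube i) (psi (Num.max L (gmax f d i.1 x)))%:E =
  (vol (R := R) (n := n) i.1 * smax (alpha n) nchild (nmean f) psi d i L)%:E)%E.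
Proof.
move=> mpsi; elim: d i L => [|d IH] [m z] L /=.
  rewrite (eq_integral (fun=> (psi (Num.max L (nmean f (m, z))))%:E)).
    rewrite integral_cst; last exact: measurable_ncube.
    by rewrite [X in (_ * X)%E](lebesgue_ncube (m, z)) mulrC.
  by move=> x /set_mem /idx_cube ->.
rewrite integral_children; last first.
  apply: (measurable_funS measurableT) => //; apply: (measurableT_comp mpsi).
  by apply: measurable_maxr => //; exact: (measurable_gmax f d.+1 m).
rewrite (eq_bigr (fun e => (vol (R := R) (n := n) (m + 1) *
   smax (alpha n) nchild (nmean f) psi d (nchild (m, z) e) (Num.max L (nmean f (m, z))))%:E)).
  rewrite sumEFin -mulr_sumr (volS m) -mulrA; congr (_ * _)%:E.
  by rewrite mulrA mulfV ?mul1r// expf_neq0// pnatr_eq0.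
move=> e _; apply: etrans (IH (nchild (m, z) e) _); apply: eq_integral => x /set_mem xe /=.
by rewrite (idx_cube (cube_child_sub xe)) maxA.
Qed.

End averages.

(** * Mean and essential infimum of the maximal function on one cube *)

Section local_maximal_function.
Context {R : realType} {n : nat}.
Local Notation mu := (@lebesgue R n).
Local Notation B := {ffun 'I_n -> bool}.
Local Notation node := (int * ('I_n -> int))%type.
Local Notation vol := (vol (R := R) (n := n)).
Implicit Types (i : node) (f : Rn R n -> R).

Lemma card_alpha : #|B|%:R * alpha n = 1 :> R.
Proof. by rewrite card_ffun card_bool card_ord natrX /alpha mulfV// expf_neq0// pnatr_eq0. Qed.

Lemma ereal_sup_range_ge (u : nat -> \bar R) d : (u d <= ereal_sup (range u))%E.
Proof. by apply: ereal_sup_ubound; exists d. Qed.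

Lemma measurable_ereal_sup (D : set (Rn R n)) (u : nat -> Rn R n -> \bar R) :
  (forall d, measurable_fun D (u d)) ->
  measurable_fun D (fun x => ereal_sup (range (fun d => u d x))).
Proof.
move=> mu_; rewrite (_ : (fun x => _) = (fun x => esups (u ^~ x) 0%N)).
  exact: measurable_fun_esups.
apply/funext => x; rewrite /esups /=; congr ereal_sup.
by apply/seteqP; split => y /= [d _ <-]; exists d.
Qed.

Lemma measurable_natural_max f : measurable_fun setT (natural_max f).
Proof.
(* Enumerating the cubes by [pickle] turns the supremum into a countable one. *)
pose u (N : nat) (x : Rn R n) : \bar R :=
  if unpickle N is Some (m, z) then
    if x \in cube (m : int) (z : {ffun 'I_n -> int}) then (mean (cube m z) f)%:E else -oo%E
  else -oo%E.
rewrite (_ : natural_max f = fun x => ereal_sup (range (u ^~ x))).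
  apply: measurable_ereal_sup => N; rewrite /u; case: unpickle => [[m z]|]; last exact:
    measurable_cst.
  apply: measurable_fun_ifT => //; try exact: measurable_cst.
  apply: (measurable_fun_bool true); rewrite setTI.
  rewrite (_ : _ @^-1` _ = cube m z); first exact: measurable_cube.
  by apply/seteqP; split => x /=; [move=> /set_mem|move=> /mem_set].
apply/funext => x; apply/eqP; rewrite eq_le; apply/andP; split.
  apply: ge_ereal_sup => _ [J [[m [z ->]] Jx] <-].
  apply: le_ereal_sup_tmp; exists (u (pickle (m, [ffun i => z i])) x); first by eexists.
  have e : [ffun i => z i] = z :> (_ -> _) by apply/funext => i; rewrite ffunE.
  by rewrite /u pickleK e mem_set.
apply: ge_ereal_sup => _ [N _ <-]; rewrite /u.
case: unpickle => [[m z]|]; last exact: leNye.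
case: ifPn => [/set_mem xz|_]; last exact: leNye.
by apply: ereal_sup_ubound; exists (cube m z) => //; split => //; exists m, z.
Qed.

Lemma le_gmax f m x d d' : (d <= d')%N -> gmax f d m x <= gmax f d' m x.
Proof.
elim: d d' m => [|d IH] [|d'] m //= dd'; first by rewrite le_max lexx.
by rewrite ge_max !le_max lexx /= IH ?orbT.
Qed.

Lemma gmax_ge f m x (k : nat) : nmean f (m + k%:Z, idx (m + k%:Z) x) <= gmax f k m x.
Proof.
elim: k m => [|k IH] m /=; first by rewrite addr0.
by rewrite intS addrA le_max IH orbT.
Qed.

Lemma gmax_attained f m x d : exists k : nat, gmax f d m x = nmean f (m + k%:Z, idx (m + k%:Z) x).
Proof.
elim: d m => [|d IH] m /=; first by exists 0%N; rewrite addr0.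
have [k e] := IH (m + 1); case: leP => _; last by exists 0%N; rewrite addr0.
by exists k.+1; rewrite e intS addrA.
Qed.

(* The contribution to the maximal function of the cubes containing [Q]. *)
Definition outer_max f (Q : set (Rn R n)) : \bar R :=
  ereal_sup [set (mean J f)%:E | J in [set J | dyadic J /\ Q `<=` J]].

Lemma outer_max_ge f i : ((nmean f i)%:E <= outer_max f (ncube i))%E.
Proof. by apply: ereal_sup_ubound; exists (ncube i) => //; split => //; exists i.1, i.2. Qed.

Lemma outer_max_le f (Q : set (Rn R n)) x : Q x -> (outer_max f Q <= natural_max f x)%E.
Proof.
move=> Qx; apply: ge_ereal_sup => _ [J [dJ QJ] <-].
by apply: ereal_sup_ubound; exists J => //; split => //; exact: QJ.
Qed.

Lemma outer_max_fin f i : ~ (forall x, ncube i x -> natural_max f x = +oo%E) ->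
  outer_max f (ncube i) \is a fin_num.
Proof.
move=> /existsNP[x /not_implyP[ix ne]].
rewrite fin_numE; apply/andP; split; apply/eqP => e.
  by have := outer_max_ge f i; rewrite e.
by apply: ne; apply/eqP; rewrite -leye_eq -e; exact: outer_max_le.
Qed.

(** By nestedness a dyadic cube through [x] either contains [ncube i] or is contained in it. *)
Lemma natural_max_split f i L x : outer_max f (ncube i) = L%:E -> generic x -> ncube i x ->
  natural_max f x = ereal_sup (range (fun d => (Num.max L (gmax f d i.1 x))%:E)).
Proof.
case: i => m z Lo gx ix; apply/eqP; rewrite eq_le; apply/andP; split.
  apply: ge_ereal_sup => _ [J [[m' [z' ->]] Jx] <-].
  have [mm'|m'm] := leP m m'.
    have [k e] : exists k : nat, m' = m + k%:Z.
      by exists `|m' - m|%N; rewrite gez0_abs ?subr_ge0// [RHS]addrC subrK.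
    apply: le_trans (ereal_sup_range_ge _ k); rewrite lee_fin le_max.
    by rewrite -(idx_cube Jx) e (gmax_ge f m x k) orbT.
  apply: le_trans (ereal_sup_range_ge _ 0%N); rewrite EFin_max le_max -Lo.
  apply/orP; left; apply: ereal_sup_ubound; exists (cube m' z') => //; split.
    by exists m', z'.
  exact: cube_nested (ltW m'm) ix Jx.
apply: ge_ereal_sup => _ [d _ <-]; rewrite EFin_max ge_max -Lo outer_max_le//=.
have [k ->] := gmax_attained f m x d.
apply: ereal_sup_ubound; exists (ncube (m + k%:Z, idx (m + k%:Z) x)) => //; split.
  by exists (m + k%:Z), (idx (m + k%:Z) x).
exact: cube_idx.
Qed.

Lemma integral_sup_gmax f (psi : R -> R) i L : measurable_fun setT psi -> (forall x, 0 <= psi x) ->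
  {homo psi : x y / x <= y} ->
  (\int[mu]_(x in ncube i) ereal_sup (range (fun d => (psi (Num.max L (gmax f d i.1 x)))%:E)) =
   ereal_sup (range (fun d => (vol i.1 * smax (alpha n) nchild (nmean f) psi d i L)%:E)))%E.
Proof.
move=> mpsi psi0 psih.
pose g (d : nat) (x : Rn R n) : \bar R := (psi (Num.max L (gmax f d i.1 x)))%:E.
have nd x : {homo (g ^~ x) : d d' / (d <= d')%N >-> (d <= d')%E}.
  by move=> d d' dd'; rewrite lee_fin psih// ge_max !le_max lexx (le_gmax _ _ _ dd') orbT.
have mg d : measurable_fun (ncube i) (g d).
  apply/measurable_EFinP; apply: (measurable_funS measurableT) => //.
  by apply: (measurableT_comp mpsi); apply: measurable_maxr => //; exact: measurable_gmax.
have e x : ereal_sup (range (g ^~ x)) = limn (g ^~ x).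
  by apply/esym/cvg_lim => //; exact: ereal_nondecreasing_cvgn (nd x).
rewrite (eq_integral (fun x => limn (g ^~ x))); last by move=> x _; rewrite -e.
rewrite monotone_convergence //; first last.
- by move=> d x _; rewrite lee_fin.
- exact: measurable_ncube.
rewrite -(eq_fun (fun d => integral_gmax f d i L mpsi)).
apply/cvg_lim => //; apply: ereal_nondecreasing_cvgn => d d' dd'.
apply: ge0_le_integral => //; first exact: measurable_ncube.
- by move=> x _; rewrite lee_fin.
- by move=> x _; exact: nd.
Qed.

Section square_integrable.
Context (f : Rn R n -> R) (q : node).
Hypotheses (mf : measurable_fun (ncube q) f) (f2 : nint q (fun x => f x ^+ 2)).

Definition inside i := ncube i `<=` (ncube q : set (Rn R n)).

Lemma inside_child i e : inside i -> inside (nchild i e).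
Proof. by move=> iq; apply: subset_trans iq; exact: cube_child_sub. Qed.

Lemma inside_measurable i : inside i -> measurable_fun (ncube i) f.
Proof. by move=> iq; exact: measurable_funS (measurable_ncube q) iq mf. Qed.

Lemma inside_sq i : inside i -> nint i (fun x => f x ^+ 2).
Proof. by move=> iq; apply: nint_sub f2 => //; exact: measurable_ncube. Qed.

Lemma inside_nint i : inside i -> nint i f.
Proof. by move=> iq; apply: nint_sq; [exact: inside_measurable|exact: inside_sq]. Qed.

Let Xm i : inside i -> nmean f i = alpha n * \sum_e nmean f (nchild i e).
Proof. by move=> iq; apply: nmean_children; exact: inside_nint. Qed.

Let Xq i : inside i -> nmean (fun x => f x ^+ 2) i =
  alpha n * \sum_e nmean (fun x => f x ^+ 2) (nchild i e).
Proof. by move=> iq; apply: nmean_children; exact: inside_sq. Qed.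

Let Xv i : inside i -> nmean f i ^+ 2 <= nmean (fun x => f x ^+ 2) i.
Proof. by move=> iq; apply: nmean_sq_le; [exact: inside_measurable|exact: inside_sq]. Qed.

Context (L : R).
Hypothesis Lo : outer_max f (ncube q) = L%:E.

Lemma nmean_le_outer : nmean f q <= L.
Proof. by rewrite -lee_fin -Lo outer_max_ge. Qed.

Local Notation S d := (smax (alpha n) nchild (nmean f) id d q L).

Lemma smax_bounded : exists K, forall d, S d <= K.
Proof.
eexists => d; apply: (@smax_le_sqrt _ _ _ _ _ card_alpha inside (nmean f)
  (nmean (fun x => f x ^+ 2))) => //; [exact: inside_child|exact: nmean_le_outer].
Qed.

(** [e] is the supremum of the stopped maxima; the first clause serves the sharpness, the second the
    upper bound. *)
Lemma natural_max_integral : exists e,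
  [/\ forall d, S d <= e,
      forall K, (forall d, S d <= K) -> e <= K,
      mu.-integrable (ncube q) (natural_max f)
    & emean (ncube q) (natural_max f) = e%:E].
Proof.
pose psi (w : R) := Num.max (w - L) 0.
have mpsi : measurable_fun setT psi.
  by apply: measurable_maxr => //; exact: measurable_funB.
have psi0 w : 0 <= psi w by rewrite le_max lexx orbT.
have psih : {homo psi : x y / x <= y}.
  by move=> x y xy; rewrite ge_max !le_max lexx orbT andbT lerD2r xy.
pose W x := ereal_sup (range (fun d => (psi (Num.max L (gmax f d q.1 x)))%:E)).
have mW : measurable_fun (ncube q) W.
  apply: measurable_ereal_sup => d; apply/measurable_EFinP.
  apply: (measurable_funS measurableT) => //; apply: (measurableT_comp mpsi).
  by apply: measurable_maxr => //; exact: measurable_gmax.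
have W0 x : (0 <= W x)%E by apply: le_trans (ereal_sup_range_ge _ 0%N); rewrite lee_fin.
have v0 := vol_gt0 (R := R) (n := n) q.1.
have intW := integral_sup_gmax f q L mpsi psi0 psih.
have trunc d : smax (alpha n) nchild (nmean f) psi d q L = S d - L.
  exact: (@smax_trunc _ _ _ (alpha n) nchild card_alpha (nmean f) L d q L (lexx L)).
have [K hK] := smax_bounded.
have W_fin : (\int[mu]_(x in ncube q) W x)%E \is a fin_num.
  rewrite ge0_fin_numE; last by apply: integral_ge0 => x _; exact: W0.
  apply: (@le_lt_trans _ _ (vol q.1 * (K - L))%:E); last exact: ltry.
  rewrite intW; apply: ge_ereal_sup => _ [d _ <-].
  by rewrite lee_fin trunc ler_pM2l// lerD2r.
have iW : mu.-integrable (ncube q) W.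
  apply/integrableP; split => //.
  rewrite (eq_integral W) ?ltey_eq ?W_fin//.
  by move=> x _; rewrite gee0_abs.
have iWL : mu.-integrable (ncube q) (fun x => W x + L%:E)%E.
  exact: (integrableD (measurable_ncube q) iW (nint_cst q L)).
have NW : ae_eq mu (ncube q) (natural_max f) (fun x => W x + L%:E)%E.
  apply: ae_imp ae_generic => x gx qx; rewrite (natural_max_split Lo gx qx).
  have pE d : psi (Num.max L (gmax f d q.1 x)) = Num.max L (gmax f d q.1 x) - L.
    by apply/max_idPl; rewrite subr_ge0 le_max lexx.
  apply/eqP; rewrite eq_le; apply/andP; split.
    apply: ge_ereal_sup => _ [d _ <-]; rewrite -leeBlDr// -EFinB -pE.
    exact: (ereal_sup_range_ge (fun d => (psi (Num.max L (gmax f d q.1 x)))%:E) d).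
  rewrite -leeBrDr//; apply: ge_ereal_sup => _ [d _ <-].
  rewrite pE EFinB leeBrDr// subeK//.
  exact: (ereal_sup_range_ge (fun d => (Num.max L (gmax f d q.1 x))%:E) d).
have mN : measurable_fun (ncube q) (natural_max f).
  exact: (measurable_funS measurableT (@subsetT _ _) (measurable_natural_max f)).
have mWL : measurable_fun (ncube q) (fun x => W x + L%:E)%E by case/integrableP: iWL.
exists ((vol q.1)^-1 * fine (\int[mu]_(x in ncube q) W x)%E + L); split.
- move=> d; rewrite -lerBlDr -ler_pdivrMl ?invr_gt0// invrK -trunc -lee_fin fineK// intW.
  exact: (ereal_sup_range_ge (fun d => (vol q.1 * smax (alpha n) nchild (nmean f) psi d q L)%:E) d).
- move=> K' hK'; rewrite -lerBrDr ler_pdivrMl// -lee_fin fineK// intW.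
  by apply: ge_ereal_sup => _ [d _ <-]; rewrite lee_fin trunc ler_pM2l// lerD2r.
- apply/integrableP; split => //.
  rewrite (@ae_eq_integral _ _ _ mu _ (fun x => `|W x + L%:E|%E)).
  + by case/integrableP: iWL.
  + exact: measurable_ncube.
  + exact: measurableT_comp.
  + exact: measurableT_comp.
  + by apply: ae_imp NW => x h /h ->.
rewrite /emean fine_cube (ae_eq_integral _ _ (measurable_ncube q) mN mWL NW).
rewrite (integralD (measurable_ncube q) iW (nint_cst q L)) integral_cst; last exact:
  measurable_ncube.
rewrite [X in (_ * (_ + _ * X))%E](lebesgue_ncube q) -(fineK W_fin) -EFinM.
by congr EFin; rewrite /= mulrDr [L * _]mulrC mulKf// gt_eqF.
Qed.

(** Were the maximal function above some [c > L] almost everywhere on the cube, the indicator of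
    this event would have average 1, against a Chebyshev bound that is less than 1. *)
Lemma ess_inf_natural_max : ess_inf_on (ncube q) (natural_max f) = L%:E.
Proof.
apply/eqP; rewrite eq_le; apply/andP; split; last first.
  by apply: ereal_sup_ubound; apply: aeW => x qx; rewrite -Lo; exact: outer_max_le.
apply: ge_ereal_sup => y hy; rewrite leNgt; apply/negP => Ly.
have [c Lc cy] : exists2 c, L < c & (c%:E < y)%E.
  case: y Ly {hy} => [y| |] //; last by exists (L + 1); rewrite ?ltrDl ?ltry.
  rewrite lte_fin => Ly; exists ((L + y) / 2); rewrite ?lte_fin; lra.
pose X := nmean f q; pose Y := nmean (fun x => f x ^+ 2) q.
have XY : X ^+ 2 <= Y by exact: Xv.
have Xc : X < c := le_lt_trans nmean_le_outer Lc.
pose s := c - X; have s0 : 0 < s by rewrite subr_gt0.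
(* Far enough to the left for [(c - m) ^+ 2] to exceed the second moment about [m]; the difference
   grows like [2 * s * (- m)]. *)
pose m := - ((Y + c ^+ 2 + 1) / (2 * s)) - `|c| - 1.
have mc : m < c.
  have : 0 <= (Y + c ^+ 2 + 1) / (2 * s).
    by rewrite divr_ge0 ?mulr_ge0 ?(ltW s0)//; have := sqr_ge0 X; have := sqr_ge0 c; lra.
  have := ler_norm (- c); rewrite normrN /m; lra.
have th : (Y - 2 * m * X + m ^+ 2) / (c - m) ^+ 2 < 1.
  rewrite ltr_pdivrMr ?exprn_gt0 ?subr_gt0// mul1r.
  have e : (c - m) ^+ 2 - (Y - 2 * m * X + m ^+ 2) = 2 * s * (- m) + c ^+ 2 - Y.
    by rewrite /s; ring.
  have : 2 * s * (- m) = Y + c ^+ 2 + 1 + 2 * s * (`|c| + 1).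
    by rewrite /m; field; rewrite gt_eqF.
  have : 0 <= s * `|c| by rewrite mulr_ge0// ltW.
  have := sqr_ge0 c; move: e s0; lra.
have mind : measurable_fun setT (fun w : R => (c < w)%R%:R : R).
  apply: (measurableT_comp (f := fun b : bool => b%:R : R)) => //.
  exact: measurable_fun_ltr.
have hind : {homo (fun w : R => (c < w)%R%:R : R) : x y / x <= y}.
  by move=> x w xw; case: (ltP c x) => // cx; rewrite (lt_le_trans cx xw).
have := @integral_sup_gmax f (fun w => (c < w)%R%:R) q L mind (fun w => ler0n _ _) hind.
rewrite (@ae_eq_integral _ _ _ mu _ (cst 1%E)).
- rewrite integral_cst ?mul1e; last exact: measurable_ncube.
  rewrite [X in X = _](lebesgue_ncube q) => e.
  have : ((vol q.1)%:E <= (vol q.1 * ((Y - 2 * m * X + m ^+ 2) / (c - m) ^+ 2))%:E)%E.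
    rewrite e; apply: ge_ereal_sup => _ [d _ <-].
    rewrite lee_fin ler_wpM2l ?(ltW (vol_gt0 _))//.
    apply: (@smax_chebyshev _ _ _ _ _ card_alpha inside (nmean f)
      (nmean (fun x => f x ^+ 2))) => //; [exact: inside_child|exact: ltW].
  by rewrite lee_fin leNgt -[X in _ < X]mulr1 ltr_pM2l ?vol_gt0 ?th.
- exact: measurable_ncube.
- apply: measurable_ereal_sup => d; apply/measurable_EFinP.
  apply: (measurable_funS measurableT) => //; apply: (measurableT_comp mind).
  by apply: measurable_maxr => //; exact: measurable_gmax.
- exact: measurable_cst.
apply: ae_imp (ae_and hy ae_generic) => x [hx gx] qx.
have := lt_le_trans cy (hx qx); rewrite (natural_max_split Lo gx qx).
move=> /ereal_sup_gtP[_ [d _ <-]]; rewrite lte_fin => cd.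
apply/eqP; rewrite eq_le; apply/andP; split.
  by apply: ge_ereal_sup => _ [d' _ <-]; rewrite lee_fin; case: (_ < _).
by apply: le_trans (ereal_sup_range_ge _ d); rewrite cd.
Qed.

End square_integrable.
End local_maximal_function.

(** * The upper bounds for the mean and for the BLO norm *)

Section upper_bounds.
Context {R : realType} {n : nat}.
Hypothesis n_gt0 : (0 < n)%N.
Local Notation mu := (@lebesgue R n).
Local Notation B := {ffun 'I_n -> bool}.
Local Notation node := (int * ('I_n -> int))%type.
Implicit Types (f : Rn R n -> R) (q i : node).

Lemma dyadic_ncube (Q : set (Rn R n)) : dyadic Q -> exists q, Q = ncube q.
Proof. by move=> [m [z ->]]; exists (m, z). Qed.

Lemma ncube_dyadic q : dyadic (ncube q : set (Rn R n)).
Proof. by exists q.1, q.2. Qed.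

Lemma bmo_norm_ge (C : set (set (Rn R n))) f i : C (ncube i) ->
  ((Num.sqrt (nmean (fun x => f x ^+ 2) i - nmean f i ^+ 2))%:E <= bmo_norm C f)%E.
Proof. by move=> Ci; apply: ereal_sup_ubound; exists (ncube i). Qed.

Lemma bmo_norm_ge0 (C : set (set (Rn R n))) f i : C (ncube i) -> (0 <= bmo_norm C f)%E.
Proof. by move=> Ci; apply: le_trans (bmo_norm_ge f Ci); rewrite lee_fin sqrtr_ge0. Qed.

Lemma bmo_norm_fin (C : set (set (Rn R n))) f i : C (ncube i) -> (bmo_norm C f < +oo)%E ->
  bmo_norm C f \is a fin_num.
Proof. by move=> Ci h; rewrite ge0_fin_numE// (bmo_norm_ge0 f Ci). Qed.

Lemma bmo_norm_var (C : set (set (Rn R n))) f i c : 0 <= c -> C (ncube i) ->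
  (bmo_norm C f <= c%:E)%E -> nmean (fun x => f x ^+ 2) i - nmean f i ^+ 2 <= c ^+ 2.
Proof.
move=> c0 Ci /(le_trans (bmo_norm_ge f Ci)); rewrite lee_fin.
set v := _ - _ => h; have [v0|v0] := leP 0 v; last by rewrite (le_trans (ltW v0)) ?sqr_ge0.
by rewrite -[v]sqr_sqrtr// ler_sqr ?nnegrE ?sqrtr_ge0.
Qed.

Lemma bmo_norm_abs (C : set (set (Rn R n))) f : C `<=` dyadic ->
  (forall i, C (ncube i) -> nint i f) ->
  (bmo_norm C (fun x => `|f x|%R) <= bmo_norm C f)%E.
Proof.
move=> Cd hf; apply: ge_ereal_sup => _ [J CJ <-].
have [i Ji] := dyadic_ncube (Cd _ CJ); rewrite Ji in CJ *.
apply: le_trans (bmo_norm_ge f CJ); rewrite lee_fin ler_wsqrtr//.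
apply: lerB; first by under eq_fun do rewrite real_normK ?num_real//.
rewrite -[leLHS]real_normK ?num_real// ler_sqr ?nnegrE//.
  exact: nmean_abs (hf _ CJ).
exact: le_trans (nmean_abs (hf _ CJ)).
Qed.

Section one_cube.
Context (f : Rn R n -> R) (q : node).
Hypotheses (mf : measurable_fun (ncube q) f) (f2 : nint q (fun x => f x ^+ 2)).
Context (L : R).
Hypothesis Lo : outer_max f (ncube q) = L%:E.
Local Notation S d := (smax (alpha n) nchild (nmean f) id d q L).

Lemma smax_le_Phi_pos d c : 0 < c -> (bmo_norm (dyadic_in (ncube q)) f <= c%:E)%E ->
  S d <= L + Phi n ((L - nmean f q) / c) * c.
Proof.
move=> c0 hc; have c2 : 0 < c ^+ 2 by rewrite exprn_gt0.
have XL := nmean_le_outer Lo.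
have v1 i : inside (R := R) q i -> nmean (fun x => f x ^+ 2) i / c ^+ 2 - (nmean f i / c) ^+ 2 <= 1.
  move=> iq; have iC : dyadic_in (ncube q) (ncube i : set (Rn R n)).
    by split; [exact: (ncube_dyadic i)|exact: iq].
  by rewrite expr_div_n -mulrBl ler_pdivrMr// mul1r (bmo_norm_var (ltW c0) iC hc).
have dom : dominated (root_alpha n) (root_alpha n)^-1 (nmean f q / c - L / c)
    (nmean (fun x => f x ^+ 2) q / c ^+ 2 - (nmean f q / c) ^+ 2) (S d / c - L / c).
  rewrite -smax_scale//.
  apply: (smax_dominated card_alpha (D := inside (R := R) q) (X := fun i => nmean f i / c)
    (q := fun i => nmean (fun x => f x ^+ 2) i / c ^+ 2)) => //.
  - exact: inside_child.
  - move=> i iq; rewrite (nmean_children (inside_nint mf f2 iq)) -mulrA mulr_suml.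
    by congr (_ * _); apply: eq_bigr.
  - move=> i iq; rewrite (nmean_children (inside_sq f2 iq)) -mulrA mulr_suml.
    by congr (_ * _); apply: eq_bigr.
  - move=> i iq; rewrite expr_div_n ler_wpM2r ?invr_ge0 ?(ltW c2)//.
    exact: nmean_sq_le (inside_measurable mf iq) (inside_sq f2 iq).
  - exact: root_alpha_gt0.
  - exact: root_alpha_sq.
  - exact: root_alphaV.
  - exact: alphaE.
  - by rewrite ler_pM2r ?invr_gt0.
have p0 : nmean f q / c - L / c <= 0 by rewrite -mulrBl ler_pdivrMr// mul0r subr_le0.
have := dominated_b_fun n_gt0 p0 (v1 q (@subset_refl _ _)) dom.
rewrite (_ : nmean f q / c - L / c = - ((L - nmean f q) / c)); last by rewrite mulrBl opprB.
by rewrite -mulrBl ler_pdivrMr// lerBlDl.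
Qed.

Lemma smax_le_Phi d c : 0 <= c -> (bmo_norm (dyadic_in (ncube q)) f <= c%:E)%E ->
  S d <= L + Phi n ((L - nmean f q) / c) * c.
Proof.
rewrite le_eqVlt => /predU1P[<- hc|]; last exact: smax_le_Phi_pos.
(* At [c = 0] the claim is [S d <= L]; it follows from the bounds for [e > 0], since [Phi] is at
   most 1. *)
rewrite mulr0 addr0; apply/ler_addgt0Pr => e e0.
have he : (bmo_norm (dyadic_in (ncube q)) f <= e%:E)%E.
  by apply: (le_trans hc); rewrite lee_fin ltW.
apply: (le_trans (smax_le_Phi_pos d e0 he)); rewrite lerD2l -[leRHS]mul1r.
rewrite ler_wpM2r ?(ltW e0)// Phi_le1// divr_ge0 ?(ltW e0)// subr_ge0.
exact: nmean_le_outer.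
Qed.

End one_cube.

Lemma maximal_bound f q c : measurable_fun (ncube q) f -> nint q (fun x => f x ^+ 2) ->
  ~ (forall x, ncube q x -> natural_max f x = +oo%E) ->
  0 <= c -> (bmo_norm (dyadic_in (ncube q)) f <= c%:E)%E ->
  let L := fine (ess_inf_on (ncube q) (natural_max f)) in
  let t := L - mean (ncube q) f in
  [/\ ess_inf_on (ncube q) (natural_max f) = L%:E,
      0 <= t, mu.-integrable (ncube q) (natural_max f),
      (emean (ncube q) (natural_max f) <= (L + Phi n (t / c) * c)%:E)%E
    & c <= 1 -> (emean (ncube q) (natural_max f) <= (L + Phi n t * c)%:E)%E].
Proof.
move=> mf f2 nfin c0 hc; have /fineK/esym := outer_max_fin nfin.
move: (fine _) => L Lo; rewrite (ess_inf_natural_max mf f2 Lo) /=.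
have t0 : 0 <= L - mean (ncube q) f by rewrite subr_ge0 -lee_fin -Lo; exact: outer_max_ge.
have [e [_ e_le iN ->]] := natural_max_integral mf f2 Lo.
have main : e <= L + Phi n ((L - mean (ncube q) f) / c) * c.
  by apply: e_le => d; exact: smax_le_Phi.
split => // c1; rewrite lee_fin (le_trans main)// lerD2l.
move: c0; rewrite le_eqVlt => /predU1P[<-|c0]; first by rewrite !mulr0.
rewrite ler_wpM2r ?(ltW c0)//.
(* For [c <= 1] the rescaled [t] is the larger one, and [Phi] decreases. *)
have : L - mean (ncube q) f <= (L - mean (ncube q) f) / c by rewrite ler_pdivlMr// ler_piMr.
rewrite le_eqVlt => /predU1P[<- //|h]; apply/ltW/(Phi_decr n_gt0) => //.
  by rewrite in_itv /= andbT.
by rewrite in_itv /= andbT divr_ge0// ltW.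
Qed.

Lemma bounded_ncube q : bounded_rn (ncube q : set (Rn R n)).
Proof.
exists (\sum_i 2 ^ (- q.1) * (`|(q.2 i)%:~R| + 1)) => x qx i.
have s0 := side_gt0 (R := R) q.1.
have t0 j : 0 <= 2 ^ (- q.1) * (`|(q.2 j)%:~R| + 1) :> R.
  by rewrite mulr_ge0 ?(ltW s0) ?addr_ge0.
rewrite (bigD1 i)//= -[leLHS]addr0 lerD ?sumr_ge0//.
have := qx i; rewrite intrD; move: (2 ^ _ : R) s0 ((q.2 i)%:~R : R) (tnth x i) => s s0 z y.
rewrite (_ : 1%:~R = 1)// => /andP[h1 h2].
have s1 : s * z <= s * `|z| by rewrite ler_pM2l// ler_norm.
have s2 : - (s * z) <= s * `|z| by rewrite -mulrN ler_pM2l// -normrN ler_norm.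
by rewrite ler_norml mulrDr mulr1; apply/andP; split; lra.
Qed.

(** The cubes of side [2 ^+ k] with a corner at the origin. No dyadic cube crosses a coordinate
    hyperplane, so a bounded set may need all of them. *)
Definition quadrant (k : nat) (e : B) : node := (- k%:Z, fun j => (e j)%:Z - 1).

Lemma trivIset_quadrant k (D : set B) : trivIset D (fun e => ncube (quadrant k e) : set (Rn R n)).
Proof.
move=> e e' _ _ [x [h h']]; apply/ffunP => i.
have := congr1 (fun z => z i) (etrans (esym (idx_cube h)) (idx_cube h')).
by move=> /= /addIr; case: (e i); case: (e' i).
Qed.

Lemma bounded_quadrant (K : set (Rn R n)) : bounded_rn K -> exists k,
  forall x, generic x -> K x -> (\bigcup_e ncube (quadrant k e)) x.
Proof.
move=> [r hr]; pose k := Num.truncn `|r|; exists k => x gx Kx.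
have rk : r < 2 ^+ k.
  apply: (le_lt_trans (ler_norm r)); apply: (lt_le_trans (truncnS_gt _)).
  by rewrite -natrX ler_nat ltn_expl.
exists [ffun i => 0 < tnth x i] => // i.
have := hr x Kx i; rewrite ler_norml => /andP[h1 h2].
have := gx i 0 0; rewrite mulr0 /= ffunE opprK subrK -exprnP => x0.
case: (ltgtP 0 (tnth x i)) => [p0|p0|//]; rewrite ?subrr ?sub0r ?mulrN1 ?mulr0 ?mulr1 ?mulrN1z
  ?mulr0z.
  by rewrite p0 (le_lt_trans h2).
  by rewrite p0 andbT (lt_le_trans _ h1)// ltrN2.
by move=> h; case: x0.
Qed.

Lemma L1loc_ncube (F : Rn R n -> \bar R) : measurable_fun setT F ->
  (forall q, mu.-integrable (ncube q) F) -> L1loc F.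
Proof.
move=> mN iN; split => // K mK /bounded_quadrant[k hk].
have mNs D : measurable_fun D F by exact: measurable_funS mN.
have big : \big[setU/set0]_(e <- index_enum B) ncube (quadrant k e) =
    \bigcup_e ncube (quadrant k e) :> set (Rn R n).
  by rewrite -bigcup_seq; apply: eq_bigcupl; split => e _ //; rewrite /= mem_index_enum.
have mU : measurable (\bigcup_e ncube (quadrant k e) : set (Rn R n)).
  by rewrite -big; apply: bigsetU_measurable => e _; exact: measurable_ncube.
have mKU := measurableI _ _ mK mU.
apply/integrableP; split => //.
rewrite (@integral_ae_sub _ _ (K `&` \bigcup_e ncube (quadrant k e))) //.
- apply: (@le_lt_trans _ _ (\int[mu]_(x in \bigcup_e ncube (quadrant k e)) `|F x|)%E).
    by apply: ge0_subset_integral => //; exact: measurableT_comp.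
  rewrite -big ge0_integral_bigsetU //.
  + by apply: lte_sum_pinfty => e _; case/integrableP: (iN (quadrant k e)).
  + by move=> e; exact: measurable_ncube.
  + exact: index_enum_uniq.
  + exact: trivIset_quadrant.
  + exact: measurableT_comp.
- by apply: ae_imp ae_generic => x gx Kx; split => //; exact: hk.
- exact: measurableT_comp.
Qed.

Lemma L2loc_nint f q : L2loc f -> measurable_fun (ncube q) f /\ nint q (fun x => f x ^+ 2).
Proof.
move=> [mf f2]; split; first exact: measurable_funS mf.
by apply: f2; [exact: measurable_ncube|exact: bounded_ncube].
Qed.

Lemma bmo_norm_sub (C C' : set (set (Rn R n))) f : C `<=` C' ->
  (bmo_norm C f <= bmo_norm C' f)%E.
Proof. by move=> CC'; apply: le_ereal_sup => _ [J CJ <-]; exists J => //; exact: CC'. Qed.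

Lemma maximal_BLO f c : L2loc f ->
  (forall Q, dyadic Q -> ~ (forall x, Q x -> natural_max f x = +oo%E)) ->
  0 <= c -> (bmo_norm dyadic f <= c%:E)%E ->
  BLOd (natural_max f) /\ (blo_norm (natural_max f) <= c%:E)%E.
Proof.
move=> fL2 nfin c0 hc.
have bound q := maximal_bound (L2loc_nint q fL2).1 (L2loc_nint q fL2).2 (nfin _ (ncube_dyadic q)) c0
  (le_trans (@bmo_norm_sub _ _ f (fun J => @proj1 _ _)) hc).
have blo : (blo_norm (natural_max f) <= c%:E)%E.
  apply: ge_ereal_sup => _ [J /dyadic_ncube[q ->] <-].
  have [-> t0 _ h _] := bound q; rewrite leeBlDr//; apply: (le_trans h).
  rewrite -EFinD lee_fin addrC lerD2r -[leRHS]mul1r ler_wpM2r//.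
  by rewrite Phi_le1// divr_ge0.
split => //; split; last exact: (le_lt_trans blo (ltry _)).
by apply: L1loc_ncube => [|q]; [exact: measurable_natural_max|case: (bound q)].
Qed.

End upper_bounds.

(** * Functions realizing the trees *)

Section tree_functions.
Context {R : realType} {n : nat}.
Hypothesis n_gt0 : (0 < n)%N.
Local Notation mu := (@lebesgue R n).
Local Notation B := {ffun 'I_n -> bool}.
Local Notation node := (int * ('I_n -> int))%type.
Local Notation vol := (vol (R := R) (n := n)).
Local Notation al := (alpha n : R).
Local Notation tree := (@tree R B).
Local Notation tmean := (tmoment al id).
Local Notation tsq := (tmoment al (fun x => x ^+ 2)).

(** The parities of the index tell which child of its parent is the cube of generation [m]
    containing [x]. *)
Definition digit m (x : Rn R n) : B := [ffun j => (idx m x j %% 2)%Z == 1].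

Fixpoint treal (T : tree) (m : int) (x : Rn R n) : R :=
  match T with
  | Leaf c => c
  | Node A U V => if digit (m + 1) x \in A then treal U (m + 1) x else treal V (m + 1) x
  end.

Fixpoint tbound (T : tree) : R :=
  match T with Leaf c => `|c| | Node _ U V => tbound U + tbound V end.

Lemma tbound_ge0 T : 0 <= tbound T.
Proof. by elim: T => [c|A U hU V hV] /=; [exact: normr_ge0|exact: addr_ge0]. Qed.

Lemma treal_bound T m x : `|treal T m x| <= tbound T.
Proof.
elim: T m => [c|A U hU V hV] m //=; case: ifP => _.
  by rewrite (le_trans (hU _))// lerDl tbound_ge0.
by rewrite (le_trans (hV _))// lerDr tbound_ge0.
Qed.

Lemma measurable_treal T m : measurable_fun setT (treal T m).
Proof.
elim: T m => [c|A U hU V hV] m /=; first exact: measurable_cst.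
pose w (c c' : R) (z : 'I_n -> int) := if [ffun j => (z j %% 2)%Z == 1] \in A then c else c'.
have mw c c' := measurable_idx (w c c') (m + 1).
rewrite (_ : (fun x => _) = fun x => w 1 0 (idx (m + 1) x) * treal U (m + 1) x +
    w 0 1 (idx (m + 1) x) * treal V (m + 1) x).
  by apply: measurable_funD; apply: measurable_funM.
by apply/funext => x; rewrite /digit /w; case: ifP => _; rewrite ?mul1r ?mul0r ?addr0 ?add0r.
Qed.

Lemma treal_shift r T m x : treal (tshift r T) m x = treal T m x + r.
Proof. by elim: T m => [c|A U hU V hV] m //=; case: ifP. Qed.

Lemma digit_child m z e x : cube (m + 1) (child z e) x -> digit (m + 1) x = e.
Proof.
move=> /idx_cube h; apply/ffunP => j; rewrite ffunE h /child modzMDl.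
by case: (e j).
Qed.

Lemma exists_generic i : exists2 x : Rn R n, generic x & ncube i x.
Proof.
apply: contrapT => h.
have : {ae mu, forall x, ~ ncube i x}.
  by apply: ae_imp (@ae_generic R n) => x gx ix; apply: h; exists x.
move=> [N [mN N0 sub]]; have : (mu (ncube i) <= mu N)%E.
  by apply: le_measure; rewrite ?inE//; [exact: measurable_ncube|move=> x ix; apply: sub; exact].
by rewrite N0 lebesgue_ncube lee_fin leNgt vol_gt0.
Qed.

Section realization.
Context (f : Rn R n -> R).

Definition realizes i T := forall x, ncube i x -> f x = treal T i.1 x.

Lemma realizes_child i T e : realizes i T -> realizes (nchild i e) (tchild T e).
Proof.
move=> h x xe; rewrite h; last exact: cube_child_sub xe.
by case: T {h} => [//|A U V] /=; rewrite (digit_child xe); case: ifP.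
Qed.

Lemma nmean_realizes (g : R -> R) : (forall i, nint i (g \o f)) ->
  forall T i, realizes i T -> nmean (g \o f) i = tmoment al g T.
Proof.
move=> gi; elim=> [c|A U hU V hV] i h.
  by rewrite -[RHS](nmean_cst i); apply: nmean_eq => x ix /=; rewrite h.
rewrite nmean_children// (tmoment_child card_alpha); congr (_ * _); apply: eq_bigr => e _.
by have := realizes_child (e := e) h; rewrite /=; case: ifP => _; [exact: hU|exact: hV].
Qed.

Lemma realizes_descend k i T (x : Rn R n) : generic x -> ncube i x -> realizes i T -> tbmo al T ->
  exists T', tbmo al T' /\ realizes (i.1 + k%:Z, idx (i.1 + k%:Z) x) T'.
Proof.
move=> gx; elim: k i T => [|k IH] [m z] T ix h hT.
  by exists T; split=> //=; rewrite addr0 (idx_cube ix).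
have [e he] := cube_child_cover gx ix.
have [T' hT'] := IH (nchild (m, z) e) _ he (realizes_child (e := e) h) (tbmo_child e hT).
by exists T'; rewrite /= intS addrA.
Qed.

End realization.

Lemma half_alpha (j : 'I_n) : al * #|[set e : B | e j]%SET|%:R = 2^-1.
Proof.
pose flip (e : B) : B := [ffun k => if k == j then ~~ e k else e k].
have flipK : involutive flip.
  by move=> e; apply/ffunP => k; rewrite !ffunE; case: eqP => [_|//]; rewrite ?negbK.
have h : #|[set e : B | e j]%SET| = #|~: [set e : B | e j]%SET|.
  rewrite -(card_imset _ (inv_inj flipK)); apply: eq_card => e.
  apply/imsetP/idP => [[e' + ->]|]; rewrite !inE; first by rewrite ffunE eqxx => ->.
  by move=> he; exists (flip e); rewrite ?flipK// inE ffunE eqxx.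
have := card_alpha (R := R) (n := n); rewrite -(cardsC [set e : B | e j]%SET) -h natrD => h1.
by rewrite mulrC; move: h1; rewrite mulrDl; lra.
Qed.

Lemma achieve_Phi t eps : 0 <= t -> 0 < eps -> exists T : tree,
  [/\ tmean T = - t, tsq T = t ^+ 2 + 1, tbmo al T & Phi n t - eps <= tmax al T 0].
Proof.
move=> t0 e0; pose H := [set e : B | e (Ordinal n_gt0)]%SET.
have hH := half_alpha (Ordinal n_gt0).
have p0 : - t <= 0 by rewrite oppr_le0.
suff : achieve (B := B) al (- t) (b_fun n (- t)).
  by move=> /(_ _ e0) [T [h1 h2 h3 h4]]; exists T; split=> //; rewrite h2 sqrrN.
have [[k [u [hu h1 h2]]]|[k [u [hu h1 h2]]]] := b_fun_spec n_gt0 p0; rewrite h2 h1.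
  exact: (achieve_curve card_alpha [ffun=> false] hH (root_alpha_gt0 n) (root_alpha_sq n_gt0)
    (root_alphaV n) (alphaE n) k hu).
exact: (achieve_line card_alpha [ffun=> false] hH (root_alpha_gt0 n) (root_alpha_sq n_gt0)
    (root_alphaV n) (alphaE n) k hu).
Qed.

Section extremal.
Context (q : node) (T : tree) (L : R).
Hypotheses (hT : tbmo al T) (var1 : tsq T - tmean T ^+ 2 = 1) (TL : tmean T <= L).

(** With the value [L] outside, the averages over growing ancestors of the cube increase to [L],
    which installs the outer level without changing the function inside. *)
Definition extremal (x : Rn R n) : R := if x \in ncube q then treal T q.1 x else L.
Local Notation f := extremal.

Lemma measurable_extremal : measurable_fun setT f.
Proof.
rewrite (_ : f = fun x => \1_(ncube q) x * (treal T q.1 x - L) + L).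
  apply: measurable_funD => //; apply: measurable_funM.
    by apply: measurable_indic; exact: measurable_ncube.
  by apply: measurable_funB => //; exact: measurable_treal.
apply/funext => x; rewrite /f indicE; case: (x \in _); rewrite ?mul1r ?subrK//.
by rewrite mul0r add0r.
Qed.

Lemma extremal_bound x : `|f x| <= tbound T + `|L|.
Proof.
rewrite /f; case: ifP => _; last by rewrite lerDr tbound_ge0.
by rewrite (le_trans (treal_bound _ _ _))// lerDl.
Qed.

Lemma nint_bounded i (g : Rn R n -> R) M : measurable_fun setT g -> (forall x, `|g x| <= M) ->
  nint i g.
Proof. by move=> mg gM; apply: nint_le gM (nint_cst i M); exact: measurable_funS mg. Qed.

Lemma nint_extremal i : nint i (id \o f).
Proof. exact: nint_bounded measurable_extremal extremal_bound. Qed.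

Lemma nint_extremal_sq i : nint i ((fun x => x ^+ 2) \o f).
Proof.
apply: (@nint_bounded _ _ ((tbound T + `|L|) ^+ 2)) => [|x /=].
  exact: measurable_funX measurable_extremal.
by rewrite normrX ler_sqr ?nnegrE ?addr_ge0 ?tbound_ge0// extremal_bound.
Qed.

Lemma extremal_L1loc : L1loc (EFin \o f).
Proof.
by apply: L1loc_ncube => [|i]; [apply/measurable_EFinP; exact: measurable_extremal|exact:
  nint_extremal].
Qed.

Lemma extremal_L2loc : L2loc f.
Proof.
split; first exact: measurable_extremal.
apply: (@L1loc_ncube _ _ (fun x => (f x ^+ 2)%:E) _ nint_extremal_sq).2.
by apply/measurable_EFinP; exact: measurable_funX measurable_extremal.
Qed.

Lemma extremal_realizes : realizes f q T.
Proof. by move=> x qx; rewrite /f mem_set. Qed.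

Lemma extremal_mean : nmean f q = tmean T.
Proof. exact: (nmean_realizes nint_extremal extremal_realizes). Qed.

Lemma extremal_sq : nmean (fun x => f x ^+ 2) q = tsq T.
Proof. exact: (nmean_realizes nint_extremal_sq extremal_realizes). Qed.

Lemma extremal_var i : ncube i `<=` (ncube q : set (Rn R n)) ->
  nmean (fun x => f x ^+ 2) i - nmean f i ^+ 2 <= 1.
Proof.
move=> iq; have [x gx ix] := exists_generic i.
have [qi|iq1] := leP q.1 i.1; last first.
  (* An index of a coarser generation whose cube lies inside [ncube q] must describe the same
     set. *)
  have e : ncube i = ncube q :> set (Rn R n).
    by apply/seteqP; split => //; exact: cube_nested (ltW iq1) (iq _ ix) ix.
  by rewrite /nmean e; have := extremal_mean; have := extremal_sq; rewrite /nmean => -> ->;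
    rewrite var1.
have [k e] : exists k : nat, i.1 = q.1 + k%:Z.
  by exists `|i.1 - q.1|%N; rewrite gez0_abs ?subr_ge0// [RHS]addrC subrK.
have [T' []] := realizes_descend k gx (iq _ ix) extremal_realizes hT.
rewrite -e (idx_cube ix) -surjective_pairing => hT' h.
have e1 : nmean f i = tmean T' := nmean_realizes nint_extremal h.
have e2 : nmean (fun x => f x ^+ 2) i = tsq T' := nmean_realizes nint_extremal_sq h.
by rewrite e1 e2; exact: tbmo_var.
Qed.

(** Beyond the cube [g \o f] is the constant [g L]; a general [g] covers the function and its
    square. *)
Lemma extremal_outside i (g : R -> R) : (forall i, nint i (g \o f)) ->
  ncube q `<=` (ncube i : set (Rn R n)) ->
  nmean (g \o f) i = g L + vol q.1 / vol i.1 * (nmean (g \o f) q - g L).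
Proof.
move=> gi qi; have gL j : nint j (fun x => (g \o f) x + - g L) := nintD (gi j) (nint_cst j _).
have e : (\int[mu]_(x in ncube i) (((g \o f) x + - g L)%:E) =
          \int[mu]_(x in ncube q) (((g \o f) x + - g L)%:E))%E.
  rewrite integral_mkcond [RHS]integral_mkcond; apply: eq_integral => x _.
  rewrite !patchE; case: ifPn => [/set_mem ix|ix].
    by case: ifPn => // nq; rewrite /= /f (negbTE nq) subrr.
  by rewrite ifF//; apply: contraNF ix => /set_mem /qi /mem_set.
move: e; rewrite !nmean_int// => -[].
rewrite !(nmeanD (gi _) (nint_cst _ _)) !nmean_cst => e.
have v0 := vol_neq0 (R := R) (n := n) i.1.
apply: (mulfI v0); rewrite (_ : vol i.1 * (g L + _) = vol i.1 * g L +
  vol q.1 * (nmean (g \o f) q - g L)); last by field.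
by move: e; rewrite !mulrBr; lra.
Qed.

Lemma vol_le i : ncube q `<=` (ncube i : set (Rn R n)) -> vol q.1 <= vol i.1.
Proof.
move=> qi; rewrite -lee_fin -!lebesgue_ncube.
by apply: le_measure; rewrite ?inE//; exact: measurable_ncube.
Qed.

Lemma extremal_outer : outer_max f (ncube q) = L%:E.
Proof.
apply/eqP; rewrite eq_le; apply/andP; split.
  apply: ge_ereal_sup => _ [J [/dyadic_ncube[i ->] qi] <-].
  rewrite lee_fin -/(nmean f i) -[f]/(id \o f) (extremal_outside nint_extremal qi).
  rewrite -[leRHS]addr0 lerD2l mulr_ge0_le0 ?divr_ge0 ?(ltW (vol_gt0 _))//.
  by rewrite -[id \o f]/f extremal_mean subr_le0.
have [x gx qx] := exists_generic q.
apply/lee_addgt0Pr => eps eps0.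
have D0 : 0 < L - tmean T + 1 by rewrite ltr_wpDl// subr_ge0.
have [k hk] := pow2_small (divr_gt0 eps0 D0).
pose i : node := (q.1 - k%:Z, idx (q.1 - k%:Z) x).
have qi : ncube q `<=` (ncube i : set (Rn R n)).
  by apply: cube_nested qx (cube_idx _ gx); rewrite lerBlDr lerDl.
have hL : ((nmean f i)%:E <= outer_max f (ncube q))%E.
  by apply: ereal_sup_ubound; exists (ncube i) => //; split => //; exact: ncube_dyadic.
apply: (@le_trans _ _ ((nmean f i)%:E + eps%:E)%E); last by rewrite leeD2r.
rewrite -EFinD lee_fin -[nmean f i]/(nmean (id \o f) i) (extremal_outside nint_extremal qi).
rewrite -[nmean (id \o f) q]/(nmean f q) extremal_mean.
have th : vol q.1 / vol i.1 <= (2 ^+ k)^-1.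
  have -> : vol i.1 = vol q.1 * (2 ^+ n) ^+ k.
    rewrite /i /=; elim: k {hk i qi hL} => [|k IH]; first by rewrite subr0 expr0 mulr1.
    rewrite (volS (q.1 - _)) (_ : q.1 - k.+1%:Z + 1 = q.1 - k%:Z).
      by rewrite IH exprSr mulrA.
    by rewrite intS opprD addrA addrAC subrK.
  rewrite invfM mulrA mulfV ?vol_neq0// mul1r lef_pV2 ?posrE ?exprn_gt0//.
  by rewrite lerXn2r ?nnegrE ?exprn_ge0// -[leLHS]expr1 ler_weXn2l// ler1n.
have := le_trans th hk; rewrite ler_pdivlMr//.
have : 0 <= vol q.1 / vol i.1 by rewrite divr_ge0 ?(ltW (vol_gt0 _)).
have := TL; move: (_ / _) (tmean T) => y z; rewrite /= !(mulrDr, mulrBr, mulr1); lra.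
Qed.

Lemma extremal_bmo_on : bmo_norm (dyadic_in (ncube q)) f = 1%E.
Proof.
have Cq : dyadic_in (ncube q) (ncube q : set (Rn R n)) by split => //; exact: ncube_dyadic.
apply/eqP; rewrite eq_le; apply/andP; split; last first.
  apply: le_trans (bmo_norm_ge f Cq).
  by rewrite extremal_mean extremal_sq var1 sqrtr1.
apply: ge_ereal_sup => _ [J [/dyadic_ncube[i ->] iq] <-].
by rewrite lee_fin -[leRHS]sqrtr1 ler_wsqrtr//; exact: extremal_var.
Qed.

(** On an ancestor in which the cube has volume share [th], the mean remains [L] and the variance is
    [th <= 1]. *)
Lemma extremal_bmo : tmean T = L -> bmo_norm dyadic f = 1%E.
Proof.
move=> TLe; apply/eqP; rewrite eq_le; apply/andP; split; last first.
  rewrite -extremal_bmo_on; exact: bmo_norm_sub (fun J => @proj1 _ _).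
apply: ge_ereal_sup => _ [J /dyadic_ncube[i ->] <-].
rewrite lee_fin -[leRHS]sqrtr1 ler_wsqrtr// -/(nmean f i) -/(nmean (fun x => f x ^+ 2) i).
have [[x [ix qx]]|dis] := pselect (exists x : Rn R n, ncube i x /\ ncube q x); last first.
  have e x : ncube i x -> f x = L.
    by move=> ix; rewrite /f memNset// => qx; apply: dis; exists x.
  rewrite (@nmean_eq _ _ i f (fun=> L)) // (@nmean_eq _ _ i _ (fun=> L ^+ 2)); last first.
    by move=> x /e ->.
  by rewrite !nmean_cst subrr.
have [qi|iq] := leP q.1 i.1; first by apply: extremal_var; exact: cube_nested qi ix qx.
have qi : ncube q `<=` (ncube i : set (Rn R n)) := cube_nested (ltW iq) qx ix.
have e1 := extremal_outside nint_extremal qi.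
have e2 := extremal_outside nint_extremal_sq qi.
rewrite -[nmean f i]/(nmean (id \o f) i) e1 -[nmean _ i]/(nmean ((fun x => x ^+ 2) \o f) i) e2.
have -> : nmean (id \o f) q = L by rewrite -TLe -extremal_mean.
have -> : nmean ((fun x => x ^+ 2) \o f) q = L ^+ 2 + 1.
  by rewrite -[LHS]/(nmean (fun x => f x ^+ 2) q) extremal_sq -TLe -var1; ring.
have : vol q.1 / vol i.1 <= 1 by rewrite ler_pdivrMr ?vol_gt0// mul1r vol_le.
by move: (_ / _) => th; lra.
Qed.

Lemma extremal_max_mean : ((tmax al T L)%:E <= emean (ncube q) (natural_max f))%E.
Proof.
have [mf f2] := L2loc_nint q extremal_L2loc.
have [e [he _ _ ->]] := natural_max_integral mf f2 extremal_outer.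
rewrite lee_fin; apply: le_trans (he (height T)).
rewrite -(tmax_smax card_alpha L (leqnn (height T))) le_eqVlt; apply/orP; left; apply/eqP.
apply/esym/(@smax_congr _ _ _ _ _ _ _ _ _ (realizes f)); last exact: extremal_realizes.
- by move=> i S k; exact: realizes_child.
- by move=> i S; exact: (nmean_realizes nint_extremal).
Qed.

Lemma extremal_max_lty x : (natural_max f x < +oo)%E.
Proof.
apply: (@le_lt_trans _ _ (tbound T + `|L|)%:E); last exact: ltry.
apply: ge_ereal_sup => _ [J [/dyadic_ncube[i ->] _] <-].
rewrite lee_fin -[leRHS](nmean_cst i); apply: nmean_le.
- exact: nint_extremal.
- exact: nint_cst.
by move=> y _; exact: le_trans (ler_norm _) (extremal_bound y).
Qed.

End extremal.
End tree_functions.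

(** * Assembly: both operators, and the extremal sequences *)

Section sharpness.
Context {R : realType} {n : nat}.
Hypothesis n_gt0 : (0 < n)%N.
Local Notation node := (int * ('I_n -> int))%type.

(** The two choices of [g] give the two maximal operators, both measured by the norm of [f]. *)
Lemma maximal_bound_of_L1loc (f : Rn R n -> R) (Q : set (Rn R n)) :
  dyadic Q -> L1loc (EFin \o f) ->
  BMOd_on Q f ->
  let c := fine (bmo_norm (dyadic_in Q) f) in
  forall g : Rn R n -> R, g = f \/ g = (fun x => `|f x|) ->
  ~ (forall x, Q x -> natural_max g x = +oo%E) ->
  let L := fine (ess_inf_on Q (natural_max g)) in
  let t := L - mean Q g in
  [/\ ess_inf_on Q (natural_max g) \is a fin_num,
      0 <= t,
      (emean Q (natural_max g) <= (L + Phi n (t / c) * c)%:E)%E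
    & c <= 1 -> (emean Q (natural_max g) <= (L + Phi n t * c)%:E)%E].
Proof.
move=> /dyadic_ncube[q ->] [/measurable_EFinP mf _] [_ f2 bmo] c g gE nfin.
have Cq : dyadic_in (ncube q) (ncube q : set (Rn R n)) by split => //; exact: ncube_dyadic.
have mfD D : measurable_fun D f by exact: measurable_funS mf.
have cE : bmo_norm (dyadic_in (ncube q)) f = c%:E by rewrite fineK// (bmo_norm_fin Cq).
have c0 : 0 <= c by rewrite -lee_fin -cE; exact: bmo_norm_ge0 Cq.
have [mg g2 bg] : [/\ measurable_fun (ncube q) g, nint q (fun x => g x ^+ 2)
    & (bmo_norm (dyadic_in (ncube q)) g <= c%:E)%E].
  case: gE => ->; first by rewrite cE.
  split; first exact: measurableT_comp.
    by under eq_fun do rewrite real_normK ?num_real//.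
  rewrite -cE; apply: bmo_norm_abs => [J []//|i [_ iq]].
  exact: inside_nint f2 _ iq.
have [e t0 _ h1 h2] := maximal_bound n_gt0 mg g2 nfin c0 bg.
by split => //; rewrite e.
Qed.

Lemma maximal_BLO_of_BMO (f g : Rn R n -> R) : BMOd f ->
  g = f \/ g = (fun x => `|f x|) ->
  (forall Q, dyadic Q -> ~ (forall x, Q x -> natural_max g x = +oo%E)) ->
  BLOd (natural_max g) /\ (blo_norm (natural_max g) <= bmo_norm dyadic f)%E.
Proof.
move=> [fL2 bmo] gE nfin; have mf : measurable_fun setT f by case: fL2.
pose i0 : node := (0, fun=> 0).
have fin := bmo_norm_fin (ncube_dyadic i0) bmo.
have c0 : 0 <= fine (bmo_norm dyadic f) by rewrite fine_ge0// (bmo_norm_ge0 f (ncube_dyadic i0)).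
rewrite -(fineK fin); apply: (maximal_BLO n_gt0 _ nfin c0); rewrite ?fineK//.
  case: gE => -> //; split; first exact: measurableT_comp.
  by under eq_fun do rewrite real_normK ?num_real//; case: fL2.
case: gE => -> //; apply: bmo_norm_abs => // i _.
by have [mi i2] := L2loc_nint i fL2; exact: nint_sq.
Qed.

Lemma sharp_local (Q : set (Rn R n)) (L t : R) : dyadic Q -> 0 <= t ->
  exists f : nat -> Rn R n -> R,
    (forall j, [/\ L1loc (EFin \o f j), BMOd_on Q (f j),
        bmo_norm (dyadic_in Q) (f j) = 1%E,
        ess_inf_on Q (natural_max (f j)) = L%:E
      & L - mean Q (f j) = t]) /\
    emean Q (natural_max (f j)) @[j --> \oo] --> (L + Phi n t)%:E.
Proof.
move=> /dyadic_ncube[q ->] t0.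
have inv0 j : 0 < j.+1%:R^-1 :> R by rewrite invr_gt0.
have [T hT] := choice (fun j => achieve_Phi n_gt0 t0 (inv0 j)).
pose S j := tshift L (T j).
have S1 j : tbmo (alpha n) (S j) by have [_ _ h _] := hT j; exact: tbmo_shift.
have S2 j : tmoment (alpha n) id (S j) = L - t.
  by have [h _ _ _] := hT j; rewrite (tmoment_shift _ _ _).1 h addrC.
have S3 j : tmoment (alpha n) (fun x => x ^+ 2) (S j) - tmoment (alpha n) id (S j) ^+ 2 = 1.
  by have [h h' _ _] := hT j; rewrite S2 (tmoment_shift _ _ _).2 h h'; ring.
have S4 j : tmoment (alpha n) id (S j) <= L by rewrite S2 gerBl.
pose f j := extremal q (S j) L; exists f.
have facts j : [/\ L1loc (EFin \o f j), BMOd_on (ncube q) (f j),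
        bmo_norm (dyadic_in (ncube q)) (f j) = 1%E,
        ess_inf_on (ncube q) (natural_max (f j)) = L%:E
      & L - mean (ncube q) (f j) = t].
  have bmo : bmo_norm (dyadic_in (ncube q)) (f j) = 1%E by exact: extremal_bmo_on.
  have [mf f2] := L2loc_nint q (extremal_L2loc q (S j) L).
  split => //.
  - exact: extremal_L1loc.
  - by split => //; rewrite bmo ltry.
  - by apply: (ess_inf_natural_max mf f2); exact: extremal_outer.
  - by rewrite -/(nmean (f j) q) extremal_mean S2 opprB addrC subrK.
split => //; apply: (@squeeze_cvge _ _ _ _ (fun j : nat => (L + Phi n t - j.+1%:R^-1)%:E)
  _ (fun=> (L + Phi n t)%:E)).
- apply: nearW => j; apply/andP; split.
    apply: le_trans (extremal_max_mean n_gt0 q (S4 j)).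
    rewrite lee_fin -[X in tmax _ _ X]add0r tmax_shift.
    by have [_ _ _ h] := hT j; rewrite -addrA [leLHS]addrC lerD2r.
  have [fL fB bmo eL tE] := facts j.
  have nfin : ~ (forall x, ncube q x -> natural_max (f j) x = +oo%E).
    by have [x _ qx] := exists_generic (R := R) q => /(_ x qx) e; have := extremal_max_lty q (S
      j) L x; rewrite -/(f j) e.
  have [_ _ _] := maximal_bound_of_L1loc (ncube_dyadic q) fL fB (or_introl erefl) nfin.
  by rewrite bmo eL /= tE mulr1; apply.
- apply: cvg_EFin; first by apply: nearW.
  rewrite -[X in _ --> X]subr0; apply: cvgB; first exact: cvg_cst.
  exact: cvg_harmonic.
- exact: cvg_cst.
Qed.

Lemma sharp_global : exists f : nat -> Rn R n -> R,
    (forall j, [/\ BMOd (f j), bmo_norm dyadic (f j) = 1%E,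
       forall x, 0 <= f j x & BLOd (natural_max (f j))]) /\
    blo_norm (natural_max (f j)) @[j --> \oo] --> 1%E.
Proof.
have inv0 j : 0 < j.+1%:R^-1 :> R by rewrite invr_gt0.
have [T hT] := choice (fun j => achieve_Phi n_gt0 (lexx 0) (inv0 j)).
pose q : node := (0, fun=> 0).
(* Lifting the tree by a bound for its values makes the function nonnegative, so that one sequence
   serves both operators. *)
pose L j := tbound (T j); pose S j := tshift (L j) (T j).
have S1 j : tbmo (alpha n) (S j) by have [_ _ h _] := hT j; exact: tbmo_shift.
have S2 j : tmoment (alpha n) id (S j) = L j.
  by have [h _ _ _] := hT j; rewrite (tmoment_shift _ _ _).1 h oppr0 add0r.
have S3 j : tmoment (alpha n) (fun x => x ^+ 2) (S j) - tmoment (alpha n) id (S j) ^+ 2 = 1.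
  by have [h h' _ _] := hT j; rewrite S2 (tmoment_shift _ _ _).2 h h'; ring.
have S4 j : tmoment (alpha n) id (S j) <= L j by rewrite S2.
pose f j := extremal q (S j) (L j); exists f.
have bmo j : bmo_norm dyadic (f j) = 1%E by exact: extremal_bmo.
have fB j : BMOd (f j) by split; [exact: extremal_L2loc|rewrite bmo ltry].
have nfin j Q : dyadic Q -> ~ (forall x, Q x -> natural_max (f j) x = +oo%E).
  move=> /dyadic_ncube[i ->]; have [x _ ix] := exists_generic (R := R) i => /(_ x ix) e.
  by have := extremal_max_lty q (S j) (L j) x; rewrite -/(f j) e.
have [blo le1] := all_and2 (fun j => maximal_BLO_of_BMO (fB j) (or_introl erefl) (nfin j)).
split.
  move=> j; split => // x; rewrite /f /extremal; case: ifP => _; last exact: tbound_ge0.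
  by rewrite treal_shift -lerBlDr sub0r; have := treal_bound (T j) q.1 x; rewrite ler_norml =>
    /andP[].
apply: (@squeeze_cvge _ _ _ _ (fun j : nat => (1 - j.+1%:R^-1)%:E) _ (fun=> 1%E)).
- apply: nearW => j; apply/andP; split; last by rewrite -(bmo j).
  have [mf f2] := L2loc_nint q (extremal_L2loc q (S j) (L j)).
  apply: (@le_trans _ _ (emean (ncube q) (natural_max (f j)) - ess_inf_on (ncube q) (natural_max
    (f j)))%E); last first.
    by apply: ereal_sup_ubound; exists (ncube q) => //; exact: ncube_dyadic.
  rewrite (ess_inf_natural_max mf f2 (extremal_outer n_gt0 q (S4 j))) leeBrDr//.
  apply: le_trans (extremal_max_mean n_gt0 q (S4 j)).
  rewrite -EFinD lee_fin -[X in tmax _ _ X]add0r tmax_shift lerD2r.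
  by have [_ _ _ h] := hT j; move: h; rewrite (Phi0 n_gt0).
- apply: cvg_EFin; first by apply: nearW.
  rewrite -[X in _ --> X]subr0; apply: cvgB; first exact: cvg_cst.
  exact: cvg_harmonic.
- exact: cvg_cst.
Qed.

End sharpness.

Theorem theorem1p1 (R : realType) (n : nat) (n_ge1 : (1 <= n)%N) :
  (* (I); since N, t and the BMO norm are homogeneous, t is rescaled by c, and
     the unscaled bound holds when c <= 1 *)
  (forall (Q : set (Rn R n)) (phi : Rn R n -> R),
    dyadic Q -> L1loc (EFin \o phi) ->
    ~ (forall x, Q x -> natural_max phi x = +oo%E) ->
    BMOd_on Q phi ->
    let c := fine (bmo_norm (dyadic_in Q) phi) in
    let L := fine (ess_inf_on Q (natural_max phi)) in
    let t := L - mean Q phi in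
    [/\ ess_inf_on Q (natural_max phi) \is a fin_num,
        0 <= t,
        (emean Q (natural_max phi) <= (L + Phi n (t / c) * c)%:E)%E
      & c <= 1 -> (emean Q (natural_max phi) <= (L + Phi n t * c)%:E)%E]) /\
  (* the properties of Phi *)
  [/\ {in `[0, +oo[ &, {homo (Phi n : R -> R) : s t / s < t >-> t < s}},
      convex_function (`[0, +oo[%classic : set R) (Phi n : R -> R)
    & forall k : nat,
        Phi n (k%:R * (2 `^ (n%:R / 2) - 2 `^ (- (n%:R / 2)))) = 2 ^- (n * k) :> R] /\
  (* (II) *)
  (forall phi : Rn R n -> R, BMOd phi ->
    (forall Q, dyadic Q -> ~ (forall x, Q x -> natural_max phi x = +oo%E)) ->
    BLOd (natural_max phi) /\
    (blo_norm (natural_max phi) <= bmo_norm dyadic phi)%E) /\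
  (* sharpness of (I) *)
  (forall (Q : set (Rn R n)) (L t : R), dyadic Q -> 0 <= t ->
    exists phi : nat -> Rn R n -> R,
      (forall j, [/\ L1loc (EFin \o phi j), BMOd_on Q (phi j),
          bmo_norm (dyadic_in Q) (phi j) = 1%E,
          ess_inf_on Q (natural_max (phi j)) = L%:E
        & L - mean Q (phi j) = t]) /\
      emean Q (natural_max (phi j)) @[j --> \oo] --> (L + Phi n t)%:E) /\
  (* sharpness of (II) *)
  (exists phi : nat -> Rn R n -> R,
    (forall j, [/\ BMOd (phi j), bmo_norm dyadic (phi j) = 1%E
      & BLOd (natural_max (phi j))]) /\
    blo_norm (natural_max (phi j)) @[j --> \oo] --> 1%E) /\
  (* (I) for M phi = N |phi|, with t built on the averages of |phi| *)
  (forall (Q : set (Rn R n)) (phi : Rn R n -> R),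
    dyadic Q -> L1loc (EFin \o phi) ->
    ~ (forall x, Q x -> dyadic_max phi x = +oo%E) ->
    BMOd_on Q phi ->
    let c := fine (bmo_norm (dyadic_in Q) phi) in
    let L := fine (ess_inf_on Q (dyadic_max phi)) in
    let t := L - mean Q (fun x => `|phi x|) in
    [/\ ess_inf_on Q (dyadic_max phi) \is a fin_num,
        0 <= t,
        (emean Q (dyadic_max phi) <= (L + Phi n (t / c) * c)%:E)%E
      & c <= 1 -> (emean Q (dyadic_max phi) <= (L + Phi n t * c)%:E)%E]) /\
  (* (II) and its sharpness for the classical maximal operator *)
  (forall phi : Rn R n -> R, BMOd phi ->
    (forall Q, dyadic Q -> ~ (forall x, Q x -> dyadic_max phi x = +oo%E)) ->
    BLOd (dyadic_max phi) /\
    (blo_norm (dyadic_max phi) <= bmo_norm dyadic phi)%E) /\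
  (exists phi : nat -> Rn R n -> R,
    (forall j, [/\ BMOd (phi j), bmo_norm dyadic (phi j) = 1%E
      & BLOd (dyadic_max (phi j))]) /\
    blo_norm (dyadic_max (phi j)) @[j --> \oo] --> 1%E).
Proof.
split; [|split; [split|split; [|split; [|split; [|split; [|split]]]]]].
- by move=> Q f dQ fL nfin fB c L t; exact: (maximal_bound_of_L1loc n_ge1 dQ fL fB (or_introl erefl) nfin).
- exact: Phi_decr.
- exact: Phi_convex.
- exact: Phi_vertex.
- by move=> f fB nfin; exact: (maximal_BLO_of_BMO n_ge1 fB (or_introl erefl) nfin).
- by move=> Q L t dQ t0; exact: sharp_local.
- have [f [h1 h2]] := sharp_global (R := R) n_ge1.
  by exists f; split => // j; have [] := h1 j.
- by move=> Q f dQ fL nfin fB c L t; exact: (maximal_bound_of_L1loc n_ge1 dQ fL fB (or_intror erefl) nfin).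
- by move=> f fB nfin; exact: (maximal_BLO_of_BMO n_ge1 fB (or_intror erefl) nfin).
have [f [h1 h2]] := sharp_global (R := R) n_ge1.
have e j : dyadic_max (f j) = natural_max (f j).
  have [_ _ f0 _] := h1 j; rewrite -[RHS]/(natural_max (fun x => f j x)).
  by rewrite -[LHS]/(natural_max (fun x => `|f j x|)); congr natural_max; apply/funext => x; rewrite ger0_norm.
exists f; split; first by move=> j; have [] := h1 j; rewrite e.
by under eq_fun do rewrite e.
Qed.
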